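(* Let $p$ be a prime with $p\neq 2,3,19$. If $\left(\frac{p}{19}\right)=-1$, then $$\sum_{k=0}^{p-1}\frac{\binom{2k}{k}\binom{3k}{k}\binom{6k}{3k}}{(-96)^{3k}}\equiv 0\pmod{p^2}.$$ If $\left(\frac{p}{19}\right)=1$ and so $4p=x^2+19y^2$ with $x,y\in\mathbb{Z}$, then $$\sum_{k=0}^{p-1}\frac{\binom{2k}{k}\binom{3k}{k}\binom{6k}{3k}}{(-96)^{3k}}\equiv \left(\frac{-6}{p}\right)x^2\pmod p.$$
   Context: $\left(\frac{a}{q}\right)$ denotes the Legendre symbol. Congruences modulo $p$ and $p^2$ are in the ring of rational numbers whose denominator is coprime to $p$. *)

(* Defs.v *)
From mathcomp Require Import all_boot all_order all_algebra.

Set Implicit Arguments.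
Unset Strict Implicit.
Unset Printing Implicit Defensive.

Import Order.TTheory GRing.Theory Num.Theory.
Local Open Scope ring_scope.

(* Meant for q an odd prime. *)
Definition legendre (a : int) (q : nat) : int :=
  if (q %| a)%Z then 0
  else if [exists x : 'I_q, (q %| x%:Z ^+ 2 - a)%Z] then 1
  else - 1.

Definition pintegral (p : nat) : pred rat :=
  fun x => coprimez p%:Z (denq x).

(* Congruence modulo m in the ring of p-integral rationals; in particular
   both sides are required to lie in that ring. *)
Definition pcongr (p m : nat) (x y : rat) : Prop :=
  [/\ pintegral p x, pintegral p y
    & exists2 z : rat, pintegral p z & x - y = m%:R * z].

Definition binsum (p : nat) : rat :=
  \sum_(0 <= k < p)
    ('C(2 * k, k) * 'C(3 * k, k) * 'C(6 * k, 3 * k))%N%:R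
      / (- 96%:R) ^+ (3 * k).

(* Main.v *)
From HB Require Import structures.
Require Import Defs.
From mathcomp Require Import all_boot all_order all_algebra all_field.
From mathcomp Require Import ring zify.

Set Implicit Arguments.
Unset Strict Implicit.
Unset Printing Implicit Defensive.

Import Order.TTheory GRing.Theory Num.Theory.
Local Open Scope ring_scope.

(** The sum is a value of Clausen's square of a hypergeometric series, and this
    series at the point in question computes the Hasse invariant of an elliptic
    curve with complex multiplication by the ring of integers of [Q(sqrt(-19))].

    Write [a_c = C(3c, c) C(6c, 3c)] and [b_c = C(2c, c) a_c]. Clausen's identity
    [(sum a_c X^c)^2 = sum b_c (X (1 - 432 X))^c] holds for the truncations at
    [c < p] modulo [p^2], because the products [a_i a_j] with [i + j >= p] and the
    [b_c] with [2 c >= p] are divisible by [p^2] ([clausen_truncated],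
    [clausen_mod]). The argument [(-96)^(-3)] is [X (1 - 432 X)] for [X] in
    [Q(sqrt 114)], so that the sum is modulo [p^2] the square of
    [s + u sqrt 114], where [s^2 + 114 u^2] is the sum and [2 s u] is divisible by
    [p^2] ([binsum_int_square]). Modulo [p] the number [s + u sqrt 114] is, up to
    a factor whose square is the Legendre symbol of -6, the coefficient of
    [x^(p-1)] in [(x^3 + 8 x + 4 t - 2)^((p-1)/2)], where
    [t = (1 + sqrt(-19)) / 2]: expand this cubic around one of its critical points
    ([hasse_series], [hasse_cm_series]). That coefficient is the Hasse invariant of
    the curve [y^2 = x^3 + 8 x + 4 t - 2], on which [t] acts as an explicit
    endomorphism of degree 5 ([cm_equation], [cm_differential]).

    If [p] is inert in [Q(sqrt(-19))], then [t] is not fixed by the [p]-th power.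
    Pulling back the differential by the endomorphism multiplies the Hasse
    invariant by [t] on one side and by [t^p] on the other, so it vanishes
    ([hasse_inert]). Applied to both square roots of 114 this makes [s] and [u]
    divisible by [p], and the sum divisible by [p^2].

    If [p] splits, then [p = m^2 + m n + 5 n^2] with [m + n t = 0] in the residue
    field. The endomorphism [m + n t] kills the differential and has degree [p],
    so it factors through Frobenius and equals it up to sign
    ([inseparable_degree_p]). The degree being a quadratic form
    ([degree_form]), Frobenius minus the identity has degree
    [p + 1 -+ (2 m + n)]; by the addition formula this degree is the number of
    points over the prime field, which is one minus the Hasse invariant modulo [p]
    ([frobenius_sub_id_hasse]). So the square of the Hasse invariant is
    [(2 m + n)^2 = x^2] ([hasse_split]). Only [p = 5], where the degree of the
    endomorphism [t] is itself divisible by [p], is done by hand.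

    Endomorphisms of the curve are treated as points of its twist over the field
    of rational functions, so that they form a group; the degree of such a point
    is the degree of its abscissa, and the parallelogram law for it follows from
    the formulas for the abscissas of a sum and a difference
    ([degree_parallelogram]). *)

(** * The group law on a twisted Weierstrass cubic *)

(** The affine equation is [c y^2 = x^3 + a x + b].  The twisting factor [c]
    is kept because the curve of interest lives over a rational function field,
    with [c] the cubic evaluated at the variable: its points are then the
    rational self-maps [(x, y) |-> (X x, y * Y x)] of the untwisted curve. *)
Record twisted_cubic (K : fieldType) := TwistedCubic {
  cub_c : K; cub_a : K; cub_b : K;
  cub_c_neq0 : cub_c != 0;
  cub_disc_neq0 : 4 * cub_a ^+ 3 + 27 * cub_b ^+ 2 != 0;
  cub_2_neq0 : (2 : K) != 0 }.

Section GroupLaw.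
Variables (K : fieldType) (E : twisted_cubic K).
Local Notation c := (cub_c E).
Local Notation a := (cub_a E).
Local Notation b := (cub_b E).
Implicit Types (p q r : option (K * K)) (x y s : K).

Definition on_cubic p : bool :=
  if p is Some (x, y) then c * y ^+ 2 == x ^+ 3 + a * x + b else true.

Definition opp_cubic p := if p is Some (x, y) then Some (x, - y) else None.

Definition slope x1 y1 x2 y2 :=
  if x1 == x2 then (3 * x1 ^+ 2 + a) / (2 * c * y1) else (y2 - y1) / (x2 - x1).

Definition third x1 y1 x2 s :=
  let x3 := c * s ^+ 2 - x1 - x2 in Some (x3, - (y1 + s * (x3 - x1))).

Definition add_cubic p q :=
  if p isn't Some (x1, y1) then q else
  if q isn't Some (x2, y2) then p else
  if q == opp_cubic p then None else third x1 y1 x2 (slope x1 y1 x2 y2).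

(** Subtracting the equations of two points and cancelling [x2 - x1] turns the
    chord condition into the second equation; keeping both of them treats
    chords and tangents alike. *)
Definition is_slope x1 y1 x2 y2 s :=
  y2 - y1 = s * (x2 - x1) /\
  c * s * (y1 + y2) = x1 ^+ 2 + x1 * x2 + x2 ^+ 2 + a.

Let c0 := cub_c_neq0 E.
Let two0 := cub_2_neq0 E.

Lemma opp_cubicK : involutive opp_cubic.
Proof. by case=> [[x y]|] //=; rewrite opprK. Qed.

Lemma opp_on_cubic p : on_cubic p -> on_cubic (opp_cubic p).
Proof. by case: p => [[x y]|] //=; rewrite sqrrN. Qed.

Lemma same_x x y1 y2 : on_cubic (Some (x, y1)) -> on_cubic (Some (x, y2)) ->
  y2 = y1 \/ y2 = - y1.
Proof.
move=> /= /eqP e1 /eqP e2; have /eqP : y2 ^+ 2 = y1 ^+ 2.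
  by apply: (mulfI c0); rewrite e1 e2.
by rewrite eqf_sqr => /orP[/eqP|/eqP]; [left|right].
Qed.

Lemma slopeP x1 y1 x2 y2 :
  on_cubic (Some (x1, y1)) -> on_cubic (Some (x2, y2)) ->
  Some (x2, y2) != opp_cubic (Some (x1, y1)) ->
  is_slope x1 y1 x2 y2 (slope x1 y1 x2 y2).
Proof.
move=> o1 o2 nv; rewrite /slope /is_slope; case: eqVneq => [e|ne].
  move: o2 nv; rewrite -e => o2 nv; rewrite subrr mulr0.
  have [e2|e2] := same_x o1 o2; last by move: nv; rewrite e2 eqxx.
  have y0 : y1 != 0.
    by apply: contraNneq nv => y0; rewrite e2 y0 /= oppr0.
  rewrite e2 subrr; split=> //; field.
  by rewrite ?two0 ?c0 ?y0.
have d0 : x2 - x1 != 0 by rewrite subr_eq0 eq_sym.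
split; first by field.
move: o1 o2 => /= /eqP o1 /eqP o2.
have -> : c * ((y2 - y1) / (x2 - x1)) * (y1 + y2) =
  (c * y2 ^+ 2 - c * y1 ^+ 2) / (x2 - x1) by field.
by rewrite o1 o2; field.
Qed.

Lemma slope_uniq x1 y1 x2 y2 s t :
  Some (x2, y2) != opp_cubic (Some (x1, y1)) ->
  is_slope x1 y1 x2 y2 s -> is_slope x1 y1 x2 y2 t -> s = t.
Proof.
move=> nv [e1 e2] [f1 f2]; have [ex|nx] := eqVneq x1 x2; last first.
  apply: (@mulIf _ (x2 - x1)); first by rewrite subr_eq0 eq_sym.
  by rewrite -e1 -f1.
have y0 : y1 + y2 != 0.
  apply: contraNneq nv => /eqP; rewrite addrC addr_eq0 => /eqP ->.
  by rewrite ex.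
by apply: (mulfI c0); apply: (mulIf y0); rewrite e2 f2.
Qed.

Lemma add_third x1 y1 x2 y2 s :
  on_cubic (Some (x1, y1)) -> on_cubic (Some (x2, y2)) ->
  Some (x2, y2) != opp_cubic (Some (x1, y1)) ->
  is_slope x1 y1 x2 y2 s ->
  add_cubic (Some (x1, y1)) (Some (x2, y2)) = third x1 y1 x2 s.
Proof.
move=> o1 o2 nv e; rewrite /add_cubic (negPf nv).
by rewrite (slope_uniq nv (slopeP o1 o2 nv) e).
Qed.

Lemma is_slope_sym x1 y1 x2 y2 s : is_slope x1 y1 x2 y2 s -> is_slope x2 y2 x1 y1 s.
Proof.
move=> [e1 e2]; split; first by rewrite -opprB e1 -mulrN opprB.
by rewrite addrC e2; ring.
Qed.

Lemma is_slope_opp x1 y1 x2 y2 s :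
  is_slope x1 y1 x2 y2 s -> is_slope x1 (- y1) x2 (- y2) (- s).
Proof. by move=> [e1 e2]; split; [rewrite mulNr -e1 | rewrite -e2]; ring. Qed.

Lemma is_slope_third x1 y1 x2 y2 s x3 : is_slope x1 y1 x2 y2 s ->
  x3 = c * s ^+ 2 - x1 - x2 -> is_slope x1 y1 x3 (y1 + s * (x3 - x1)) s.
Proof.
move=> [e1 e2] ->; split; first by ring.
have -> : a = c * s * (y1 + (y1 + s * (x2 - x1))) - (x1 ^+ 2 + x1 * x2 + x2 ^+ 2).
  by rewrite -e1 [y1 + (y2 - y1)]addrC subrK e2; ring.
by ring.
Qed.

Lemma third_on_cubic x1 y1 x2 y2 s : on_cubic (Some (x1, y1)) ->
  is_slope x1 y1 x2 y2 s -> on_cubic (third x1 y1 x2 s).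
Proof.
move=> /= /eqP o1 [e1 e2]; apply/eqP.
have -> : b = c * y1 ^+ 2 - x1 ^+ 3 - a * x1 by rewrite o1; ring.
have -> : a = c * s * (y1 + (y1 + s * (x2 - x1))) - (x1 ^+ 2 + x1 * x2 + x2 ^+ 2).
  by rewrite -e1 [y1 + (y2 - y1)]addrC subrK e2; ring.
by ring.
Qed.

Lemma add_on_cubic p q : on_cubic p -> on_cubic q -> on_cubic (add_cubic p q).
Proof.
case: p => [[x1 y1]|] //; case: q => [[x2 y2]|] // o1 o2.
rewrite /add_cubic; case: ifPn => // nv.
exact: third_on_cubic o1 (slopeP o1 o2 nv).
Qed.

Lemma add_oppl p : add_cubic (opp_cubic p) p = None.
Proof. by case: p => [[x y]|] //=; rewrite opprK eqxx. Qed.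

Lemma add_oppr p : add_cubic p (opp_cubic p) = None.
Proof. by rewrite -{1}[p]opp_cubicK add_oppl. Qed.

Lemma add_cubic0 p : add_cubic p None = p.
Proof. by case: p => [[]|]. Qed.

Lemma eq_opp_cubic p q : (q == opp_cubic p) = (p == opp_cubic q).
Proof. by rewrite -(inj_eq (inv_inj opp_cubicK)) opp_cubicK eq_sym. Qed.

Lemma add_cubicC p q : on_cubic p -> on_cubic q -> add_cubic p q = add_cubic q p.
Proof.
case: p => [[x1 y1]|]; case: q => [[x2 y2]|] // o1 o2.
have [e|nv] := boolP (Some (x2, y2) == opp_cubic (Some (x1, y1))).
  rewrite /add_cubic e; by rewrite eq_opp_cubic in e; rewrite e.
have sl := slopeP o1 o2 nv; rewrite (add_third o1 o2 nv sl).
rewrite eq_opp_cubic in nv; rewrite (add_third o2 o1 nv (is_slope_sym sl)) /third.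
move: (slope _ _ _ _) sl => s [e1 _].
have -> : y2 = y1 + s * (x2 - x1) by rewrite -e1; ring.
by congr Some; congr pair; ring.
Qed.

Lemma opp_add_cubic p q : on_cubic p -> on_cubic q ->
  opp_cubic (add_cubic p q) = add_cubic (opp_cubic p) (opp_cubic q).
Proof.
case: p => [[x1 y1]|]; case: q => [[x2 y2]|] // o1 o2.
have [e|nv] := boolP (Some (x2, y2) == opp_cubic (Some (x1, y1))).
  have := e; rewrite -(inj_eq (inv_inj opp_cubicK)) => e'.
  by rewrite /add_cubic e e'.
have sl := slopeP o1 o2 nv; rewrite (add_third o1 o2 nv sl).
have := nv; rewrite -(inj_eq (inv_inj opp_cubicK)) => nv'.
rewrite (add_third (opp_on_cubic o1) (opp_on_cubic o2) nv' (is_slope_opp sl)).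
by rewrite /third /=; congr Some; congr pair; ring.
Qed.

(** A singular point would be a double point of every line through it. *)
Lemma cubic_nonsingular x : on_cubic (Some (x, 0)) -> 3 * x ^+ 2 + a != 0.
Proof.
move=> /= /eqP; rewrite expr0n mulr0 => /esym ob; apply/eqP => oa.
have : b = (x ^+ 3 + a * x + b) - x ^+ 3 - a * x by ring.
rewrite ob => eb.
have ea : a = - (3 * x ^+ 2) by apply/eqP; rewrite -addr_eq0 addrC oa.
by case/eqP: (cub_disc_neq0 E); rewrite eb ea; ring.
Qed.

Lemma add_cubicK p q : on_cubic p -> on_cubic q ->
  add_cubic (opp_cubic p) (add_cubic p q) = q.
Proof.
case: p => [[x1 y1]|]; case: q => [[x2 y2]|] // o1 o2; last first.
  by rewrite [add_cubic (Some _) None]/= add_oppl.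
have [e|nv] := boolP (Some (x2, y2) == opp_cubic (Some (x1, y1))).
  by rewrite [add_cubic (Some _) _]/add_cubic e (eqP e).
have sl := slopeP o1 o2 nv; have o3 := third_on_cubic o1 sl.
rewrite (add_third o1 o2 nv sl); set s := slope _ _ _ _ in sl o3 *.
set x3 := c * s ^+ 2 - x1 - x2.
have sl3 := is_slope_third sl (erefl x3).
have slm := is_slope_opp sl3.
rewrite /third -/x3 in o3 *.
have nv3 : Some (x3, - (y1 + s * (x3 - x1))) != opp_cubic (opp_cubic (Some (x1, y1))).
  rewrite opp_cubicK; apply/eqP => -[ex ey]; case: sl3 => _; rewrite ex.
  rewrite ex subrr mulr0 addr0 in ey *; have y0 : y1 = 0.
    have /eqP : 2 * y1 = 0 by rewrite mulr_natl mulr2n -{1}ey addNr.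
    by rewrite mulf_eq0 (negPf two0) => /eqP.
  rewrite y0 in o1; rewrite y0 addr0 mulr0 => /esym e0.
  by case/eqP: (cubic_nonsingular o1); rewrite -e0; ring.
rewrite (add_third (opp_on_cubic o1) o3 nv3 slm) /third.
case: sl => e1 _; have -> : y2 = y1 + s * (x2 - x1) by rewrite -e1; ring.
by congr Some; congr pair; rewrite /x3; ring.
Qed.

Lemma is_slopeE x1 y1 x2 y2 s : is_slope x1 y1 x2 y2 s ->
  Some (x2, y2) != opp_cubic (Some (x1, y1)) ->
  (x2 - x1 != 0 /\ s = (y2 - y1) / (x2 - x1)) \/
  (y1 + y2 != 0 /\ s = (x1 ^+ 2 + x1 * x2 + x2 ^+ 2 + a) / (c * (y1 + y2))).
Proof.
move=> [e1 e2] nv; have [ex|nx] := eqVneq x2 x1; last first.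
  have d : x2 - x1 != 0 by rewrite subr_eq0.
  by left; split=> //; rewrite e1; field.
have d : y1 + y2 != 0.
  apply: contraNneq nv => /eqP; rewrite addrC addr_eq0 => /eqP ->.
  by rewrite ex.
by right; split=> //; rewrite -e2; field; rewrite ?c0 ?d.
Qed.

(** The three points and the curve are rationally parametrised by the two
    slopes and the three abscissas, so associativity in general position is an
    identity between rational functions. *)
Lemma third_assoc x1 y1 x2 y2 x3 y3 s t x12 y12 x23 y23 u v :
  is_slope x2 y2 x1 y1 s -> is_slope x2 y2 x3 y3 t -> s != t ->
  x12 = c * s ^+ 2 - x2 - x1 -> y12 = - (y2 + s * (x12 - x2)) ->
  x23 = c * t ^+ 2 - x2 - x3 -> y23 = - (y2 + t * (x23 - x2)) ->
  is_slope x12 y12 x3 y3 u -> Some (x3, y3) != opp_cubic (Some (x12, y12)) ->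
  is_slope x1 y1 x23 y23 v -> Some (x23, y23) != opp_cubic (Some (x1, y1)) ->
  third x12 y12 x3 u = third x1 y1 x23 v.
Proof.
move=> [e1 e2] [f1 f2] st ex12 ey12 ex23 ey23 hu nu hv nv.
have d : s - t != 0 by rewrite subr_eq0.
have E1 : y1 = y2 + s * (x1 - x2) by rewrite -e1; ring.
have E3 : y3 = y2 + t * (x3 - x2) by rewrite -f1; ring.
have Ea : a = c * s * (y2 + y1) - (x2 ^+ 2 + x2 * x1 + x1 ^+ 2).
  by rewrite e2; ring.
have E2 : y2 = (x1 ^+ 2 + x1 * x2 - x3 ^+ 2 - x3 * x2
   - c * s ^+ 2 * (x1 - x2) + c * t ^+ 2 * (x3 - x2)) / (2 * c * (s - t)).
  move: e2 f2; rewrite E1 E3 => e2 f2.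
  have -> : x1 ^+ 2 + x1 * x2 - x3 ^+ 2 - x3 * x2 =
    (x2 ^+ 2 + x2 * x1 + x1 ^+ 2 + a) - (x2 ^+ 2 + x2 * x3 + x3 ^+ 2 + a) by ring.
  by rewrite -e2 -f2; field; rewrite ?two0 ?c0 ?d.
case: (is_slopeE hu nu) => -[{}nu ->]; case: (is_slopeE hv nv) => -[{}nv ->].
all: move: nu nv; rewrite ?Ea ?ey12 ?ey23 ?ex12 ?ex23 ?E1 ?E3 ?E2 => nu nv.
all: rewrite /third; congr Some; congr pair.
all: field; rewrite ?two0 ?c0 ?d ?nu ?nv ?andbT //=.
(* What is left are denominators equal to those of [u] or [v] up to the
   factor [2 c (s - t)] that comes from eliminating [y2]. *)
all: have den : 2 * c * (s - t) != 0 by rewrite !mulf_neq0.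
all: try (apply/andP; split).
all: solve
  [ apply: contra_neq nu => H; apply: (mulIf den);
    rewrite mul0r -[RHS]H; field; rewrite ?two0 ?c0 ?d //
  | apply: contra_neq nv => H; apply: (mulIf den);
    rewrite mul0r -[RHS]H; field; rewrite ?two0 ?c0 ?d // ].
Qed.

Lemma add_cubicA p q r : on_cubic p -> on_cubic q -> on_cubic r ->
  add_cubic p (add_cubic q r) = add_cubic (add_cubic p q) r.
Proof.
move=> op oq or.
have [pn|p0] := eqVneq p None; first by rewrite pn.
have [qn|q0] := eqVneq q None; first by rewrite qn add_cubic0.
have [rn|r0] := eqVneq r None; first by rewrite rn !add_cubic0.
have C := add_cubicC; have K' := add_cubicK; have O := opp_on_cubic.
have [eqp|npq] := eqVneq q (opp_cubic p).
  by rewrite eqp add_oppr -{1}[p]opp_cubicK K' ?O.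
have [erq|nqr] := eqVneq r (opp_cubic q).
  rewrite erq add_oppr add_cubic0 [RHS]C ?add_on_cubic ?O //.
  by rewrite [add_cubic p q]C // K'.
have opq := add_on_cubic op oq; have oqr := add_on_cubic oq or.
have [e1|n1] := eqVneq r (opp_cubic (add_cubic p q)).
  have -> : add_cubic q r = opp_cubic p.
    rewrite e1 opp_add_cubic // [add_cubic (opp_cubic p) _]C ?O //.
    by rewrite -{1}[q]opp_cubicK K' ?O.
  by rewrite e1 !add_oppr.
have [e2|n2] := eqVneq p (opp_cubic (add_cubic q r)).
  have -> : add_cubic p q = opp_cubic r.
    by rewrite C // e2 opp_add_cubic // -{1}[q]opp_cubicK K' ?O.
  by rewrite e2 !add_oppl.
have n2' : add_cubic q r != opp_cubic p by rewrite eq_opp_cubic.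
case: p op p0 npq opq n1 n2 n2' => [[x1 y1]|] // op _ npq opq n1 n2 n2'.
case: q oq q0 npq nqr opq oqr n1 n2 n2' => [[x2 y2]|] // oq _ npq nqr opq oqr n1 n2 n2'.
case: r or r0 nqr oqr n1 n2 n2' => [[x3 y3]|] // or _ nqr oqr n1 n2 n2'.
have npq' : Some (x1, y1) != opp_cubic (Some (x2, y2)) by rewrite eq_opp_cubic.
move: opq oqr n1 n2'; rewrite [add_cubic (Some (x1, y1)) _]C //.
have sl := slopeP oq op npq'; have tl := slopeP oq or nqr.
rewrite (add_third oq op npq' sl) (add_third oq or nqr tl).
move: (slope _ _ _ _) (slope _ _ _ _) sl tl => t s sl tl.
set x12 := c * s ^+ 2 - x2 - x1; set x23 := c * t ^+ 2 - x2 - x3.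
rewrite /third -/x12 -/x23 => opq oqr n1 n2'.
have [est|nst] := eqVneq s t; last first.
  have ul := slopeP opq or n1; have vl := slopeP op oqr n2'.
  rewrite (add_third op oqr n2' vl) (add_third opq or n1 ul); symmetry.
  exact: (third_assoc sl tl nst (erefl _) (erefl _) (erefl _) (erefl _) ul n1 vl n2').
(* With equal slopes the three points are collinear, and then either [p = r]
   or [r] is opposite to [p + q]. *)
rewrite -est in tl; case: sl tl => [s1 s2] [t1 t2].
have /eqP : (x1 - x3) * (c * s ^+ 2 - x1 - x3 - x2) = 0.
  have -> : (x1 - x3) * (c * s ^+ 2 - x1 - x3 - x2) =
    c * s * (s * (x1 - x2) - s * (x3 - x2)) -
      ((x2 ^+ 2 + x2 * x1 + x1 ^+ 2 + a) - (x2 ^+ 2 + x2 * x3 + x3 ^+ 2 + a)).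
    by ring.
  by rewrite -s1 -t1 -s2 -t2; ring.
rewrite mulf_eq0 => /orP[|] /eqP e.
  have e13 : x1 = x3 by apply/eqP; rewrite -subr_eq0 e.
  have f13 : y1 = y3.
    by apply: (addIr (- y2)); rewrite s1 t1 e13.
  by rewrite [RHS]C // /x12 /x23 -est e13 f13.
case/eqP: n1; have e3 : x3 = x12 by apply/eqP; rewrite -subr_eq0 -oppr_eq0 -e /x12; apply/eqP; ring.
rewrite /= opprK; congr Some; congr pair => //.
by rewrite -e3 -t1; ring.
Qed.

Record point := Point { coords : option (K * K); _ : on_cubic coords }.
HB.instance Definition _ := [isSub for coords].
HB.instance Definition _ := [Choice of point by <:].

Definition point0 := @Point None isT.
Definition opp_point (P : point) := Point (opp_on_cubic (valP P)).
Definition add_point (P Q : point) := Point (add_on_cubic (valP P) (valP Q)).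

Lemma add_pointA : associative add_point.
Proof. by move=> P Q R; apply/val_inj/add_cubicA; apply: valP. Qed.
Lemma add_pointC : commutative add_point.
Proof. by move=> P Q; apply/val_inj/add_cubicC; apply: valP. Qed.
Lemma add_point0 : left_id point0 add_point.
Proof. by move=> P; apply/val_inj. Qed.
Lemma add_pointN : left_inverse point0 opp_point add_point.
Proof. by move=> P; apply/val_inj/add_oppl. Qed.

HB.instance Definition _ :=
  GRing.isZmodule.Build point add_pointA add_pointC add_point0 add_pointN.

Lemma coordsD (P Q : point) : coords (P + Q) = add_cubic (coords P) (coords Q).
Proof. by []. Qed.
Lemma coordsN (P : point) : coords (- P) = opp_cubic (coords P).
Proof. by []. Qed.
Lemma coords_on (P : point) : on_cubic (coords P).
Proof. exact: valP. Qed.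

End GroupLaw.

(** * Abscissas of a sum and a difference *)

(** The symmetric functions of the abscissas of [P + Q] and [P - Q], as forms
    of bidegree (2, 2) in the abscissas [n1 : d1] and [n2 : d2]. *)
Section Forms.
Variable R : comPzRingType.
Implicit Types (a b n d : R).
Definition form_den n1 d1 n2 d2 := (n1 * d2 - n2 * d1) ^+ 2.
Definition form_sum a b n1 d1 n2 d2 :=
  2 * (n1 * d2 + n2 * d1) * (a * d1 * d2 + n1 * n2) + 4 * b * d1 ^+ 2 * d2 ^+ 2.
Definition form_prod a b n1 d1 n2 d2 :=
  (n1 * n2 - a * d1 * d2) ^+ 2 - 4 * b * d1 * d2 * (n1 * d2 + n2 * d1).
End Forms.

(** The three forms have no common zero on a product of projective lines:
    on the diagonal they reduce to the numerator and the denominator of the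
    duplication formula, which are coprime when the cubic has distinct roots. *)
Lemma forms_neq0 (F : fieldType) (a b n1 d1 n2 d2 : F) :
  (2 : F) != 0 -> 4 * a ^+ 3 + 27 * b ^+ 2 != 0 ->
  (n1, d1) != (0, 0) -> (n2, d2) != (0, 0) ->
  [|| form_den n1 d1 n2 d2 != 0, form_sum a b n1 d1 n2 d2 != 0
    | form_prod a b n1 d1 n2 d2 != 0].
Proof.
move=> h2 disc v1 v2; rewrite -!negb_and; apply/negP => /and3P[/eqP u0 /eqP u1 /eqP u2].
move: u0 => /eqP; rewrite /form_den expf_eq0 /= subr_eq0 => /eqP u0.
have [d10|d1n] := eqVneq d1 0.
  have n10 : n1 != 0 by move: v1; rewrite d10 xpair_eqE eqxx andbT.
  have /eqP := u0; rewrite d10 mulr0 mulf_eq0 (negPf n10) /= => /eqP d20.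
  have n20 : n2 != 0 by move: v2; rewrite d20 xpair_eqE eqxx andbT.
  move: u2; rewrite /form_prod d10 d20 => /eqP.
  by rewrite !(mulr0, mul0r, subr0) expf_eq0 /= mulf_eq0 (negPf n10) (negPf n20).
have [d20|d2n] := eqVneq d2 0.
  have n20 : n2 != 0 by move: v2; rewrite d20 xpair_eqE eqxx andbT.
  by have /eqP := u0; rewrite d20 mulr0 eq_sym mulf_eq0 (negPf n20) (negPf d1n).
pose x := n1 / d1.
have en1 : n1 = x * d1 by rewrite /x; field.
have en2 : n2 = x * d2 by apply: (mulIf d1n); rewrite -u0 en1; ring.
have f0 : x ^+ 3 + a * x + b = 0.
  have : 4 * d1 ^+ 2 * d2 ^+ 2 * (x ^+ 3 + a * x + b) = 0.
    by rewrite -u1 /form_sum en1 en2; ring.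
  move/eqP; rewrite mulf_eq0 => /orP[|/eqP //].
  by rewrite (_ : 4 = 2 * 2); last ring; rewrite !mulf_eq0 ?expf_eq0 (negPf h2) (negPf d1n) (negPf d2n).
have f1 : 3 * x ^+ 2 + a = 0.
  have : d1 ^+ 2 * d2 ^+ 2 * ((3 * x ^+ 2 + a) ^+ 2 - 8 * x * (x ^+ 3 + a * x + b)) = 0.
    by rewrite -u2 /form_prod en1 en2; ring.
  rewrite f0 mulr0 subr0 => /eqP.
  by rewrite !mulf_eq0 ?expf_eq0 /= (negPf d1n) (negPf d2n) ?orbb => /eqP.
have : b = (x ^+ 3 + a * x + b) - x ^+ 3 - a * x by ring.
rewrite f0 => eb; have ea : a = - (3 * x ^+ 2) by apply/eqP; rewrite -addr_eq0 addrC f1.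
by case/eqP: disc; rewrite eb ea; ring.
Qed.

Section SumDiff.
Variables (K : fieldType) (E : twisted_cubic K).
Local Notation c := (cub_c E).
Local Notation a := (cub_a E).
Local Notation b := (cub_b E).

Definition proj_x (p : option (K * K)) : K * K :=
  if p is Some (x, _) then (x, 1) else (1, 0).

Lemma proj_x_opp p : proj_x (opp_cubic p) = proj_x p.
Proof. by case: p => [[x y]|]. Qed.

(** The factor [l] is the price of homogeneous coordinates. The identities are
    those of [x1], [x2] alone once [a] and [b] are expressed by the coordinates
    of the points; tangents and points of order 2 need separate expressions. *)
Lemma sum_diff_proj_x (P Q : point E) n1 d1 n2 d2 n3 d3 n4 d4 :
  proj_x (coords P) = (n1, d1) -> proj_x (coords Q) = (n2, d2) ->
  proj_x (coords (P + Q)) = (n3, d3) -> proj_x (coords (P - Q)) = (n4, d4) ->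
  exists2 l, l != 0 & [/\ form_den n1 d1 n2 d2 = l * (d3 * d4),
    form_sum a b n1 d1 n2 d2 = l * (n3 * d4 + n4 * d3)
    & form_prod a b n1 d1 n2 d2 = l * (n3 * n4)].
Proof.
have c0 := cub_c_neq0 E; have two0 := cub_2_neq0 E.
rewrite !coordsD coordsN; move: (coords_on P) (coords_on Q).
case: (coords P) => [[x1 y1]|] op; last first.
  move=> oq; rewrite ![add_cubic _ None _]/= proj_x_opp.
  rewrite /= => -[<- <-] -> [-> ->] [-> ->].
  exists 1; first exact: oner_neq0.
  by rewrite /form_den /form_sum /form_prod; split; ring.
case: (coords Q) => [[x2 y2]|] oq; last first.
  rewrite !add_cubic0 /= => -[<- <-] [<- <-] [<- <-] [<- <-].
  exists 1; first exact: oner_neq0.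
  by rewrite /form_den /form_sum /form_prod; split; ring.
rewrite /= => -[<- <-] [<- <-] {n1 d1 n2 d2}.
have [ex|nx] := eqVneq x1 x2; last first.
  have d : x1 - x2 != 0 by rewrite subr_eq0.
  have d' : x2 - x1 != 0 by rewrite subr_eq0 eq_sym.
  rewrite /slope (negPf nx) /=.
  rewrite !(inj_eq (@Some_inj _)) !xpair_eqE ![x2 == _]eq_sym (negPf nx) /=.
  move=> -[<- <-] [<- <-]; exists ((x1 - x2) ^+ 2); first by rewrite expf_neq0.
  move: op oq => /= /eqP e1 /eqP e2.
  have eb : b = c * y1 ^+ 2 - x1 ^+ 3 - a * x1 by rewrite e1; ring.
  have ea : a = (c * y2 ^+ 2 - c * y1 ^+ 2 - x2 ^+ 3 + x1 ^+ 3) / (x2 - x1).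
    by rewrite e1 e2; field.
  rewrite /form_den /form_sum /form_prod eb ea.
  by split; field; rewrite ?d ?d'.
move: oq; rewrite -ex => oq {x2 ex}.
wlog -> : y2 oq n3 d3 n4 d4 / y2 = y1.
  move=> W; have [->|->] := same_x op oq; first exact: (W y1).
  rewrite opprK => e4 e3.
  have [||l l0 [h1 h2 h3]] := W y1 op n4 d4 n3 d3 (erefl _).
  - by rewrite e3.
  - by rewrite e4.
  by exists l => //; rewrite h1 h2 h3; split=> //; ring.
move: op => /= /eqP e1; rewrite [Some (x1, - y1) == Some (x1, - y1)]eqxx /= => h3 [<- <-].
have [y0|y0] := eqVneq y1 0.
  move: h3; rewrite y0 oppr0 eqxx => -[<- <-].
  have o0 : on_cubic E (Some (x1, 0)) by rewrite /= -y0 e1.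
  exists ((3 * x1 ^+ 2 + a) ^+ 2); first by rewrite expf_neq0 ?cubic_nonsingular.
  have eb : b = - x1 ^+ 3 - a * x1.
    apply/eqP; rewrite -subr_eq0; move: o0 => /= /eqP; rewrite expr0n mulr0 => h.
    by apply/eqP; rewrite [RHS]h; ring.
  by rewrite /form_den /form_sum /form_prod eb; split; ring.
move: h3; rewrite (inj_eq (@Some_inj _)) xpair_eqE eqxx /= -addr_eq0 -mulr2n -mulr_natl.
rewrite mulf_eq0 (negPf two0) (negPf y0) /= /slope eqxx => -[<- <-].
have four0 : (4 : K) != 0 by rewrite (_ : 4 = 2 * 2); [rewrite mulf_neq0 | ring].
exists (4 * c * y1 ^+ 2); first by rewrite !mulf_neq0 ?expf_neq0.
have eb : b = c * y1 ^+ 2 - x1 ^+ 3 - a * x1 by rewrite e1; ring.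
by rewrite /form_den /form_sum /form_prod eb; split; field; rewrite ?two0 ?c0 ?y0.
Qed.

End SumDiff.

(** * Primitive families of polynomials *)

Section Primitive.
Variable k : closedFieldType.
Implicit Types (N D u v : {poly k}) (s : seq {poly k}) (z : option k).

(** The value of a form of degree [d] in two variables, dehomogenised to a
    polynomial, at a point of the projective line; [None] is infinity. *)
Definition pval d z N := if z is Some t then N.[t] else N`_d.

(** Coprimality as forms of degree [d]: a common zero at infinity counts too, so
    that [d] is the degree of the map that the family defines. *)
Definition primitive d s :=
  all (fun N => size N <= d.+1)%N s /\
  forall z, has (fun N => pval d z N != 0) s.

Lemma pvalD d z N D : pval d z (N + D) = pval d z N + pval d z D.
Proof. by case: z => [t|] /=; rewrite ?hornerD ?coefD. Qed.

Lemma pvalN d z N : pval d z (- N) = - pval d z N.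
Proof. by case: z => [t|] /=; rewrite ?hornerN ?coefN. Qed.

Lemma pvalZ d z a N : pval d z (a *: N) = a * pval d z N.
Proof. by case: z => [t|] /=; rewrite ?hornerZ ?coefZ. Qed.

Lemma pvalM d e z N D : (size N <= d.+1)%N -> (size D <= e.+1)%N ->
  pval (d + e) z (N * D) = pval d z N * pval e z D.
Proof.
move=> hN hD; case: z => [t|] /=; first by rewrite hornerM.
rewrite coefM (bigD1 (inord d)) //= inordK ?ltnS ?leq_addr // addKn.
rewrite big1 ?addr0 // => i; rewrite -val_eqE /= inordK ?ltnS ?leq_addr // => ni.
have [hi|hi] := ltnP d i.
  by rewrite [N`_i]nth_default ?mul0r // (leq_trans hN).
rewrite [D`_ _]nth_default ?mulr0 // (leq_trans hD) //.
have : (i < d)%N by rewrite ltn_neqAle ni.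
by move=> lt; rewrite ltn_subRL ltn_add2r.
Qed.

Lemma primitive_scale_le d e s s' u v :
  primitive d s -> primitive e s' -> u != 0 -> v != 0 ->
  [seq u * N | N <- s] = [seq v * N | N <- s'] ->
  (d <= e)%N /\ exists2 c : k, c != 0 & s = [seq c *: N | N <- s'].
Proof.
move=> [ds ps] [es ps'].
wlog cop : u v / coprimep u v => [W u0 v0|].
  set g := gcdp u v; have g0 : g != 0 by rewrite gcdp_eq0 (negPf u0).
  have eu : u = (u %/ g) * g by rewrite divpK ?dvdp_gcdl.
  have ev : v = (v %/ g) * g by rewrite divpK ?dvdp_gcdr.
  rewrite {1}eu {1}ev => e1; apply: (W (u %/ g) (v %/ g)).
  - by rewrite coprimep_div_gcd // u0.
  - by apply: contraNneq u0 => h; rewrite eu h mul0r.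
  - by apply: contraNneq v0 => h; rewrite ev h mul0r.
  apply: (inj_map (mulIf g0)); rewrite -!map_comp.
  transitivity [seq u %/ g * g * N | N <- s].
    by apply: eq_map => N /=; ring.
  by rewrite e1; apply: eq_map => N /=; ring.
move=> u0 v0 euv.
have const (w w' : {poly k}) (r r' : seq {poly k}) f : coprimep w w' ->
    (forall z, has (fun N => pval f z N != 0) r') ->
    [seq w * N | N <- r] = [seq w' * N | N <- r'] -> size w == 1%N.
  move=> cw pr er; apply/negPn/negP => /closed_rootP[t /rootP wt].
  have /hasP[N Nr /eqP] := pr (Some t); apply => /=.
  have : w' * N \in [seq w * N0 | N0 <- r] by rewrite er map_f.
  case/mapP => N' _ /(congr1 (horner^~ t)); rewrite !hornerM wt mul0r => /eqP.
  by rewrite mulf_eq0 (negPf (coprimep_root cw _)) /= => [/eqP|]; rewrite ?/root ?wt.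
have /size_poly1P[cu cu0 eu] := const _ _ _ _ _ cop ps' euv.
have cop' : coprimep v u by rewrite coprimep_sym.
have /size_poly1P[cv cv0 ev] := const _ _ _ _ _ cop' ps (esym euv).
have es' : s = [seq (cu^-1 * cv) *: N | N <- s'].
  apply: (inj_map (@mulfI _ cu%:P _)); first by rewrite polyC_eq0.
  rewrite -eu euv -map_comp; apply: eq_map => N /=.
  by rewrite eu ev !mul_polyC scalerA mulrA mulfV ?mul1r.
split; last by exists (cu^-1 * cv); rewrite // mulf_neq0 ?invr_eq0.
have /hasP[N Ns /= N0] := ps None.
move: Ns; rewrite es' => /mapP[N' N's eN].
rewrite -ltnS; apply: leq_trans (allP es _ N's); rewrite ltnNge.
by apply: contra N0; rewrite eN coefZ => h; rewrite nth_default ?mulr0.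
Qed.

Lemma primitive_scale d e s s' u v :
  primitive d s -> primitive e s' -> u != 0 -> v != 0 ->
  [seq u * N | N <- s] = [seq v * N | N <- s'] ->
  d = e /\ exists2 c : k, c != 0 & s = [seq c *: N | N <- s'].
Proof.
move=> ps ps' u0 v0 e1.
have [le1 h] := primitive_scale_le ps ps' u0 v0 e1.
have [le2 _] := primitive_scale_le ps' ps v0 u0 (esym e1).
by split=> //; apply/eqP; rewrite eqn_leq le1.
Qed.

Lemma primitive_neq0 d N D z : primitive d [:: N; D] ->
  (pval d z N, pval d z D) != (0, 0).
Proof. by case=> _ /(_ z) /=; rewrite orbF xpair_eqE negb_and. Qed.

(** Symmetric functions of two points of the projective line determine their
    homogeneous coordinates up to a factor. *)
Lemma primitive_symm d e N D N' D' :
  primitive d [:: N; D] -> primitive e [:: N'; D'] ->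
  primitive (d + e) [:: D * D'; N * D' + N' * D; N * N'].
Proof.
move=> p p'; have [/= /and3P[sN sD _] _] := p; have [/= /and3P[sN' sD' _] _] := p'.
have szM (A B : {poly k}) : (size A <= d.+1)%N -> (size B <= e.+1)%N ->
    (size (A * B)%R <= (d + e).+1)%N.
  move=> sA sB; apply: (leq_trans (size_polyMleq _ _)).
  by rewrite -ltnS; apply: (@leq_ltn_trans (d.+1 + e.+1).-1); lia.
split=> /=; first by rewrite !szM //= (leq_trans (size_polyD _ _)) // geq_max ![_ * D]mulrC !szM.
move=> z; rewrite orbF pvalD [N' * D]mulrC !pvalM //.
have := primitive_neq0 z p; have := primitive_neq0 z p'.
rewrite !xpair_eqE; set n := pval d z N; set m := pval d z D.
set n' := pval e z N'; set m' := pval e z D' => h' h.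
rewrite -!negb_and; apply/negP => /and3P[h1 h2 h3].
move: h1 h3; rewrite !mulf_eq0.
case/orP => /eqP h1; case/orP => /eqP h3.
- by move: h; rewrite h1 h3 eqxx.
- by move: h2 h h'; rewrite h1 h3 eqxx mul0r addr0 mulf_eq0 andbT => /orP[/eqP ->|/eqP ->]; rewrite ?eqxx.
- by move: h2 h h'; rewrite h1 h3 eqxx mulr0 add0r mulf_eq0 andbT => /orP[/eqP ->|/eqP ->]; rewrite ?eqxx.
- by move: h'; rewrite h1 h3 eqxx.
Qed.

Lemma pval_forms d e (a b : k) N D N' D' :
  all (fun N => size N <= d.+1)%N [:: N; D] ->
  all (fun N => size N <= e.+1)%N [:: N'; D'] ->
  all (fun N => size N <= (2 * d + 2 * e).+1)%N [:: form_den N D N' D';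
     form_sum a%:P b%:P N D N' D'; form_prod a%:P b%:P N D N' D'] /\
  forall z, let n := pval d z N in let m := pval d z D in
   let n' := pval e z N' in let m' := pval e z D' in
  [/\ pval (2 * d + 2 * e) z (form_den N D N' D') = form_den n m n' m',
    pval (2 * d + 2 * e) z (form_sum a%:P b%:P N D N' D') = form_sum a b n m n' m'
  & pval (2 * d + 2 * e) z (form_prod a%:P b%:P N D N' D') = form_prod a b n m n' m'].
Proof.
case/and3P=> sN sD _ /and3P[sN' sD' _].
pose ok (f : nat) (A : {poly k}) := (size A <= f.+1)%N.
have okM f g (A B : {poly k}) : ok f A -> ok g B -> ok (f + g)%N (A * B).
  rewrite /ok => sA sB; apply: (leq_trans (size_polyMleq _ _)).
  by rewrite -ltnS; apply: (@leq_ltn_trans (f.+1 + g.+1).-1); lia.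
have okD f (A B : {poly k}) : ok f A -> ok f B -> ok f (A + B).
  by rewrite /ok => sA sB; rewrite (leq_trans (size_polyD _ _)) // geq_max sA.
have okB f (A : {poly k}) : ok f A -> ok f (- A) by rewrite /ok size_polyN.
have okZ f (c : k) A : ok f A -> ok f (c *: A).
  by move=> h; apply: leq_trans (size_scale_leq _ _) h.
have fdE : form_den N D N' D' = (N * D' - D * N') * (N * D' - D * N').
  by rewrite /form_den; ring.
have fsE : form_sum a%:P b%:P N D N' D' =
    2 *: ((N * D' + D * N') * (a *: (D * D') + N * N')) + (4 * b) *: ((D * D') * (D * D')).
  by rewrite /form_sum -!mul_polyC polyCM !rmorph_nat; ring.
have fpE : form_prod a%:P b%:P N D N' D' =
    (N * N' + (- a) *: (D * D')) * (N * N' + (- a) *: (D * D')) +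
     (- (4 * b)) *: ((D * D') * (N * D' + D * N')).
  by rewrite /form_prod -!mul_polyC !polyCN polyCM !rmorph_nat; ring.
have -> : (2 * d + 2 * e = (d + e) + (d + e))%N by lia.
have o1 : ok (d + e)%N (N * D' - D * N') by rewrite okD ?okB ?okM.
have o2 : ok (d + e)%N (N * D' + D * N') by rewrite okD ?okM.
have o3 : ok (d + e)%N (D * D') by rewrite okM.
have o4 c : ok (d + e)%N (c *: (D * D') + N * N') by rewrite okD ?okZ ?okM.
have o5 c : ok (d + e)%N (N * N' + c *: (D * D')) by rewrite okD ?okZ ?okM.
rewrite fdE fsE fpE; split=> [|z] /=.
  apply/and4P; split=> //; rewrite -/(ok _ _).
  - by rewrite okM.
  - by rewrite okD ?okZ ?okM.
  - by rewrite okD ?okZ ?okM.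
rewrite !(pvalD, pvalZ, pvalM, pvalN) //;
  [|exact: (o5 (- a))|exact: (o5 (- a))|exact: (o4 a)].
by split; rewrite /form_den /form_sum /form_prod; ring.
Qed.

Lemma primitive_forms d e (a b : k) N D N' D' :
  (2 : k) != 0 -> 4 * a ^+ 3 + 27 * b ^+ 2 != 0 ->
  primitive d [:: N; D] -> primitive e [:: N'; D'] ->
  primitive (2 * d + 2 * e) [:: form_den N D N' D';
     form_sum a%:P b%:P N D N' D'; form_prod a%:P b%:P N D N' D'].
Proof.
move=> h2 disc p p'; have [s v] := pval_forms a b p.1 p'.1.
split=> // z; have [/= -> -> ->] := v z; rewrite orbF.
exact: forms_neq0 h2 disc (primitive_neq0 z p) (primitive_neq0 z p').
Qed.

End Primitive.

(** * The degree of a point over a rational function field *)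

(** The field of rational functions is used only through these properties;
    the abstraction keeps the construction of fractions out of the algebra. *)
Record function_field (k : fieldType) := FunctionField {
  ff_sort : fieldType;
  ff_of : {rmorphism {poly k} -> ff_sort};
  ff_inj : injective ff_of;
  ff_frac : forall x, exists N D : {poly k}, D != 0 /\ x = ff_of N / ff_of D;
  ff_der : ff_sort -> ff_sort;
  ff_derD : {morph ff_der : x y / x + y};
  ff_derM : forall x y, ff_der (x * y) = ff_der x * y + x * ff_der y;
  ff_der_of : forall N : {poly k}, ff_der (ff_of N) = ff_of N^`() }.

Section Degree.
Variables (k : closedFieldType) (FF : function_field k).
Local Notation K := (ff_sort FF).
Local Notation "p %:F" := (ff_of FF p) : ring_scope.
Variables (E : twisted_cubic K) (a b : k).
Hypotheses (Ea : cub_a E = a%:P%:F) (Eb : cub_b E = b%:P%:F).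
Implicit Types (P Q : point E) (N D : {poly k}).

Lemma of_eq N D : (N%:F == D%:F) = (N == D).
Proof. by apply: (inj_eq (@ff_inj _ FF)). Qed.

Lemma of_eq0 N : (N%:F == 0) = (N == 0).
Proof. by rewrite -(rmorph0 (ff_of FF)) of_eq. Qed.

Lemma two_neq0 : (2 : k) != 0.
Proof.
by rewrite -polyC_eq0 -of_eq0 !rmorph_nat (cub_2_neq0 E).
Qed.

Lemma disc_neq0 : 4 * a ^+ 3 + 27 * b ^+ 2 != 0.
Proof.
rewrite -polyC_eq0 -of_eq0.
have -> : (4 * a ^+ 3 + 27 * b ^+ 2)%:P%:F = 4 * cub_a E ^+ 3 + 27 * cub_b E ^+ 2.
  by rewrite Ea Eb; ring.
exact: cub_disc_neq0.
Qed.

(** [N : D] is the abscissa of [P] in lowest terms, a map of degree [d]. *)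
Definition reduced_x P d N D :=
  primitive d [:: N; D] /\ exists2 m : K, m != 0 &
    N%:F = m * (proj_x (coords P)).1 /\ D%:F = m * (proj_x (coords P)).2.

Lemma primitive_exists N D : D != 0 ->
  exists d N' D', primitive d [:: N'; D'] /\ exists2 g, g != 0 & N = N' * g /\ D = D' * g.
Proof.
move=> D0; set g := gcdp N D.
have g0 : g != 0 by rewrite gcdp_eq0 negb_and D0 orbT.
have eN : N = (N %/ g) * g by rewrite divpK ?dvdp_gcdl.
have eD : D = (D %/ g) * g by rewrite divpK ?dvdp_gcdr.
have cop : coprimep (N %/ g) (D %/ g) by rewrite coprimep_div_gcd // D0 orbT.
have D'0 : D %/ g != 0 by apply: contraNneq D0 => h; rewrite eD h mul0r.
move: (N %/ g) (D %/ g) eN eD cop D'0 => N' D' eN eD cop D'0.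
pose d := (maxn (size N') (size D')).-1; exists d, N', D'; split; last by exists g.
have dS : (d.+1 = maxn (size N') (size D'))%N.
  by rewrite prednK // leq_max orbC lt0n size_poly_eq0 D'0.
split; first by rewrite /= dS leq_maxl leq_maxr.
case=> [t|] /=; rewrite orbF -negb_and.
  apply/negP => /andP[/eqP h1 /eqP h2].
  by have := coprimep_root cop (x := t); rewrite /root h1 h2 eqxx => /(_ isT).
apply/negP => /andP[h1 h2].
have h (A : {poly k}) : size A = d.+1 -> A`_d == 0 -> False.
  move=> sA; have -> : A`_d = lead_coef A by rewrite /lead_coef sA.
  by rewrite lead_coef_eq0 -size_poly_eq0 sA.
have [hle|hle] := leqP (size N') (size D').
  by apply: (h D') => //; rewrite dS; apply/esym/maxn_idPr.
by apply: (h N') => //; rewrite dS; apply/esym/maxn_idPl/ltnW.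
Qed.

Lemma reduced_x_exists P : exists d N D, reduced_x P d N D.
Proof.
rewrite /reduced_x; case: (coords P) => [[x y]|] /=; last first.
  exists 0%N, 1, 0; split; last first.
    by exists 1; rewrite ?oner_neq0 // !mul1r rmorph1 rmorph0.
  split=> [|[t|]] /=; rewrite ?size_poly1 ?size_poly0 //.
    by rewrite hornerC oner_neq0.
  by rewrite coefC oner_neq0.
have [N [D [D0 ->]]] := ff_frac x.
have [d [N' [D' [pr [g g0 [eN eD]]]]]] := primitive_exists N D0.
exists d, N', D'; split=> //; exists D'%:F; last first.
  split; last by rewrite mulr1.
  rewrite eN eD !rmorphM /=; field; rewrite !of_eq0 g0 /=.
  by apply: contraNneq D0 => h; rewrite eD h mul0r.
by rewrite of_eq0; apply: contraNneq D0 => h; rewrite eD h mul0r.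
Qed.

Lemma form_den_frac N D N' D' :
  (form_den N D N' D')%:F = form_den N%:F D%:F N'%:F D'%:F.
Proof. by rewrite /form_den; ring. Qed.

Lemma form_sum_frac (A B : {poly k}) N D N' D' :
  (form_sum A B N D N' D')%:F = form_sum A%:F B%:F N%:F D%:F N'%:F D'%:F.
Proof. by rewrite /form_sum; ring. Qed.

Lemma form_prod_frac (A B : {poly k}) N D N' D' :
  (form_prod A B N D N' D')%:F = form_prod A%:F B%:F N%:F D%:F N'%:F D'%:F.
Proof. by rewrite /form_prod; ring. Qed.

(** Two ways of writing the symmetric functions of the abscissas of [P + Q]
    and [P - Q], both without common factor, have the same degree. *)
Lemma degree_parallelogram P Q d1 d2 d3 d4 N1 D1 N2 D2 N3 D3 N4 D4 :
  reduced_x P d1 N1 D1 -> reduced_x Q d2 N2 D2 ->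
  reduced_x (P + Q) d3 N3 D3 -> reduced_x (P - Q) d4 N4 D4 ->
  (2 * d1 + 2 * d2 = d3 + d4)%N /\ exists2 c : k, c != 0 &
  [:: form_den N1 D1 N2 D2; form_sum a%:P b%:P N1 D1 N2 D2;
      form_prod a%:P b%:P N1 D1 N2 D2] =
  [seq c *: N | N <- [:: D3 * D4; N3 * D4 + N4 * D3; N3 * N4]].
Proof.
move=> [p1 [m1 m10 [n1 e1]]] [p2 [m2 m20 [n2 e2]]].
move=> [p3 [m3 m30 [n3 e3]]] [p4 [m4 m40 [n4 e4]]].
have /= := @sum_diff_proj_x _ _ P Q _ _ _ _ _ _ _ _
  (surjective_pairing _) (surjective_pairing _) (surjective_pairing _) (surjective_pairing _).
case=> l l0 [h1 h2 h3].
have [u [v [v0 eq_uv]]] := ff_frac (m1 ^+ 2 * m2 ^+ 2 * l / (m3 * m4)).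
have u0 : u != 0.
  rewrite -of_eq0; apply: contraTneq (isT) => uF; move: eq_uv; rewrite uF mul0r => /eqP.
  by rewrite !(mulf_eq0, invr_eq0, expf_eq0) /= (negPf m10) (negPf m20) (negPf l0) (negPf m30) (negPf m40).
have v0F : v%:F != 0 :> K by rewrite of_eq0.
have key (A B : {poly k}) A' B' : A%:F = m1 ^+ 2 * m2 ^+ 2 * A' -> A' = l * B' ->
    B%:F = m3 * m4 * B' -> v * A = u * B.
  move=> hA hAB hB; apply/eqP; rewrite -of_eq !rmorphM /= hA hB hAB; apply/eqP.
  have -> : u%:F = v%:F * (m1 ^+ 2 * m2 ^+ 2 * l / (m3 * m4)) by rewrite eq_uv; field.
  by field; rewrite m30 m40.
have pf := primitive_forms two_neq0 disc_neq0 p1 p2.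
apply: (primitive_scale pf (primitive_symm p3 p4) v0 u0).
rewrite /=; congr [:: _; _; _].
- apply: key h1 _; first by rewrite form_den_frac n1 e1 n2 e2 /form_den; ring.
  by rewrite rmorphM /= e3 e4; ring.
- apply: key h2 _.
    by rewrite form_sum_frac n1 e1 n2 e2 /form_sum -Ea -Eb; ring.
  by rewrite rmorphD /= !rmorphM /= n3 e3 n4 e4; ring.
- apply: key h3 _.
    by rewrite form_prod_frac n1 e1 n2 e2 /form_prod -Ea -Eb; ring.
  by rewrite rmorphM /= n3 n4; ring.
Qed.

Lemma reduced_x_uniq P d e N D N' D' :
  reduced_x P d N D -> reduced_x P e N' D' ->
  d = e /\ exists2 c : k, c != 0 & [:: N; D] = [seq c *: A | A <- [:: N'; D']].
Proof.
move=> [p [m m0 [n1 e1]]] [p' [m' m'0 [n2 e2]]].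
have [u [v [v0 eq_uv]]] := ff_frac (m / m').
have u0 : u != 0.
  rewrite -of_eq0; apply: contraTneq (isT) => uF; move: eq_uv; rewrite uF mul0r => /eqP.
  by rewrite !(mulf_eq0, invr_eq0) (negPf m0) (negPf m'0).
have v0F : v%:F != 0 :> K by rewrite of_eq0.
have eu : u%:F = v%:F * (m / m') by rewrite eq_uv; field.
apply: (@primitive_scale _ _ _ _ _ v u) => //.
rewrite /=; congr [:: _; _]; apply/eqP; rewrite -of_eq !rmorphM /= ?n1 ?n2 ?e1 ?e2 eu;
  by apply/eqP; field.
Qed.

End Degree.

(** * Quadratic functions on an abelian group *)

(** Jordan and von Neumann: the parallelogram law makes [d] a quadratic
    form. Stated for a functional relation, as degrees are only given by the
    existence of a reduced fraction. *)
Section Quadratic.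
Variables (G : zmodType) (d : G -> int -> Prop).
Hypothesis d_total : forall x, exists u, d x u.
Hypothesis d_para : forall x y s t u v, d x s -> d y t -> d (x + y) u ->
  d (x - y) v -> 2 * s + 2 * t = u + v.

Lemma quadratic0 u : d 0 u -> u = 0.
Proof.
move=> du; have du1 : d (0 + 0) u by rewrite addr0.
have du2 : d (0 - 0) u by rewrite subr0.
by have := d_para du du du1 du2; lia.
Qed.

Lemma quadraticN x u : d x u -> d (- x) u.
Proof.
move=> du; have [v dv] := d_total (- x); have [w dw] := d_total 0.
have du1 : d (0 + x) u by rewrite add0r.
have dv2 : d (0 - x) v by rewrite add0r.
by have := d_para dw du du1 dv2; rewrite (quadratic0 dw) => e; have <- : v = u by lia.
Qed.

Lemma quadratic_line_nat x y u v w (n : nat) : d x u -> d y v -> d (x + y) w ->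
  d (x + y *+ n) (u + n%:Z * (w - u - v) + n%:Z ^+ 2 * v) /\
  d (x + y *+ n.+1) (u + n.+1%:Z * (w - u - v) + n.+1%:Z ^+ 2 * v).
Proof.
move=> du dv dw; elim: n => [|n [IH1 IH2]].
  rewrite mulr0n addr0 mulr1n; split.
    by rewrite (_ : _ + _ + _ = u); last ring.
  by rewrite (_ : _ + _ + _ = w); last ring.
split=> //; have [t dt] := d_total (x + y *+ n.+2).
have d1 : d (x + y *+ n.+1 + y) t by rewrite -addrA -mulrSr.
have d2 : d (x + y *+ n.+1 - y) (u + n%:Z * (w - u - v) + n%:Z ^+ 2 * v).
  by rewrite mulrSr addrA addrK.
have := d_para IH2 dv d1 d2 => e.
rewrite (_ : _ + _ + _ = t) // (_ : t = 2 * (u + n.+1%:Z * (w - u - v) + n.+1%:Z ^+ 2 * v)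
  + 2 * v - (u + n%:Z * (w - u - v) + n%:Z ^+ 2 * v)); last by rewrite e; ring.
by rewrite -[n.+2]addn2 -[n.+1]addn1 !PoszD; ring.
Qed.

Lemma quadratic_line x y u v w (n : int) : d x u -> d y v -> d (x + y) w ->
  d (x + y *~ n) (u + n * (w - u - v) + n ^+ 2 * v).
Proof.
move=> du dv dw; case: n => n; first by case: (quadratic_line_nat n du dv dw).
have [t dt] := d_total (x - y); have et := d_para du dv dw dt.
have [_] := quadratic_line_nat n du (quadraticN dv) dt.
rewrite mulNrn NegzE mulrNz -pmulrn.
by rewrite (_ : u + - n.+1%:Z * _ + _ = u + n.+1%:Z * (t - u - v) + n.+1%:Z ^+ 2 * v) //
  (_ : t = 2 * u + 2 * v - w); [ring | rewrite et; ring].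
Qed.

Lemma quadratic_form x y u v w (m n : int) : d x u -> d y v -> d (x + y) w ->
  d (x *~ m + y *~ n) (m ^+ 2 * u + m * n * (w - u - v) + n ^+ 2 * v).
Proof.
move=> du dv dw; have [z dz] := d_total 0; have z0 := quadratic0 dz.
have dm : d (x *~ m) (m ^+ 2 * u).
  have := quadratic_line m dz du; rewrite !add0r z0 => /(_ u du).
  by rewrite (_ : _ + _ + _ = m ^+ 2 * u) //; ring.
have dyx : d (y + x) w by rewrite addrC.
have := quadratic_line m dv du dyx; rewrite addrC => dmy.
have := quadratic_line n dm dv dmy.
by rewrite (_ : _ + _ + _ = m ^+ 2 * u + m * n * (w - u - v) + n ^+ 2 * v) //; ring.
Qed.
End Quadratic.

Section DegreeForm.
Variables (k : closedFieldType) (FF : function_field k).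
Local Notation K := (ff_sort FF).
Variables (E : twisted_cubic K) (a b : k).
Hypotheses (Ea : cub_a E = ff_of FF a%:P) (Eb : cub_b E = ff_of FF b%:P).
Implicit Types (P Q : point E) (N D : {poly k}).

Definition has_degree P (e : int) := exists d N D, reduced_x P d N D /\ e = d%:Z.

Lemma reduced_has_degree P d N D : reduced_x P d N D -> has_degree P d.
Proof. by move=> r; exists d, N, D. Qed.

Lemma has_degree_uniq P d d' : has_degree P d -> has_degree P d' -> d = d'.
Proof.
move=> [e [N [D [r ->]]]] [e' [N' [D' [r' ->]]]].
by have [-> _] := reduced_x_uniq r r'.
Qed.

Lemma degree_form P Q (u v w m n : int) :
  has_degree P u -> has_degree Q v -> has_degree (P + Q) w ->
  has_degree (P *~ m + Q *~ n) (m ^+ 2 * u + m * n * (w - u - v) + n ^+ 2 * v).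
Proof.
apply: quadratic_form => [R|R S s t x y].
  by have [d [N [D r]]] := reduced_x_exists R; exists d; apply: reduced_has_degree r.
move=> [d1 [N1 [D1 [r1 ->]]]] [d2 [N2 [D2 [r2 ->]]]].
move=> [d3 [N3 [D3 [r3 ->]]]] [d4 [N4 [D4 [r4 ->]]]].
by have [e _] := degree_parallelogram Ea Eb r1 r2 r3 r4; lia.
Qed.

(** Points that specialise to the origin at infinity. *)
Definition zero_at_infinity P := exists d N D, reduced_x P d N D /\ D`_d = 0.

Lemma zero_at_infinityP P d N D :
  zero_at_infinity P -> reduced_x P d N D -> D`_d = 0.
Proof.
move=> [e [N' [D' [r h]]]] r'; have [-> [c _ [_ ->]]] := reduced_x_uniq r' r.
by rewrite coefZ h mulr0.
Qed.

Lemma zero_at_infinity_sum_diff P Q : zero_at_infinity P -> zero_at_infinity Q ->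
  zero_at_infinity (P + Q) /\ zero_at_infinity (P - Q).
Proof.
move=> [d1 [N1 [D1 [r1 h1]]]] [d2 [N2 [D2 [r2 h2]]]].
have [d3 [N3 [D3 r3]]] := reduced_x_exists (P + Q).
have [d4 [N4 [D4 r4]]] := reduced_x_exists (P - Q).
have [ed [c c0 [f1 f2 _]]] := degree_parallelogram Ea Eb r1 r2 r3 r4.
have [_ /(_ None)] := pval_forms a b r1.1.1 r2.1.1.
rewrite /pval ed f1 f2 h1 h2; case; rewrite /form_den /form_sum !coefZ.
rewrite !(mulr0, mul0r, subr0, addr0, expr0n) /= => /eqP g1 /eqP g2 _.
have [/= /and3P[s3 t3 _] _] := r3.1; have [/= /and3P[s4 t4 _] _] := r4.1.
have n3 := primitive_neq0 None r3.1; have n4 := primitive_neq0 None r4.1.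
have cM (A B : {poly k}) : (size A <= d3.+1)%N -> (size B <= d4.+1)%N ->
  (A * B)`_(d3 + d4) = A`_d3 * B`_d4 by apply: (pvalM None).
move: g1 g2; rewrite !mulf_eq0 (negPf c0) /= coefD [N4 * D3]mulrC !cM // mulf_eq0.
rewrite !xpair_eqE /= in n3 n4.
have z3 : D3`_d3 = 0 -> zero_at_infinity (P + Q) by exists d3, N3, D3.
have z4 : D4`_d4 = 0 -> zero_at_infinity (P - Q) by exists d4, N4, D4.
case/orP => /eqP g; rewrite g ?mul0r ?mulr0 ?addr0 ?add0r mulf_eq0 => g'.
  have d40 : D4`_d4 = 0 by move: g' n3; rewrite g eqxx andbT => /orP[->|/eqP].
  by split; [apply: z3 | apply: z4].
have d30 : D3`_d3 = 0 by move: g' n4; rewrite g eqxx andbT => /orP[/eqP|->].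
by split; [apply: z3 | apply: z4].
Qed.

Lemma zero_at_infinity0 : zero_at_infinity 0.
Proof.
exists 0%N, 1, 0; split; last by rewrite coef0.
split; last by exists 1; rewrite ?oner_neq0 // !mul1r rmorph1 rmorph0.
split=> [|[t|]] /=; rewrite ?size_poly1 ?size_poly0 //.
  by rewrite hornerC oner_neq0.
by rewrite coefC oner_neq0.
Qed.

Lemma zero_at_infinityMz P (n : int) : zero_at_infinity P -> zero_at_infinity (P *~ n).
Proof.
move=> zP; have pos m : zero_at_infinity (P *+ m).
  elim: m => [|m IH]; first exact: zero_at_infinity0.
  by rewrite mulrS; case: (zero_at_infinity_sum_diff zP IH).
case: n => m; first exact: pos.
rewrite NegzE mulrNz -[- _]add0r.
by case: (zero_at_infinity_sum_diff zero_at_infinity0 (pos m.+1)).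
Qed.

End DegreeForm.

(** * The invariant differential *)

Section Multiplier.
Variables (K : fieldType) (E : twisted_cubic K) (der : K -> K).
Local Notation c := (cub_c E).
Local Notation a := (cub_a E).
Local Notation b := (cub_b E).
Hypothesis derD : {morph der : x y / x + y}.
Hypothesis derM : forall x y, der (x * y) = der x * y + x * der y.
Hypotheses (der_a : der a = 0) (der_b : der b = 0).

Lemma der0 : der 0 = 0.
Proof. by apply: (addrI (der 0)); rewrite -derD !addr0. Qed.

Lemma derN x : der (- x) = - der x.
Proof. by apply/eqP; rewrite -addr_eq0 -derD addNr der0. Qed.

Lemma derB x y : der (x - y) = der x - der y.
Proof. by rewrite derD derN. Qed.

Lemma der1 : der 1 = 0.
Proof. by apply: (addrI (der 1)); rewrite addr0 -{3}[1]mulr1 derM mul1r mulr1. Qed.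

Lemma der_nat n : der n%:R = 0.
Proof. by elim: n => [|n IH]; rewrite ?der0 // mulrS derD der1 IH addr0. Qed.

Lemma derX2 x : der (x ^+ 2) = 2 * x * der x.
Proof. by rewrite expr2 derM; ring. Qed.

Lemma derV x y : y != 0 -> der (x / y) = (der x * y - x * der y) / y ^+ 2.
Proof.
move=> y0; have := derM (x / y) y; rewrite mulfVK // => ->.
by field.
Qed.

(** The pull-back of the invariant differential [dx / y] by the point is
    [m] times it. The second equation follows from the first one by
    differentiating the equation of the curve, except at points of order 2. *)
Definition multiplier (p : option (K * K)) (m : K) :=
  if p is Some (x, y) then
    der x = m * y /\ 2 * c * der y + der c * y = (3 * x ^+ 2 + a) * m
  else m = 0.

Lemma multiplier_opp p m : multiplier p m -> multiplier (opp_cubic p) (- m).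
Proof.
case: p => [[x y]|] /=; last by move=> ->; rewrite oppr0.
by move=> [h1 h2]; rewrite derN mulrNN; split=> //; rewrite [RHS]mulrN -h2; ring.
Qed.

Lemma multiplier_of x y m : on_cubic E (Some (x, y)) -> y != 0 -> der x = m * y ->
  multiplier (Some (x, y)) m.
Proof.
move=> /= /eqP /(congr1 der).
rewrite [LHS]derM !derD [der (a * x)]derM der_a der_b derX2 => e y0 dx.
have ex3 : der (x ^+ 3) = 3 * x ^+ 2 * der x by rewrite exprS derM derX2; ring.
split=> //; apply: (mulIf y0).
transitivity (der c * y ^+ 2 + c * (2 * y * der y)); first by ring.
by rewrite e ex3 dx; ring.
Qed.

Lemma multiplier_uniq p m n : on_cubic E p -> multiplier p m -> multiplier p n -> m = n.
Proof.
case: p => [[x y]|] o; last by rewrite /= => -> ->.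
move=> [h1 h2] [h3 h4]; have [y0|y0] := eqVneq y 0.
  move: o; rewrite y0 => /cubic_nonsingular f'0.
  by apply: (mulfI f'0); rewrite -h2 -h4 y0.
by apply: (mulIf y0); rewrite -h1 -h3.
Qed.

Lemma multiplier_chord x1 y1 x2 y2 s m n : x1 != x2 -> is_slope E x1 y1 x2 y2 s ->
  multiplier (Some (x1, y1)) m -> multiplier (Some (x2, y2)) n ->
  multiplier (third E x1 y1 x2 s) (m + n).
Proof.
move=> nx [e1 e2] [h1 h2] [h3 h4].
have c0 := cub_c_neq0 E; have two0 := cub_2_neq0 E.
have d : x2 - x1 != 0 by rewrite subr_eq0 eq_sym.
have Y1 : der y1 = ((3 * x1 ^+ 2 + a) * m - der c * y1) / (2 * c).
  by rewrite -h2; field; rewrite ?two0 ?c0.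
have Y2 : der y2 = ((3 * x2 ^+ 2 + a) * n - der c * y2) / (2 * c).
  by rewrite -h4; field; rewrite ?two0 ?c0.
have S : der s = ((der y2 - der y1) - s * (der x2 - der x1)) / (x2 - x1).
  have := congr1 der e1; rewrite derM !derB => ->.
  by field.
have E2 : y2 = y1 + s * (x2 - x1) by rewrite -e1; ring.
have Ea : a = c * s * (y1 + y2) - (x1 ^+ 2 + x1 * x2 + x2 ^+ 2) by rewrite e2; ring.
rewrite /third /multiplier !(derB, derD, derN, derM, derX2).
rewrite S Y1 Y2 h1 h3 Ea E2.
by split; field; rewrite ?two0 ?c0 ?d.
Qed.

Lemma multiplier_tangent x1 y1 s m : y1 != 0 -> is_slope E x1 y1 x1 y1 s ->
  multiplier (Some (x1, y1)) m -> multiplier (third E x1 y1 x1 s) (m + m).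
Proof.
move=> y0 [_ e2] [h1 h2].
have c0 := cub_c_neq0 E; have two0 := cub_2_neq0 E.
have Y1 : der y1 = ((3 * x1 ^+ 2 + a) * m - der c * y1) / (2 * c).
  by rewrite -h2; field; rewrite ?two0 ?c0.
have Ea : a = 2 * c * s * y1 - 3 * x1 ^+ 2.
  have -> : 2 * c * s * y1 = c * s * (y1 + y1) by ring.
  by rewrite e2; ring.
have S : der s = (6 * x1 * der x1 - 2 * s * (der c * y1 + c * der y1)) / (2 * c * y1).
  have := congr1 der Ea; rewrite der_a !(derB, derM, derX2) !der_nat.
  move=> /eqP; rewrite eq_sym subr_eq0 => /eqP H.
  have -> : 6 * x1 * der x1 = 0 * x1 ^+ 2 + 3 * (2 * x1 * der x1) by ring.
  by rewrite -H; field; rewrite ?two0 ?c0 ?y0.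
rewrite /third /multiplier !(derB, derD, derN, derM, derX2).
rewrite S Y1 h1 Ea.
by split; field; rewrite ?two0 ?c0 ?y0.
Qed.

Lemma multiplier_add p q m n : on_cubic E p -> on_cubic E q ->
  multiplier p m -> multiplier q n -> multiplier (add_cubic E p q) (m + n).
Proof.
move=> op oq mp mq.
have [e|nv] := eqVneq q (opp_cubic p).
  have -> : n = - m by apply: (multiplier_uniq oq mq); rewrite e; apply: multiplier_opp.
  by rewrite e add_oppr subrr.
case: p op mp nv => [[x1 y1]|] op mp nv; last by rewrite [m]mp add0r.
case: q oq mq nv => [[x2 y2]|] oq mq nv; last by rewrite [n]mq addr0 add_cubic0.
have sl := slopeP op oq nv; rewrite (add_third op oq nv sl).
have [ex|nx] := eqVneq x1 x2; last exact: multiplier_chord nx sl mp mq.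
move: oq mq nv sl; rewrite -ex => oq mq nv sl.
have [ey|ey] := same_x op oq; last by move: nv; rewrite ey eqxx.
move: oq mq nv sl; rewrite ey => oq mq nv sl.
rewrite -(multiplier_uniq oq mp mq); apply: multiplier_tangent sl mp.
by apply: contraNneq nv => ->; rewrite /= oppr0.
Qed.

Lemma multiplierMz (P : point E) m (n : int) :
  multiplier (coords P) m -> multiplier (coords (P *~ n)) (n%:~R * m).
Proof.
move=> mP; have pos j : multiplier (coords (P *+ j)) (j%:R * m).
  elim: j => [|j IH]; first by rewrite mul0r.
  rewrite !mulrS mulrDl mul1r coordsD; apply: multiplier_add => //; exact: coords_on.
case: n => j; first exact: pos.
rewrite NegzE mulrNz coordsN mulrNz mulNr; apply: multiplier_opp; exact: pos.
Qed.

End Multiplier.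

(** * The Frobenius point in characteristic [p] *)

Definition cubic (R : nzRingType) (a b : R) : {poly R} := 'X^3 + a%:P * 'X + b%:P.

Section CharP.
Variables (k : closedFieldType) (p : nat).
Hypotheses (charp : p \in [pchar k]) (p_neq2 : p != 2%N) (p_neq3 : p != 3%N).
Variable FF : function_field k.
Local Notation K := (ff_sort FF).
Local Notation "N %:F" := (ff_of FF N) : ring_scope.
Variables a b : k.
Hypotheses (disc : 4 * a ^+ 3 + 27 * b ^+ 2 != 0) (a_p : a ^+ p = a) (b_p : b ^+ p = b).
Local Notation f := (cubic a b).
Local Notation n := p./2.
Implicit Types N D : {poly k}.

Let p_prime : prime p := pcharf_prime charp.

Lemma natk_eq0 m : (m%:R == 0 :> k) = (p %| m)%N.
Proof. by rewrite (dvdn_pcharf charp). Qed.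

Lemma p_odd : odd p.
Proof. by case: (even_prime p_prime) => // h; move: p_neq2; rewrite h. Qed.

Lemma half_p : (n * 2).+1 = p.
Proof. by rewrite -[RHS]odd_double_half p_odd muln2. Qed.

Lemma k2_neq0 : (2 : k) != 0.
Proof. by rewrite natk_eq0 dvdn_prime2 ?p_prime. Qed.
Lemma k3_neq0 : (3 : k) != 0.
Proof. by rewrite natk_eq0 dvdn_prime2 ?p_prime. Qed.

Lemma size_cubic : size f = 4%N.
Proof.
rewrite /cubic -addrA size_polyDl size_polyXn // ltnS.
rewrite (leq_trans (size_polyD _ _)) // geq_max size_polyC mul_polyC.
rewrite (leq_trans (size_scale_leq _ _)) ?size_polyX //=.
by case: (_ != 0).
Qed.

Lemma cubic_neq0 : f != 0.
Proof. by rewrite -size_poly_eq0 size_cubic. Qed.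

Lemma horner_cubic x : f.[x] = x ^+ 3 + a * x + b.
Proof. by rewrite /cubic !hornerE. Qed.

Lemma horner_deriv_cubic x : (f^`()).[x] = 3 * x ^+ 2 + a.
Proof. by rewrite /cubic !derivE !hornerE /=; ring. Qed.

Lemma cubic_simple_root x : f.[x] = 0 -> (f^`()).[x] != 0.
Proof.
rewrite horner_cubic horner_deriv_cubic => f0; apply/eqP => f1.
case/eqP: (disc); have : b = (x ^+ 3 + a * x + b) - x ^+ 3 - a * x by ring.
rewrite f0 => ->; have -> : a = (3 * x ^+ 2 + a) - 3 * x ^+ 2 by ring.
by rewrite f1; ring.
Qed.

Lemma cubic_coprime : coprimep f f^`().
Proof.
by apply/Pdiv.ClosedField.coprimepP => x /rootP /cubic_simple_root.
Qed.

Lemma K2_neq0 : (2 : K) != 0.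
Proof. by rewrite -(rmorph_nat (ff_of FF)) of_eq0 -polyC_natr polyC_eq0 k2_neq0. Qed.

Lemma K_disc : 4 * ((a)%:P)%:F ^+ 3 + 27 * ((b)%:P)%:F ^+ 2 != 0.
Proof.
have -> : 4 * ((a)%:P)%:F ^+ 3 + 27 * ((b)%:P)%:F ^+ 2 =
  ((4 * a ^+ 3 + 27 * b ^+ 2)%:P)%:F by ring.
by rewrite of_eq0 polyC_eq0 disc.
Qed.

Lemma Kf_neq0 : f%:F != 0.
Proof. by rewrite of_eq0 cubic_neq0. Qed.

Definition fcurve := TwistedCubic Kf_neq0 K_disc K2_neq0.
Local Notation E := fcurve.
Local Notation der := (ff_der (f := FF)).
Local Notation mult := (multiplier E der).

Lemma primitive_coprime d N D : primitive d [:: N; D] -> coprimep N D.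
Proof.
move=> pr; apply/Pdiv.ClosedField.coprimepP => t /rootP N0.
by have := primitive_neq0 (Some t) pr; rewrite /= N0 xpair_eqE eqxx.
Qed.

Lemma coprime_deriv0 N D : coprimep N D -> N^`() * D = N * D^`() ->
  D != 0 -> N^`() = 0 /\ D^`() = 0.
Proof.
move=> cop e D0.
have dv (A : {poly k}) : A != 0 -> A %| A^`() -> A^`() = 0.
  move=> A0 dA; apply: contraTeq (lt_size_deriv A0) => A'0.
  by rewrite -leqNgt dvdp_leq.
have D'0 : D^`() = 0.
  apply: dv => //; rewrite -(@Gauss_dvdpr _ _ N) 1?coprimep_sym //.
  by rewrite -e dvdp_mull.
split=> //; move/eqP: e; rewrite D'0 mulr0 mulf_eq0 (negPf D0) orbF.
by move/eqP.
Qed.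

Lemma deriv0_coef N i : N^`() = 0 -> ~~ (p %| i)%N -> N`_i = 0.
Proof.
case: i => [|i]; rewrite ?dvdn0 // => N'0 pi.
have /eqP := coef_deriv N i; rewrite N'0 coef0 eq_sym -mulr_natr mulf_eq0.
by rewrite natk_eq0 (negPf pi) orbF => /eqP.
Qed.

(** For coprime [N] and [D], the relation [N' D = N D'] forces both derivatives to
    vanish: a map that kills the differential factors through Frobenius. *)
Lemma inseparable (P : point E) d N D : reduced_x P d N D -> mult (coords P) 0 ->
  (p %| d)%N /\ ((0 < d)%N -> N^`() = 0 /\ D^`() = 0 /\ D != 0).
Proof.
move=> [pr [m m0]]; case: (coords P) => [[x y]|] /=; last first.
  rewrite mulr0 => -[_ /eqP]; rewrite of_eq0 => /eqP D0 _.
  have d0 : d = 0%N.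
    have := pr.2 None; rewrite /= D0 coef0 eqxx orbF.
    have /size_poly1P[c _ ->] : size N == 1%N.
      by have := primitive_coprime pr; rewrite D0 coprimep0 -size_poly_eq1.
    by rewrite coefC; case: (d =P 0%N) => // _; rewrite eqxx.
  by rewrite d0 dvdn0.
rewrite mulr1 => -[eN eD] [dx _]; rewrite mul0r in dx.
have D0 : D != 0 by rewrite -(of_eq0 FF) eD.
have D0F : D%:F != 0 by rewrite of_eq0.
have ex : x = N%:F / D%:F by rewrite eN eD; field.
have [N'0 D'0] : N^`() = 0 /\ D^`() = 0.
  apply: coprime_deriv0 (primitive_coprime pr) _ D0.
  apply/eqP; rewrite -(of_eq FF) !rmorphM /= -!ff_der_of.
  move: dx; rewrite ex (derV (@ff_derM _ FF)) // => /eqP.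
  by rewrite mulf_eq0 invr_eq0 expf_eq0 /= (negPf D0F) orbF subr_eq0.
split=> //; apply: contraT => pd.
by have := pr.2 None; rewrite /= !deriv0_coef // eqxx.
Qed.

Lemma cubic_Frobenius : f ^+ p = f \Po 'X^p.
Proof.
have cp : p \in [pchar {poly k}] by rewrite pchar_poly.
rewrite -(pFrobenius_autE cp) /cubic !pFrobenius_autD_comm; try exact: mulrC.
rewrite !comp_polyD comp_Xn_poly comp_polyM !comp_polyC comp_polyX.
rewrite !pFrobenius_autE [(a%:P * 'X) ^+ p]exprMn.
by rewrite -!polyC_exp a_p b_p -!exprM mulnC.
Qed.

Lemma frobenius_on : on_cubic E (Some (('X^p)%:F, (f ^+ n)%:F)).
Proof.
rewrite /= -!rmorphXn -rmorphM /= -exprM -exprS half_p cubic_Frobenius.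
by apply/eqP; rewrite /cubic !comp_polyD comp_Xn_poly comp_polyM !comp_polyC comp_polyX; ring.
Qed.

Definition frobenius : point E := Point frobenius_on.


Lemma comp_polyXp_inj (N D : {poly k}) : N \Po 'X^p = D \Po 'X^p -> N = D.
Proof.
have p0 : (0 < p)%N by rewrite prime_gt0 // p_prime.
move=> e; apply/polyP => i; have := congr1 (fun A : {poly k} => A`_(i * p)) e.
by rewrite !coef_comp_poly_Xn // dvdn_mull // mulnK.
Qed.

(** If [h * (A / B)^2] is a polynomial then a pole of [A / B] would be a double
    root of [h]. *)
Lemma square_root_poly (h A B G : {poly k}) :
  (forall t, h.[t] = 0 -> (h^`()).[t] != 0) ->
  coprimep A B -> h * A ^+ 2 = G * B ^+ 2 -> size B = 1%N.
Proof.
move=> simple.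
rewrite !expr2 => cop e; apply/eqP; apply: contraT => /closed_rootP[t Bt].
have At : A.[t] != 0 by apply: coprimep_root Bt; rewrite coprimep_sym.
move/rootP in Bt.
have f0 : h.[t] = 0.
  have := congr1 (horner^~ t) e; rewrite !hornerM Bt !mulr0 => /eqP.
  by rewrite !mulf_eq0 (negPf At) !orbF => /eqP.
have := congr1 (fun N => (N^`()).[t]) e.
rewrite !derivM !(hornerM, hornerD) f0 Bt !(mulr0, mul0r, addr0) => /eqP.
by rewrite !mulf_eq0 (negPf (simple _ f0)) (negPf At).
Qed.

(** The logarithmic derivative of [Y] is that of [f^(-1/2)], hence of [f^n]. *)
Lemma dvdp_cubic_exp (Y : {poly k}) : 2 * f * Y^`() + f^`() * Y = 0 ->
  f ^+ n %| Y.
Proof.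
move=> e; have : (n <= n)%N by [].
have [j] : {j | j = n} by exists n.
move=> {1 3}<-; elim: j => [|j IH] jn; first by rewrite expr0 dvd1p.
have /dvdpP[Z eY] := IH (ltnW jn).
rewrite exprS eY; apply: dvdp_mul => //.
have c2 : ((2 * j).+1%:R : k) != 0.
  rewrite natk_eq0; apply/negP => /dvdn_leq; rewrite -half_p; lia.
rewrite -(Gauss_dvdpr _ cubic_coprime) -(dvdpZr _ _ c2).
have fj0 : f ^+ j != 0 by rewrite expf_neq0 // cubic_neq0.
have : f ^+ j * ((2 * j).+1%:R *: (f^`() * Z) + f * (2 *: Z^`())) = 0.
  rewrite -[RHS]e eY derivM deriv_exp -!mul_polyC !polyC_natr -mulr_natr -addn1.
  by rewrite natrD natrM; case: (j) => [|i]; rewrite /= ?expr0 ?exprS; ring.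
move=> /eqP; rewrite mulf_eq0 (negPf fj0) addr_eq0 => /eqP ->.
by rewrite -mulrN dvdp_mulr.
Qed.

Lemma coef_cubic_form (c3 c2 c1 c0 : k) :
  let Q := c3 *: 'X^3 + c2 *: 'X^2 + c1 *: 'X + c0%:P in
  [/\ Q`_3 = c3, Q`_2 = c2, Q`_1 = c1 & Q`_0 = c0].
Proof.
by split; rewrite !coefD !coefZ !coefXn coefX coefC /= !(mulr0, mulr1, add0r, addr0).
Qed.

(** A purely inseparable map of degree [p] fixing the origin is an affine
    function of [x^p] followed by an automorphism of the curve, and the only
    automorphisms are the signs because [a] and [b] do not vanish. *)
Lemma inseparable_degree_p (P : point E) N D : a != 0 -> b != 0 ->
  zero_at_infinity P -> reduced_x P p N D -> mult (coords P) 0 ->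
  P = frobenius \/ P = - frobenius.
Proof.
move=> a0 b0 zP rP mP; have p0 : (0 < p)%N by rewrite prime_gt0 // p_prime.
have [_ /(_ p0)[N'0 [D'0 D0]]] := inseparable rP mP.
have Dp := zero_at_infinityP zP rP.
have [pr [m m0 []]] := rP.
have [/= /and3P[sN sD _] _] := pr.
have coef_p (A : {poly k}) : A^`() = 0 -> (size A <= p.+1)%N ->
    A = A`_p *: 'X^p + (A`_0)%:P.
  move=> A'0 sA; apply/polyP => i; rewrite coefD coefZ coefXn coefC.
  have [->|ip] := eqVneq i p; first by rewrite mulr1 gtn_eqF // addr0.
  rewrite mulr0 add0r; have [->//|i0] := eqVneq i 0%N.
  have [pi|npi] := boolP (p %| i)%N; last exact: deriv0_coef.
  rewrite nth_default // (leq_trans sA) // ltn_neqAle eq_sym ip.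
  by rewrite dvdn_leq // lt0n.
have eD := coef_p D D'0 sD; rewrite Dp scale0r add0r in eD.
have d00 : D`_0 != 0 by apply: contraNneq D0 => h; rewrite eD h.
have eN := coef_p N N'0 sN.
have Np : N`_p != 0 by have := primitive_neq0 None pr; rewrite /= Dp xpair_eqE eqxx andbT.
case cP: (coords P) mP (coords_on P) => [[x y]|] mP oP /=; last first.
  by rewrite mulr0 => _ /eqP; rewrite of_eq0 (negPf D0).
rewrite mulr1 => nx dm.
pose al := N`_p / D`_0; pose be := N`_0 / D`_0.
have al0 : al != 0 by rewrite mulf_neq0 // invr_eq0.
pose G := al ^+ 3 *: 'X^3 + (3 * al ^+ 2 * be) *: 'X^2 +
  (3 * al * be ^+ 2 + a * al) *: 'X + (be ^+ 3 + a * be + b)%:P.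
have ex : x = (al *: 'X^p + be%:P)%:F.
  have D0F : D%:F != 0 by rewrite of_eq0.
  apply: (mulfI D0F); rewrite {1}dm -nx -rmorphM /=; congr (ff_of FF _).
  rewrite [LHS]eN [D]eD mulrDr mul_polyC scalerA -polyCM.
  by rewrite /al /be ![D`_0 * _]mulrC !divfK.
clearbody al be.
have eG : x ^+ 3 + a%:P%:F * x + b%:P%:F = (G \Po 'X^p)%:F.
  rewrite ex /G !comp_polyD !comp_polyZ !comp_Xn_poly comp_polyX comp_polyC.
  by rewrite -!mul_polyC !(polyCD, polyCM, polyC_exp); ring.
have [A [B [B0 ey]]] := ff_frac y.
have [d [A' [B' [prAB [g g0 [eA eB]]]]]] := primitive_exists A B0.
have B'0 : B' != 0 by apply: contraNneq B0 => h; rewrite eB h mul0r.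
have {}ey : y = A'%:F / B'%:F.
  rewrite ey eA eB !rmorphM /=; field.
  by rewrite !of_eq0 g0 B'0.
have sqr : f * A' ^+ 2 = (G \Po 'X^p) * B' ^+ 2.
  apply/eqP; rewrite !expr2 -(of_eq FF) !rmorphM /= -eG.
  move: oP => /= /eqP <-; rewrite ey; apply/eqP.
  by field; rewrite of_eq0.
have /eqP/size_poly1P[c c0 eB'] := square_root_poly cubic_simple_root (primitive_coprime prAB) sqr.
pose Y := c^-1 *: A'.
have {}ey : y = Y%:F.
  rewrite ey eB' /Y; have cF : c%:P%:F != 0 :> K by rewrite of_eq0 polyC_eq0.
  apply: (mulIf cF); rewrite divfK // -rmorphM /= mulrC mul_polyC scalerA.
  by rewrite mulfV // scale1r.
have {}sqr : f * Y ^+ 2 = G \Po 'X^p.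
  apply/eqP; rewrite -(of_eq FF) rmorphM rmorphXn /= -eG -ey.
  by move: oP => /= /eqP <-.
have /dvdpP[Z eY] : f ^+ n %| Y.
  apply: dvdp_cubic_exp; apply/eqP; rewrite -(of_eq0 FF); apply/eqP.
  have := mP.2; rewrite mulr0 ey /= !ff_der_of => <-.
  by rewrite rmorphD !rmorphM /= rmorph_nat.
have sqr' : (f \Po 'X^p) * Z ^+ 2 = G \Po 'X^p.
  have fp : f ^+ p = f * (f ^+ n) ^+ 2 by rewrite -exprM -exprS half_p.
  by rewrite -sqr eY -cubic_Frobenius fp; ring.
have [g3 g2 g1 g00] := coef_cubic_form (al ^+ 3) (3 * al ^+ 2 * be)
  (3 * al * be ^+ 2 + a * al) (be ^+ 3 + a * be + b).
rewrite -/G in g3 g2 g1 g00.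
have c3a : al ^+ 3 != 0 by rewrite expf_neq0.
have sG : (size (G \Po 'X^p) <= (3 * p).+1)%N.
  have sG4 : (size G <= 4)%N.
    apply/leq_sizeP => j j4; rewrite !coefD !coefZ !coefXn coefX coefC.
    by rewrite !gtn_eqF ?(leq_trans _ j4) // !mulr0 !addr0.
  apply: (leq_trans (size_comp_poly_leq _ _)); rewrite size_polyXn ltnS leq_mul2r.
  by move: sG4; case: (size G) => [|s] /=; rewrite ?ltnS ?orbT // => ->; rewrite orbT.
have G0 : G \Po 'X^p != 0.
  by apply: contraNneq c3a => h; rewrite -g3 (@comp_polyXp_inj G 0) ?coef0 // comp_poly0.
have Z0 : Z != 0 by apply: contraNneq G0 => h; rewrite -sqr' h expr0n mulr0.
have sZ : size Z == 1%N.
  have : size (f ^+ p * Z ^+ 2) = ((3 * p).+1 + (size Z).-1 * 2)%N.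
    rewrite size_mul ?expf_neq0 ?cubic_neq0 // -[size (f ^+ p)]prednK.
      by rewrite size_exp size_cubic addSn /= -[size (Z ^+ 2)]prednK ?size_exp ?addnS // size_poly_gt0 expf_neq0.
    by rewrite size_poly_gt0 expf_neq0 // cubic_neq0.
  rewrite cubic_Frobenius sqr' => sGe; move: sG; rewrite sGe.
  rewrite -[X in (_ <= X)%N]addn0 leq_add2l leqn0 muln_eq0 orbF.
  by move: Z0; rewrite -size_poly_gt0; case: (size Z) => [|[|]].
have /size_poly1P[z z0 eZ] := sZ.
have fG : z ^+ 2 *: f = G.
  apply: comp_polyXp_inj; rewrite comp_polyZ -sqr' eZ -mul_polyC polyC_exp.
  by rewrite mulrC.
have [f3 f2 f1 f0] := coef_cubic_form 1 0 a b.
have ef : 1 *: 'X^3 + 0 *: 'X^2 + a *: 'X + b%:P = f.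
  by rewrite /cubic scale1r scale0r addr0 mul_polyC.
rewrite ef in f3 f2 f1 f0.
have al3 : z ^+ 2 = al ^+ 3 by rewrite -g3 -fG coefZ f3 mulr1.
have be0 : be = 0.
  have /eqP := g2; rewrite -fG coefZ f2 mulr0 eq_sym !mulf_eq0 /=.
  by rewrite (negPf al0) (negPf (k3_neq0)) => /eqP.
have z2al : z ^+ 2 = al.
  apply: (mulfI a0); have := g1; rewrite -fG coefZ f1 be0 => e.
  by rewrite mulrC e expr0n /= mulr0 add0r.
have z21 : z ^+ 2 = 1.
  apply: (mulfI b0); have := g00; rewrite -fG coefZ f0 be0 => e.
  by rewrite mulrC e expr0n /= mulr0 !add0r mulr1.
have al1 : al = 1 by rewrite -z2al z21.
have {}ex : x = 'X^p%:F by rewrite ex al1 be0 scale1r addr0.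
have {}eY : Y = z *: f ^+ n by rewrite eY eZ mul_polyC.
have /orP[/eqP z1|/eqP z1] : (z == 1) || (z == -1) by rewrite -eqf_sqr z21 expr1n.
- by left; apply: val_inj; rewrite [val P]cP ex ey eY z1 scale1r.
- by right; apply: val_inj; rewrite [val P]cP ex ey eY z1 scaleN1r /= rmorphN.
Qed.

End CharP.

(** * Complex multiplication by an endomorphism of degree 5 *)

Section Endomorphism.
Variables (R : comNzRingType) (t : R).
Hypothesis t_root : t ^+ 2 = t - 5%:R.

(** The multiplication by [t = (1 + sqrt(-19)) / 2] on the curve
    [y^2 = x^3 + 8 x + 4 t - 2] is [(x, y) |-> (N / h^2, y M / h^3)]. The roots
    of [h] are the abscissas of the kernel, which has order 5, the norm of [t];
    [N] and [M] come from Velu's formulas for that kernel, normalised so that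
    the differential [dx / y] is multiplied by [t]. *)
Definition cm_num : {poly R} := 'X^5 + (4%:R * t)%:P * 'X^4
  + (20%:R * t - 60%:R)%:P * 'X^3 - (160%:R + 64%:R * t)%:P * 'X^2
  + (240%:R - 144%:R * t)%:P * 'X + (160%:R + 32%:R * t)%:P.

Definition cm_ker : {poly R} :=
  t%:P * 'X^2 + (2%:R * t - 10%:R)%:P * 'X - (4%:R + 4%:R * t)%:P.

Definition cm_ord : {poly R} := 'X^6 + (6%:R * t)%:P * 'X^5 - 44%:R * 'X^4
  + (56%:R - 16%:R * t)%:P * 'X^3 + (48%:R * t - 96%:R)%:P * 'X^2
  - (32%:R + 64%:R * t)%:P * 'X + 64%:R.

Local Notation N := cm_num.
Local Notation h := cm_ker.
Local Notation M := cm_ord.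

Lemma quad_mul (u v u' v' : {poly R}) :
  (u + t%:P * v) * (u' + t%:P * v') =
  (u * u' - 5%:R * (v * v')) + t%:P * (u * v' + v * u' + v * v').
Proof.
have e : t%:P * t%:P = t%:P - 5%:R :> {poly R}.
  by rewrite -polyCM -expr2 t_root polyCB polyC_natr.
have -> : (u + t%:P * v) * (u' + t%:P * v') =
  u * u' + t%:P * (u * v' + v * u') + t%:P * t%:P * (v * v') by ring.
by rewrite e; ring.
Qed.

Lemma cm_equation : N ^+ 3 + 8%:R * N * h ^+ 4 + (4%:R * t - 2%:R)%:P * h ^+ 6 =
  ('X^3 + 8%:R * 'X + (4%:R * t - 2%:R)%:P) * M ^+ 2.
Proof.
pose N0 : {poly R} := 'X^5 - 60%:R * 'X^3 - 160%:R * 'X^2 + 240%:R * 'X + 160%:R.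
pose N1 : {poly R} := 4%:R * 'X^4 + 20%:R * 'X^3 - 64%:R * 'X^2 - 144%:R * 'X + 32%:R.
pose h0 : {poly R} := - 10%:R * 'X - 4%:R.
pose h1 : {poly R} := 'X^2 + 2%:R * 'X - 4%:R.
pose M0 : {poly R} := 'X^6 - 44%:R * 'X^4 + 56%:R * 'X^3 - 96%:R * 'X^2 - 32%:R * 'X + 64%:R.
pose M1 : {poly R} := 6%:R * 'X^5 - 16%:R * 'X^3 + 48%:R * 'X^2 - 64%:R * 'X.
have -> : N = N0 + t%:P * N1 by rewrite /N /N0 /N1; ring.
have -> : h = h0 + t%:P * h1 by rewrite /h /h0 /h1; ring.
have -> : M = M0 + t%:P * M1 by rewrite /M /M0 /M1; ring.
have -> : (4%:R * t - 2%:R)%:P = - 2%:R + t%:P * 4%:R :> {poly R} by ring.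
have -> : 'X^3 + 8%:R * 'X + (- 2%:R + t%:P * 4%:R) =
  ('X^3 + 8%:R * 'X - 2%:R) + t%:P * 4%:R :> {poly R} by ring.
have sq (x : {poly R}) : x ^+ 4 = (x * x) * (x * x) by ring.
have six (x : {poly R}) : x ^+ 6 = (x * x) * (x * x) * (x * x) by ring.
have cb (x : {poly R}) : x ^+ 3 = (x * x) * x by ring.
rewrite sq six [(N0 + _) ^+ 3]cb [(M0 + _) ^+ 2]expr2.
have -> : 8%:R * (N0 + t%:P * N1) = 8%:R * N0 + t%:P * (8%:R * N1) by ring.
rewrite !quad_mul.
have comb (u v u' v' u'' v'' : {poly R}) : u + t%:P * v + (u' + t%:P * v') +
  (u'' + t%:P * v'') = (u + u' + u'') + t%:P * (v + v' + v'') by ring.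
rewrite comb; congr (_ + t%:P * _).
all: by rewrite /N0 /N1 /h0 /h1 /M0 /M1; ring.
Qed.

Lemma cm_differential : N^`() * h - 2%:R * N * h^`() = t%:P * M.
Proof.
have e : t%:P ^+ 2 - t%:P + 5%:R = 0 :> {poly R}.
  by rewrite -polyC_exp t_root polyCB polyC_natr; ring.
apply/eqP; rewrite -subr_eq0; apply/eqP.
transitivity ((t%:P ^+ 2 - t%:P + 5%:R) * (- 6%:R * 'X^5 - 4%:R * 'X^4
  + 120%:R * 'X^3 + 144%:R * 'X^2 + 736%:R * 'X + 448%:R : {poly R})).
  by rewrite /N /h /M !derivE; ring.
by rewrite e mul0r.
Qed.

End Endomorphism.

Section ComplexMultiplication.
Variables (k : closedFieldType) (p : nat).
Hypotheses (charp : p \in [pchar k]) (p_neq2 : p != 2%N) (p_neq3 : p != 3%N).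
Variable FF : function_field k.
Variable t : k.
Hypothesis t_root : t ^+ 2 = t - 5.
Local Notation K := (ff_sort FF).
Local Notation "N %:F" := (ff_of FF N) : ring_scope.
Local Notation N := (cm_num t).
Local Notation h := (cm_ker t).
Local Notation M := (cm_ord t).

Definition cmB : k := 4 * t - 2.

Lemma cm_disc : 4 * (8 : k) ^+ 3 + 27 * cmB ^+ 2 != 0.
Proof.
have -> : 4 * (8 : k) ^+ 3 + 27 * cmB ^+ 2 = - (2 * 2).
  have -> : 4 * (8 : k) ^+ 3 + 27 * cmB ^+ 2 = 2048 + 27 * (16 * t ^+ 2 - 16 * t + 4).
    by rewrite /cmB; ring.
  by rewrite t_root; ring.
by rewrite oppr_eq0 mulf_neq0 // (k2_neq0 charp).
Qed.

Local Notation f := (cubic 8 cmB).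
Local Notation E := (fcurve charp p_neq2 FF cm_disc).
Local Notation der := (ff_der (f := FF)).
Local Notation mult := (multiplier E der).

Lemma cm_equation_cubic : N ^+ 3 + 8%:P * N * h ^+ 4 + cmB%:P * h ^+ 6 = f * M ^+ 2.
Proof.
by rewrite /cubic /cmB polyC_natr; exact: cm_equation t_root.
Qed.

(** The numerator and the kernel polynomial generate [2^5]. The Bezout cofactors
    [U] and [V] are those over the ring of integers of [Q(sqrt(-19))]; the last
    term of the relation absorbs the multiple of [t^2 - t + 5] that is left when
    [t] is a variable. *)
Lemma cm_num_ker_coprime r : h.[r] = 0 -> N.[r] != 0.
Proof.
move=> h0; apply/eqP => N0.
have two5 : (2 : k) ^+ 5 != 0 by rewrite expf_neq0 // (k2_neq0 charp).
case/eqP: two5.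
pose U := 310 - 77 * t - 50 * t * r.
pose V := 3552 - 2384 * t - (5240 + 1812 * t) * r + (914 * t - 2380) * r ^+ 2
  + (15 + 162 * t) * r ^+ 3 + 50 * r ^+ 4.
pose U1 := - 77 - 50 * r.
pose V1 := - 2384 - 1812 * r + 914 * r ^+ 2 + 162 * r ^+ 3.
pose N1 := 4 * r ^+ 4 + 20 * r ^+ 3 - 64 * r ^+ 2 - 144 * r + 32.
pose h1 := r ^+ 2 + 2 * r - 4.
transitivity (U * N.[r] + V * h.[r] - (t ^+ 2 - t + 5) * (U1 * N1 + V1 * h1)).
  rewrite /cm_num /cm_ker !(hornerD, hornerN, hornerM, hornerC, hornerX, hornerXn).
  by rewrite /U /V /U1 /V1 /N1 /h1; ring.
by rewrite N0 h0 t_root; ring.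
Qed.

Lemma coef_cm_num : N`_5 = 1.
Proof.
by rewrite /cm_num !(coefD, coefN, coefCM, coefXn, coefX, coefC) /= !(mulr0, addr0, subr0).
Qed.

Lemma size_cm_num : (size N <= 6)%N.
Proof.
apply/leq_sizeP => i i6; rewrite /cm_num !(coefD, coefN, coefCM, coefXn, coefX, coefC).
by rewrite !gtn_eqF ?(leq_trans _ i6) // !(mulr0, addr0, subr0).
Qed.

Lemma size_cm_ker : (size h <= 3)%N.
Proof.
apply/leq_sizeP => i i3; rewrite /cm_ker !(coefD, coefN, coefCM, coefXn, coefX, coefC).
by rewrite !gtn_eqF ?(leq_trans _ i3) // !(mulr0, addr0, subr0).
Qed.

Lemma cm_ker_neq0 : h != 0.
Proof.
apply/eqP => h0; have /closed_rootP[r /rootP Nr] : size N != 1%N.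
  apply/eqP => s1; have := coef_cm_num.
  by rewrite nth_default ?s1 // => /esym/eqP; rewrite oner_eq0.
by have := @cm_num_ker_coprime r; rewrite h0 horner0 Nr eqxx => /(_ erefl).
Qed.

Lemma cm_primitive : primitive 5 [:: N; h ^+ 2].
Proof.
have sh2 : (size (h ^+ 2) <= 5)%N.
  rewrite expr2; apply: (leq_trans (size_polyMleq _ _)).
  by have := size_cm_ker; case: (size h) => [|[|[|[|]]]].
split=> [|[r|]] /=; first by rewrite size_cm_num (leq_trans sh2).
  rewrite orbF -negb_and; apply/negP => /andP[/eqP N0].
  rewrite horner_exp expf_eq0 /= => /eqP h0.
  by have := cm_num_ker_coprime h0; rewrite N0 eqxx.
by rewrite coef_cm_num oner_neq0.
Qed.

Lemma cm_ord_neq0 : M != 0.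
Proof.
have : M`_6 = 1.
  have e44 : 44 = 44%:P :> {poly k} by rewrite polyC_natr.
  have e64 : 64 = 64%:P :> {poly k} by rewrite polyC_natr.
  rewrite /cm_ord e44 e64 !(coefD, coefN, coefCM, coefXn, coefX, coefC) /=.
  by rewrite !(mulr0, addr0, subr0).
by apply: contra_eq_neq => ->; rewrite coef0 eq_sym oner_neq0.
Qed.

Lemma hF_neq0 : h%:F != 0. Proof. by rewrite of_eq0 cm_ker_neq0. Qed.

Lemma cm_on : on_cubic E (Some (N%:F / h%:F ^+ 2, M%:F / h%:F ^+ 3)).
Proof.
rewrite /=; apply/eqP.
have e : f%:F * M%:F ^+ 2 =
    N%:F ^+ 3 + (8%:P)%:F * N%:F * h%:F ^+ 4 + cmB%:P%:F * h%:F ^+ 6.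
  have e := congr1 (ff_of FF) cm_equation_cubic.
  by transitivity (f * M ^+ 2)%:F; [ring | rewrite -e; ring].
have -> : f%:F * (M%:F / h%:F ^+ 3) ^+ 2 = (f%:F * M%:F ^+ 2) / h%:F ^+ 6.
  by field; exact: hF_neq0.
by rewrite e; field; exact: hF_neq0.
Qed.

Definition cm_point : point E := Point cm_on.

Lemma cm_point_reduced : reduced_x cm_point 5 N (h ^+ 2).
Proof.
split; first exact: cm_primitive.
exists (h%:F ^+ 2); first by rewrite expf_neq0 ?hF_neq0.
by rewrite /= rmorphXn mulr1; split=> //; field; exact: hF_neq0.
Qed.

Lemma cm_point_zero_at_infinity : zero_at_infinity cm_point.
Proof.
exists 5%N, N, (h ^+ 2); split; first exact: cm_point_reduced.
rewrite nth_default // expr2; apply: (leq_trans (size_polyMleq _ _)).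
by have := size_cm_ker; case: (size h) => [|[|[|[|]]]].
Qed.

Lemma der_const (c : k) : der c%:P%:F = 0.
Proof. by rewrite ff_der_of derivC rmorph0. Qed.

Lemma cm_point_multiplier : mult (coords cm_point) t%:P%:F.
Proof.
apply: multiplier_of; first exact: (@ff_derD _ FF).
- exact: (@ff_derM _ FF).
- exact: der_const.
- exact: der_const.
- exact: cm_on.
- by rewrite mulf_neq0 ?invr_eq0 ?expf_neq0 ?hF_neq0 // of_eq0 cm_ord_neq0.
rewrite (derV (@ff_derM _ FF)) ?expf_neq0 ?hF_neq0 //.
rewrite (derX2 (@ff_derM _ FF)) !ff_der_of.
have e : t%:P%:F * M%:F = (N^`())%:F * h%:F - 2 * N%:F * (h^`())%:F.
  by have /(congr1 (ff_of FF)) := cm_differential t_root => e; transitivity (t%:P * M)%:F; [ring | rewrite -e; ring].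
have -> : t%:P%:F * (M%:F / h%:F ^+ 3) = (t%:P%:F * M%:F) / h%:F ^+ 3.
  by field; exact: hF_neq0.
by rewrite e; field; exact: hF_neq0.
Qed.

Lemma id_on : on_cubic E (Some ('X%:F, 1)).
Proof.
apply/eqP; rewrite /= expr1n mulr1 /cubic; ring.
Qed.

Definition id_point : point E := Point id_on.

Lemma id_point_reduced : reduced_x id_point 1 'X 1.
Proof.
split; last by exists 1; rewrite ?oner_neq0 //= rmorph1 !mul1r.
split=> [|[r|]] /=; first by rewrite size_polyX size_poly1.
  by rewrite hornerC oner_neq0 orbT.
by rewrite coefX oner_neq0.
Qed.

Lemma id_point_zero_at_infinity : zero_at_infinity id_point.
Proof. by exists 1%N, 'X, 1; split; [exact: id_point_reduced | rewrite coefC]. Qed.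

Lemma id_point_multiplier : mult (coords id_point) 1.
Proof.
apply: multiplier_of; first exact: (@ff_derD _ FF).
- exact: (@ff_derM _ FF).
- exact: der_const.
- exact: der_const.
- exact: id_on.
- exact: oner_neq0.
by rewrite ff_der_of derivX rmorph1 mulr1.
Qed.

End ComplexMultiplication.

(** * Counting points over the prime field *)

Section PrimeFieldSums.
Variables (k : fieldType) (p : nat).
Hypothesis charp : p \in [pchar k].

Lemma nat_expp (c : nat) : (c%:R : k) ^+ p = c%:R.
Proof. by rewrite -(pFrobenius_autE charp) pFrobenius_aut_nat. Qed.

(** Sum [(c + 1)^(i + 1) - c^(i + 1)] over [c < p] in two ways. *)
Lemma power_sum0 i : (i < p.-1)%N -> \sum_(0 <= c < p) (c%:R : k) ^+ i = 0.
Proof.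
elim/ltn_ind: i => i IH ip.
have i1 : (i.+1%:R : k) != 0.
  rewrite -(dvdn_pcharf charp); apply/negP => /dvdn_leq; have := prime_gt1 (pcharf_prime charp); lia.
apply: (mulfI i1); rewrite mulr0.
have tele : \sum_(0 <= c < p) ((c.+1%:R : k) ^+ i.+1 - c%:R ^+ i.+1) = 0.
  by rewrite telescope_sumr // (pcharf0 charp) !expr0n subr0.
rewrite -[RHS]tele; transitivity (\sum_(0 <= c < p) i.+1%:R * (c%:R : k) ^+ i).
  by rewrite mulr_sumr.
transitivity (\sum_(0 <= c < p) (\sum_(j < i) (c%:R : k) ^+ j *+ 'C(i.+1, j) +
    i.+1%:R * (c%:R : k) ^+ i)).
  rewrite big_split /= exchange_big /= [X in _ = X + _]big1 ?add0r // => j _.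
  by rewrite sumrMnl IH ?mul0rn // (ltn_trans _ ip).
apply: eq_bigr => c _; rewrite -[c.+1]add1n natrD exprDn !big_ord_recr /=.
rewrite subnn binn !expr1n !mul1r mulr1n binSn mulr_natl addrK.
by congr (_ + _); apply: eq_bigr => j _; rewrite expr1n mul1r.
Qed.

Lemma power_sum_pred : \sum_(0 <= c < p) (c%:R : k) ^+ p.-1 = -1.
Proof.
have p0 := prime_gt0 (pcharf_prime charp); have p1 := prime_gt1 (pcharf_prime charp).
rewrite big_ltn // expr0n gtn_eqF ?add0r; last by case: (p) p1 => [|[]].
transitivity (\sum_(1 <= c < p) (1 : k)).
  rewrite big_nat [RHS]big_nat; apply: eq_bigr => c /andP[c0 cp].
  have c_neq0 : (c%:R : k) != 0 by rewrite -(dvdn_pcharf charp) gtnNdvd.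
  by apply: (mulfI c_neq0); rewrite -exprS prednK // nat_expp mulr1.
rewrite sumr_const_nat; apply/eqP; rewrite -addr_eq0 -(natrD _ _ 1) subnK //.
by rewrite (pcharf0 charp).
Qed.

Lemma poly_sum (g : {poly k}) : (size g <= (p.-1).*2)%N ->
  \sum_(0 <= c < p) g.[c%:R] = - g`_(p.-1).
Proof.
move=> sg; have p1 := prime_gt1 (pcharf_prime charp).
transitivity (\sum_(0 <= c < p) \sum_(i < (p.-1).*2) g`_i * (c%:R : k) ^+ i).
  by apply: eq_bigr => c _; rewrite (horner_coef_wide _ sg).
have pd : (p.-1 < (p.-1).*2)%N by case: (p) p1 => [|[|]] //= q _; rewrite -addnn; lia.
rewrite exchange_big /= (bigD1 (Ordinal pd)) //= -mulr_sumr power_sum_pred.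
rewrite mulrN1 big1 ?addr0 // => i; rewrite -val_eqE /= => ip.
rewrite -mulr_sumr; have [lt|ge] := ltnP i p.-1; first by rewrite power_sum0 ?mulr0.
have ip' : (p <= i)%N.
  have : (p.-1 < i)%N by rewrite ltn_neqAle eq_sym ip.
  by rewrite (prednK (prime_gt0 (pcharf_prime charp))).
transitivity (g`_i * \sum_(0 <= c < p) (c%:R : k) ^+ (i - p.-1)).
  congr (_ * _); apply: eq_bigr => c _.
  rewrite -[in LHS](subnK ip') exprD nat_expp -exprSr; congr (_ ^+ _); lia.
have i2 : (i < p.-1 + p.-1)%N by rewrite addnn.
by rewrite power_sum0 ?mulr0 //; move: i2 ge p1; lia.
Qed.

Definition prime_field : seq k := [seq c%:R | c <- iota 0 p].

Lemma prime_field_uniq : uniq prime_field.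
Proof.
rewrite map_inj_in_uniq ?iota_uniq // => i j; rewrite !mem_iota /= !add0n => ip jp.
wlog le : i j ip jp / (i <= j)%N => [W e|].
  by case: (leqP i j) => h; [exact: W | symmetry; apply: W => //; exact: ltnW].
move/eqP; rewrite -subr_eq0 -opprB oppr_eq0 -natrB // -(dvdn_pcharf charp) => d.
apply/eqP; rewrite eqn_leq le /= -subn_eq0; apply: contraLR d.
by rewrite -lt0n => h; rewrite gtnNdvd // (leq_ltn_trans (leq_subr _ _)).
Qed.

Lemma prime_field_prod : 'X^p - 'X = \prod_(c <- prime_field) ('X - c%:P) :> {poly k}.
Proof.
have p1 := prime_gt1 (pcharf_prime charp).
have sz : size ('X^p - 'X : {poly k}) = p.+1.
  by rewrite size_polyDl size_polyXn // size_polyN size_polyX.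
have lc : lead_coef ('X^p - 'X : {poly k}) = 1.
  by rewrite lead_coefDl ?lead_coefXn // size_polyN size_polyX size_polyXn.
rewrite -[RHS]scale1r -lc; apply: all_roots_prod_XsubC.
- by rewrite sz size_map size_iota.
- apply/allP => _ /mapP[c _ ->].
  by rewrite /root hornerD hornerN hornerXn hornerX nat_expp subrr.
- by rewrite uniq_rootsE prime_field_uniq.
Qed.

Lemma fixed_prime_field (x : k) : x ^+ p = x -> exists2 c, (c < p)%N & x = c%:R.
Proof.
move=> xp; have : root (\prod_(c <- prime_field) ('X - c%:P)) x.
  by rewrite -prime_field_prod /root hornerD hornerN hornerXn hornerX xp subrr.
by rewrite root_prod_XsubC => /mapP[c]; rewrite mem_iota => cp ->; exists c.
Qed.

End PrimeFieldSums.

(** * The degree of Frobenius minus the identity *)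

Section FrobeniusMinusOne.
Variables (k : closedFieldType) (p : nat).
Hypotheses (charp : p \in [pchar k]) (p_neq2 : p != 2%N).
Variable FF : function_field k.
Variables a b : k.
Hypotheses (disc : 4 * a ^+ 3 + 27 * b ^+ 2 != 0) (a_p : a ^+ p = a) (b_p : b ^+ p = b).
Local Notation K := (ff_sort FF).
Local Notation "N %:F" := (ff_of FF N) : ring_scope.
Local Notation f := (cubic a b).
Local Notation n := p./2.
Local Notation E := (fcurve charp p_neq2 FF disc).
Local Notation Fp := (prime_field k p).

(** The Hasse invariant of [y^2 = f(x)]: up to a [p]-th root, the factor by which
    the Cartier operator multiplies the differential [dx / y]. *)
Definition hasse : k := (f ^+ n)`_(p.-1).

Let p_pos : (0 < p)%N. Proof. exact: prime_gt0 (pcharf_prime charp). Qed.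
Let p2n : (n * 2).+1 = p := half_p charp p_neq2.
Let n_pos : (0 < n)%N.
Proof. by have := prime_gt1 (pcharf_prime charp); move: p2n; case: (n) => // <-. Qed.

Lemma euler_cases (x : k) : x \in Fp ->
  [\/ f.[x] = 0, f.[x] ^+ n = 1 | f.[x] ^+ n = -1].
Proof.
case/mapP => c _ ->; set v := f.[_].
have vp : v ^+ p = v.
  rewrite /v -(pFrobenius_autE charp) horner_cubic !pFrobenius_autD_comm; try exact: mulrC.
  rewrite [pFrobenius_aut _ (a * _)]pFrobenius_autM_comm; last exact: mulrC.
  by rewrite !pFrobenius_autE a_p b_p -exprM mulnC exprM (nat_expp charp).
have [v0|v0] := eqVneq v 0; first by constructor 1.
have : (v ^+ n) ^+ 2 = 1 ^+ 2.
  by apply: (mulfI v0); rewrite -exprM -exprS p2n vp expr1n mulr1.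
by move/eqP; rewrite eqf_sqr => /orP[/eqP|/eqP]; [constructor 2|constructor 3].
Qed.

Let root1 := [pred x : k | f.[x] ^+ n == 1].
Let root0 := [pred x : k | f.[x] == 0].
Let R := [seq x <- Fp | root1 x].
Let Z := [seq x <- Fp | root0 x].
Let W := [seq x <- Fp | f.[x] ^+ n == -1].
Let pr (s : seq k) : {poly k} := \prod_(x <- s) ('X - x%:P).

Let one_neq_mone : (1 : k) != -1.
Proof.
by rewrite -addr_eq0 -[1 + 1]/(2%:R) (k2_neq0 charp p_neq2).
Qed.

Let exp0n : (0 : k) ^+ n = 0. Proof. by rewrite expr0n -[n == 0%N]negbK -lt0n n_pos. Qed.

Lemma perm_RZW : perm_eq Fp (R ++ Z ++ W).
Proof.
apply: uniq_perm; first exact: prime_field_uniq.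
  have U := prime_field_uniq charp.
  rewrite !cat_uniq !filter_uniq // !andbT /= has_cat negb_or; apply/andP; split.
    apply/andP; split; apply/hasPn => x; rewrite !mem_filter /= => /andP[h _].
      by rewrite (eqP h) exp0n eq_sym oner_eq0.
    by rewrite (eqP h) eq_sym (negPf one_neq_mone).
  apply/hasPn => x; rewrite !mem_filter /= => /andP[h _].
  apply/negP => /andP[/eqP h0 _]; move: h; rewrite h0 exp0n eq_sym oppr_eq0.
  by rewrite oner_eq0.
move=> x; rewrite !mem_cat !mem_filter -!andb_orl /=.
case Fx: (x \in Fp); rewrite ?andbF //= andbT; apply/esym.
by have [->|->|->] := euler_cases Fx; rewrite ?eqxx ?orbT.
Qed.

Lemma size_RZW : (size R + size Z + size W = p)%N.
Proof.
by have := perm_size perm_RZW; rewrite !size_cat size_map size_iota addnA => /esym.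
Qed.

Lemma prod_RZW : 'X^p - 'X = pr R * pr Z * pr W.
Proof.
by rewrite (prime_field_prod charp) (perm_big _ perm_RZW) /= !big_cat /= mulrA.
Qed.

Lemma size_pr s : size (pr s) = (size s).+1.
Proof. exact: size_prod_XsubC. Qed.

Lemma pr_neq0 s : pr s != 0.
Proof. by rewrite -size_poly_gt0 size_pr. Qed.

(** The counting function, in [k]: each [c] contributes [1 + f(c)^n]. *)
Lemma count_hasse : ((2 * size R + size Z)%:R : k) = - hasse.
Proof.
have := @poly_sum _ _ charp (f ^+ n + 1).
have sf : (size (f ^+ n + 1)%R <= (p.-1).*2)%N.
  rewrite (leq_trans (size_polyD _ _)) // geq_max size_poly1.
  have -> : (p.-1 = n * 2)%N by rewrite -[in LHS]p2n.
  have : size (f ^+ n) = (3 * n).+1.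
    by rewrite -[LHS]prednK ?size_exp ?size_cubic // size_poly_gt0 expf_neq0 // cubic_neq0.
  by move=> ->; move: n_pos; lia.
move=> /(_ sf); rewrite coefD coef1.
have -> : (p.-1 == 0)%N = false by rewrite -[in LHS]p2n; move: n_pos; case: (n).
rewrite addr0 => <-.
have -> : \sum_(0 <= c < p) (f ^+ n + 1).[c%:R] = \sum_(x <- Fp) (f.[x] ^+ n + 1).
  rewrite big_map /index_iota subn0; apply: eq_bigr => c _.
  by rewrite hornerD horner_exp hornerC.
rewrite (perm_big _ perm_RZW) /= !big_cat /=.
have -> : \sum_(x <- R) (f.[x] ^+ n + 1) = (2 * size R)%:R.
  rewrite big_filter -sum1_size natrM natr_sum mulr_sumr /R big_filter.
  by apply: eq_bigr => x /eqP ->; rewrite mulr1.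
have -> : \sum_(x <- Z) (f.[x] ^+ n + 1) = (size Z)%:R.
  rewrite big_filter -sum1_size natr_sum /Z big_filter.
  by apply: eq_bigr => x /eqP ->; rewrite exp0n add0r.
rewrite big_filter big1 ?addr0 ?natrD //.
by move=> x /eqP ->; rewrite addNr.
Qed.

Let dvd_prod (g : {poly k}) s : uniq s -> (forall x, x \in s -> g.[x] = 0) -> pr s %| g.
Proof.
move=> us h; apply: uniq_roots_dvdp; last by rewrite uniq_rootsE.
by apply/allP => x xs; apply/rootP/h.
Qed.

(** By the addition formula, the abscissa of [F - 1] has denominator
    [(x^p - x)^2], and the factors [x - c] with [f(c)^n = -1] cancel twice, those
    with [f(c) = 0] once. The degree is thus one plus the number of abscissas [c]
    of nonzero rational points, counted with the two signs of the ordinate. *)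
Lemma frobenius_sub_id_degree (P : point E) : coords P = Some ('X%:F, 1) ->
  has_degree (frobenius charp p_neq2 FF disc a_p b_p - P) (1 + 2 * size R + size Z)%N.
Proof.
move=> eP; have U := prime_field_uniq charp.
have /dvdpP[f1 ef] : pr Z %| f.
  by apply: dvd_prod; [exact: filter_uniq | move=> x; rewrite mem_filter => /andP[/eqP]].
have /dvdpP[g eg] : pr W %| f ^+ n + 1.
  apply: dvd_prod; first exact: filter_uniq.
  by move=> x; rewrite mem_filter => /andP[/eqP e _]; rewrite hornerD horner_exp hornerC e addNr.
pose D := pr R ^+ 2 * pr Z.
pose N := f1 * g ^+ 2 - ('X^p + 'X) * D.
have eW : pr Z * pr W ^+ 2 * N = f * (f ^+ n + 1) ^+ 2 - ('X^p + 'X) * ('X^p - 'X) ^+ 2.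
  by rewrite prod_RZW /N /D eg [X in _ = X * _ - _]ef; ring.
pose L := a%:P * 'X^p + b%:P + 2 * f ^+ n.+1 + f + 'X^(p.+2) - 'X^3.
have eL : pr Z * pr W ^+ 2 * N = 'X^((2 * p).+1) + L.
  have fp : f ^+ p = 'X^p ^+ 3 + a%:P * 'X^p + b%:P.
    rewrite (cubic_Frobenius charp a_p b_p) /cubic !comp_polyD comp_Xn_poly comp_polyM.
    by rewrite !comp_polyC comp_polyX.
  have fp' : f * (f ^+ n) ^+ 2 = f ^+ p by rewrite -exprM -exprS p2n.
  rewrite eW; transitivity (f ^+ p + 2 * (f * f ^+ n) + f - ('X^p + 'X) * ('X^p - 'X) ^+ 2).
    by rewrite -fp'; ring.
  rewrite fp /L -exprS mulnC ['X^((p * 2).+1)]exprS exprM ['X^(p.+2)]exprS ['X^(p.+1)]exprS.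
  by ring.
have sf m : size (f ^+ m) = (3 * m).+1.
  by rewrite -[LHS]prednK ?size_exp ?size_cubic // size_poly_gt0 expf_neq0 // cubic_neq0.
have sL : (size L <= (2 * p).+1)%N.
  have B (A A' : {poly k}) : (size A <= (2 * p).+1)%N -> (size A' <= (2 * p).+1)%N ->
      (size (A + A')%R <= (2 * p).+1)%N.
    by move=> h h'; rewrite (leq_trans (size_polyD _ _)) // geq_max h.
  rewrite /L; apply: (B _ _ (B _ _ (B _ _ (B _ _ (B _ _ _ _) _) _) _) _).
  - rewrite mul_polyC (leq_trans (size_scale_leq _ _)) // size_polyXn; lia.
  - by rewrite (leq_trans (size_polyC_leq1 _)).
  - rewrite -polyC_natr mul_polyC (leq_trans (size_scale_leq _ _)) // sf; lia.
  - rewrite -[f]expr1 sf; lia.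
  - rewrite size_polyXn; lia.
  - rewrite size_polyN size_polyXn; lia.
have seL : size (pr Z * pr W ^+ 2 * N) = (2 * p).+2.
  by rewrite eL size_polyDl size_polyXn.
have N0 : N != 0 by apply: contra_eq_neq seL => ->; rewrite mulr0 size_poly0.
have sQ s : size (pr s ^+ 2) = (size s * 2).+1.
  by rewrite -[LHS]prednK ?size_exp ?size_pr // size_poly_gt0 expf_neq0 // pr_neq0.
have sD : size D = (1 + 2 * size R + size Z)%N.
  by rewrite /D size_mul ?expf_neq0 ?pr_neq0 // sQ size_pr; lia.
have sN : size N = (1 + 2 * size R + size Z).+1.
  move: seL; rewrite size_mul ?mulf_neq0 ?expf_neq0 ?pr_neq0 //.
  rewrite size_mul ?expf_neq0 ?pr_neq0 // sQ size_pr.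
  by move: (size R) (size Z) (size W) (size N) size_RZW; lia.
have N_at x : D.[x] = 0 -> N.[x] = f1.[x] * (g.[x] * g.[x]).
  by move=> D0; rewrite /N hornerD hornerN [(_ * D).[x]]hornerM D0 mulr0 subr0 hornerM expr2 hornerM.
have g_at x : g.[x] * (pr W).[x] = f.[x] ^+ n + 1.
  by rewrite -hornerM -eg hornerD horner_exp hornerC.
have prim : primitive (1 + 2 * size R + size Z) [:: N; D].
  split=> [|[x|]] /=; first by rewrite sN sD leqnn leqnSn.
    rewrite orbF -negb_and; apply/negP => /andP[/eqP Nx /eqP Dx].
    move: Nx; rewrite N_at // => /eqP; rewrite !mulf_eq0 orbb => Nx.
    have : (x \in R) || (x \in Z).
      by move/eqP: Dx; rewrite /D expr2 !hornerM !mulf_eq0 orbb -!rootE !root_prod_XsubC.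
    case/orP => xs; move: (xs); rewrite mem_filter /= => /andP[/eqP fx _].
      have fx0 : f.[x] != 0.
        by apply: contra_eq_neq fx => ->; rewrite exp0n eq_sym oner_neq0.
      case/orP: Nx => /eqP Nx.
        by move: fx0; rewrite ef hornerM Nx mul0r eqxx.
      by move: (g_at x); rewrite Nx mul0r fx => /eqP; rewrite eq_sym (negPf (k2_neq0 charp p_neq2)).
    case/orP: Nx => /eqP Nx; last first.
      by move: (g_at x); rewrite Nx mul0r fx exp0n add0r => /eqP; rewrite eq_sym oner_eq0.
    have /eqP [] := cubic_simple_root disc fx.
    have Zx : (pr Z).[x] = 0 by apply/eqP; rewrite -rootE root_prod_XsubC.
    by rewrite ef derivM hornerD !hornerM Nx Zx mulr0 mul0r addr0.
  have -> : N`_(1 + 2 * size R + size Z) = lead_coef N by rewrite /lead_coef sN.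
  by rewrite lead_coef_eq0 N0.
exists (1 + 2 * size R + size Z)%N, N, D; split=> //; split=> //.
rewrite coordsD coordsN eP /=.
have XX : 'X^p - 'X != 0 :> {poly k} by rewrite prod_RZW !mulf_neq0 ?pr_neq0.
have nX : 'X^p%:F != 'X%:F :> K by rewrite of_eq -subr_eq0.
rewrite /slope (negPf nX) (inj_eq (@Some_inj _)) xpair_eqE eq_sym (negPf nX) /=.
exists D%:F; first by rewrite of_eq0 -size_poly_gt0 sD.
split; last by rewrite mulr1.
have e1 : 'X%:F - 'X^p%:F = - ((pr R)%:F * (pr Z)%:F * (pr W)%:F).
  by rewrite -!rmorphM /= -prod_RZW rmorphB opprB.
have e2 : - 1 - (f ^+ n)%:F = - (g%:F * (pr W)%:F).
  by rewrite -rmorphM /= -eg rmorphD rmorph1; ring.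
have eD : D%:F = (pr R)%:F ^+ 2 * (pr Z)%:F by rewrite /D; ring.
have eN : N%:F = f1%:F * (g ^+ 2)%:F - ('X^p%:F + 'X%:F) * D%:F.
  by rewrite /N rmorphB !rmorphM /= rmorphD.
have ef' : f%:F = f1%:F * (pr Z)%:F by rewrite -rmorphM /= -ef.
rewrite e1 e2 eN eD ef' rmorphXn /=; move: ('X^p%:F : K) => xp.
by field; rewrite ?oppr_eq0 ?mulf_neq0 ?of_eq0 ?pr_neq0.
Qed.

(** Manin's form of the point count: the degree of [F - 1] is the number of
    points over the prime field. *)
Lemma frobenius_sub_id_hasse (P : point E) (d : int) : coords P = Some ('X%:F, 1) ->
  has_degree (frobenius charp p_neq2 FF disc a_p b_p - P) d -> d%:~R = 1 - hasse.
Proof.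
move=> eP hd; rewrite -(has_degree_uniq (frobenius_sub_id_degree eP) hd).
by rewrite -pmulrn -addnA natrD count_hasse.
Qed.

End FrobeniusMinusOne.

(** * The trace of Frobenius when [p] splits *)

Section Split.
Variables (k : closedFieldType) (p : nat).
Hypotheses (charp : p \in [pchar k]) (p_neq2 : p != 2%N) (p_neq3 : p != 3%N)
  (p_neq19 : p != 19%N) (p_neq5 : p != 5%N).
Variable FF : function_field k.
Variable t : k.
Hypotheses (t_root : t ^+ 2 = t - 5) (t_p : t ^+ p = t).

Lemma intk_eq0 (z : int) : (z%:~R == 0 :> k) = (p %| `|z|)%N.
Proof.
case: z => j; first by rewrite -(dvdn_pcharf charp).
by rewrite NegzE mulrNz oppr_eq0 abszN -(dvdn_pcharf charp).
Qed.

Let nat_p c : (c%:R : k) ^+ p = c%:R := nat_expp charp c.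

Lemma cmB_p : cmB t ^+ p = cmB t.
Proof.
rewrite /cmB -(pFrobenius_autE charp) pFrobenius_autB_comm; last exact: mulrC.
rewrite pFrobenius_autM_comm; last exact: mulrC.
by rewrite !pFrobenius_aut_nat pFrobenius_autE t_p.
Qed.

Lemma eight_neq0 : (8 : k) != 0.
Proof.
by rewrite (_ : 8 = 2 ^+ 3) ?expf_neq0 ?(k2_neq0 charp) //; ring.
Qed.

Lemma cmB_neq0 : cmB t != 0.
Proof.
apply/eqP => B0; have e : cmB t ^+ 2 = - (2 ^+ 2 * 19).
  rewrite /cmB; transitivity (16 * (t ^+ 2 - t) + 4); first by ring.
  by rewrite t_root; ring.
move/eqP: e; rewrite B0 expr0n eq_sym oppr_eq0 mulf_eq0 expf_eq0 /=.
rewrite (negPf (k2_neq0 charp p_neq2)) /= -(dvdn_pcharf charp) dvdn_prime2 ?(pcharf_prime charp) //.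
by rewrite (negPf p_neq19).
Qed.

Local Notation E := (fcurve charp p_neq2 FF (cm_disc charp p_neq2 t_root)).
Local Notation P := (id_point charp p_neq2 FF t_root).
Local Notation T := (cm_point charp p_neq2 FF t_root).
Local Notation Frob := (frobenius charp p_neq2 FF (cm_disc charp p_neq2 t_root) (nat_p 8) cmB_p).

Variables m n : int.
Hypotheses (norm_p : m ^+ 2 + m * n + 5 * n ^+ 2 = p%:Z) (mult0 : m%:~R + n%:~R * t = 0).

Lemma n_neq0 : (n%:~R : k) != 0.
Proof.
apply/negP => n0; have m0 : (m%:~R : k) == 0.
  by move: mult0; rewrite (eqP n0) mul0r addr0 => ->.
have e z : (z%:~R == 0 :> k) = (p%:Z %| z)%Z by rewrite intk_eq0 dvdzE.
move: n0 m0; rewrite !e => /dvdzP[n' en] /dvdzP[m' em].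
have p1 := prime_gt1 (pcharf_prime charp).
have : p%:Z * (p%:Z * (m' ^+ 2 + m' * n' + 5 * n' ^+ 2)) = p%:Z * 1.
  by rewrite mulr1 -[RHS]norm_p en em; ring.
move/mulfI => /(_ _) h; have /h : p%:Z != 0 by lia.
move=> /(congr1 absz); rewrite abszM /= => /eqP; rewrite muln_eq1 => /andP[/eqP] ; lia.
Qed.

Lemma m_neq0 : (m%:~R : k) != 0.
Proof.
apply/negP => /eqP m0; move: mult0; rewrite m0 add0r => /eqP.
rewrite mulf_eq0 (negPf n_neq0) /= => /eqP t0; move: t_root.
rewrite t0 expr0n sub0r => /esym/eqP; rewrite oppr_eq0 -(dvdn_pcharf charp).
by rewrite dvdn_prime2 ?(pcharf_prime charp) // (negPf p_neq5).
Qed.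

Lemma lattice_degree (i j : int) w : has_degree (P + T) w ->
  has_degree (P *~ i + T *~ j) (i ^+ 2 * 1 + i * j * (w - 1 - 5) + j ^+ 2 * 5).
Proof.
by apply: degree_form; [exact: erefl | exact: erefl
  | apply: reduced_has_degree (id_point_reduced _ _ _ _)
  | apply: reduced_has_degree (cm_point_reduced _ _ _ _)].
Qed.

Lemma lattice_multiplier :
  multiplier E (ff_der (f := FF)) (coords (P *~ m + T *~ n)) 0.
Proof.
have D := @ff_derD _ FF; have M := @ff_derM _ FF.
have a0 : ff_der (cub_a E) = 0 by exact: der_const.
have -> : 0 = m%:~R * 1 + n%:~R * ff_of FF t%:P.
  rewrite -(rmorph0 (ff_of FF)) -(polyC0 k) -mult0 polyCD polyCM rmorphD rmorphM /=.
  by rewrite !rmorph_int mulr1.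
rewrite coordsD; apply: multiplier_add => //; try exact: coords_on.
  by apply: multiplierMz => //; exact: id_point_multiplier.
by apply: multiplierMz => //; exact: cm_point_multiplier.
Qed.

(** The trace form [B] of the identity and the endomorphism is 1: it is small
    by positivity, and congruent to 1 because the degree of an inseparable
    map is divisible by [p]. *)
Lemma trace_form w : has_degree (P + T) w -> w - 1 - 5 = 1.
Proof.
move=> hw; set B := w - 1 - 5.
have hB : B ^+ 2 <= 20.
  have [d [N [D [_]]]] := lattice_degree (- B) 2 hw.
  by rewrite -/B => e; nia.
have [d [N [D [r ed]]]] := lattice_degree m n hw.
have [pd _] := inseparable r lattice_multiplier.
have d0 : (d%:Z%:~R : k) = 0 by apply/eqP; rewrite intk_eq0.
have p0 : (p%:Z%:~R : k) = 0 by apply/eqP; rewrite intk_eq0 /=.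
have : (m%:~R * n%:~R * (B - 1)%:~R : k) == 0.
  have -> : m%:~R * n%:~R * (B - 1)%:~R = d%:Z%:~R - p%:Z%:~R :> k.
    by rewrite -ed -norm_p -!intrM -!intrB; congr _%:~R; rewrite -/B; ring.
  by rewrite d0 p0 subr0.
rewrite !mulf_eq0 (negPf m_neq0) (negPf n_neq0) /= intk_eq0 => pB.
have p7 : (5 < p)%N.
  by move: (pcharf_prime charp) p_neq2 p_neq3 p_neq5; case: (p) => [|[|[|[|[|[|q]]]]]].
have [/eqP|] := posnP `|B - 1|%N; first by rewrite absz_eq0 subr_eq0 => /eqP.
move=> /dvdn_leq /(_ pB) le; move: (leq_trans p7 le) hB; clearbody B; clear=> h1 h2.
have [h3 h4] : -4 <= B /\ B <= 4 by split; nia.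
by move: h1 h3 h4; clear; lia.
Qed.

(** The endomorphism [m + n t] is inseparable of degree [p], hence is the
    Frobenius endomorphism up to sign. The quadratic form then gives the degree
    of Frobenius minus the identity as [p + 1 -+ (2 m + n)], to be compared with
    Manin's count. *)
Lemma hasse_split : hasse p 8 (cmB t) ^+ 2 = (2 * m + n)%:~R ^+ 2.
Proof.
have [w [N0 [D0 rw]]] := reduced_x_exists (P + T).
have hw := reduced_has_degree rw; have B1 := trace_form hw.
have deg i j : has_degree (P *~ i + T *~ j) (i ^+ 2 + i * j + 5 * j ^+ 2).
  have := lattice_degree i j hw; rewrite B1.
  by rewrite (_ : _ + _ + _ = i ^+ 2 + i * j + 5 * j ^+ 2) //; ring.
have zQ : zero_at_infinity (P *~ m + T *~ n).
  have zP := id_point_zero_at_infinity charp p_neq2 FF t_root.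
  have zT := cm_point_zero_at_infinity charp p_neq2 FF t_root.
  have za := zero_at_infinityMz (erefl (cub_a E)) (erefl (cub_b E)).
  by case: (zero_at_infinity_sum_diff (erefl (cub_a E)) (erefl (cub_b E)) (za _ m zP) (za _ n zT)).
have [d [N [D [r ed]]]] := deg m n.
have {ed}dp : d = p by move: ed; rewrite norm_p => -[].
rewrite dp in r.
have eP : coords P = Some (ff_of FF 'X, 1) by [].
have [eQ|eQ] := inseparable_degree_p p_neq3 (nat_p 8) cmB_p eight_neq0 cmB_neq0 zQ r lattice_multiplier.
  have := deg (m - 1) n; rewrite mulrzBr mulr1z addrAC eQ => /(frobenius_sub_id_hasse eP).
  have -> : (m - 1) ^+ 2 + (m - 1) * n + 5 * n ^+ 2 = p%:Z + 1 - (2 * m + n).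
    by rewrite -norm_p; ring.
  rewrite intrB intrD -pmulrn (pcharf0 charp) add0r => /addrI/oppr_inj ->.
  by [].
have := deg (- (m + 1)) (- n).
have -> : P *~ - (m + 1) + T *~ - n = Frob - P.
  by rewrite !mulrNz mulrzDr mulr1z -opprD addrAC eQ opprD opprK.
move=> /(frobenius_sub_id_hasse eP).
have -> : (- (m + 1)) ^+ 2 + - (m + 1) * - n + 5 * (- n) ^+ 2 = p%:Z + 1 + (2 * m + n).
  by rewrite -norm_p; ring.
rewrite !intrD -pmulrn (pcharf0 charp) add0r => /addrI e.
by rewrite e sqrrN.
Qed.

End Split.

(** * The Hasse invariant vanishes when [p] is inert *)

Lemma map_cubic_horner (R S : comNzRingType) (phi : {rmorphism R -> S}) (a b : R) x :
  (map_poly phi (cubic a b)).[x] = x ^+ 3 + phi a * x + phi b.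
Proof.
rewrite /cubic !rmorphD /= map_polyXn rmorphM /= map_polyX !map_polyC.
by rewrite !hornerD hornerXn hornerM !hornerC hornerX.
Qed.

Lemma deriv_exp_mul (R : comNzRingType) (A B : {poly R}) i e :
  (e.+1%:R : R) = - 2 * i.+1%:R ->
  (A ^+ i.+1 * B ^+ e.+1)^`() =
    i.+1%:R *: (A ^+ i * B ^+ e * (A^`() * B - 2 * A * B^`())).
Proof.
move=> ee; have {}ee : (e.+1%:R : {poly R}) = - 2 * i.+1%:R.
  by rewrite -polyC_natr ee polyCM polyCN !polyC_natr.
rewrite derivM !deriv_exp [i.+1.-1]/= [e.+1.-1]/= -mul_polyC polyC_natr.
by rewrite -[_ *+ i.+1]mulr_natr -[_ *+ e.+1]mulr_natr ee !exprS; ring.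
Qed.

Section Inert.
Variables (k : closedFieldType) (p : nat).
Hypotheses (charp : p \in [pchar k]) (p_neq2 : p != 2%N).
Variable FF : function_field k.
Variable t : k.
Hypotheses (t_root : t ^+ 2 = t - 5) (t_not_fixed : t ^+ p != t).
Local Notation n := p./2.
Local Notation f := (cubic 8 (cmB t)).
Local Notation N := (cm_num t).
Local Notation h := (cm_ker t).
Local Notation M := (cm_ord t).
Local Notation "A %:F" := (ff_of FF A) : ring_scope.

Let p2n : (n * 2).+1 = p := half_p charp p_neq2.
Let p_pos : (0 < p)%N := prime_gt0 (pcharf_prime charp).

Lemma coef_exp_top (A : {poly k}) d m : (size A <= d.+1)%N ->
  (size (A ^+ m) <= (d * m).+1)%N /\ (A ^+ m)`_(d * m) = A`_d ^+ m.
Proof.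
move=> sA; elim: m => [|m [IH1 IH2]]; first by rewrite muln0 expr0 size_poly1 coef1.
rewrite exprS mulnS exprS -IH2; split; last exact: (pvalM None).
by apply: (leq_trans (size_polyMleq _ _)); move: sA IH1; lia.
Qed.

(** Clearing denominators in [f(R)^n = (S^2 f)^n], where [R = N / h^2]
    and [S = M / h^3] are the coordinates of the endomorphism. *)
Lemma pullback_exp :
  \sum_(i < (3 * n).+1) (f ^+ n)`_i *: (N ^+ i * h ^+ (2 * (3 * n - i))) = f ^+ n * M ^+ (2 * n).
Proof.
have hF0 := hF_neq0 charp p_neq2 FF t_root.
apply/eqP; rewrite -(of_eq FF) rmorph_sum /=; apply/eqP.
pose phi : {rmorphism k -> ff_sort FF} := ff_of FF \o polyC.
pose r := N%:F / h%:F ^+ 2; pose y := M%:F / h%:F ^+ 3.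
have hn0 : h%:F ^+ (6 * n) != 0 by rewrite expf_neq0.
have ev : (map_poly phi (f ^+ n)).[r] = (f%:F * y ^+ 2) ^+ n.
  rewrite rmorphXn horner_exp; congr (_ ^+ _).
  have /eqP -> := cm_on charp p_neq2 FF t_root; rewrite -/r /=.
  exact: map_cubic_horner.
have sf : (size (map_poly phi (f ^+ n)) <= (3 * n).+1)%N.
  rewrite size_map_poly -[X in (X <= _)%N]prednK ?size_exp ?size_cubic //.
  by rewrite size_poly_gt0 expf_neq0 // cubic_neq0.
transitivity (h%:F ^+ (6 * n) * (map_poly phi (f ^+ n)).[r]).
  rewrite (horner_coef_wide _ sf) mulr_sumr; apply: eq_bigr => i _.
  rewrite coef_map -mul_polyC !rmorphM !rmorphXn /=.
  have -> : (6 * n = 2 * i + 2 * (3 * n - i))%N by have := ltn_ord i; lia.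
  rewrite exprD [h%:F ^+ (2 * i)]exprM /r expr_div_n.
  by field; rewrite !expf_neq0.
rewrite ev rmorphM !rmorphXn /= exprMn -exprM /y expr_div_n -exprM mulnA.
by field.
Qed.

(** The endomorphism multiplies the differential by [t], so that pulling back
    [f^n dx] gives [t f^n] up to a [p]-th power. Expand the pull-back over the
    coefficients of [f^n]: every term but the one of degree [p - 1] is a derivative,
    and the leading coefficients make this one contribute [t^p A], where [A] is the
    Hasse invariant. Hence [t A = t^p A]. *)
Lemma hasse_inert : hasse p 8 (cmB t) = 0.
Proof.
rewrite /hasse; set A := _`_(p.-1).
have sM : (size M <= 7)%N.
  have e44 : 44 = 44%:P :> {poly k} by rewrite polyC_natr.
  have e64 : 64 = 64%:P :> {poly k} by rewrite polyC_natr.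
  apply/leq_sizeP => i i7; rewrite /cm_ord e44 e64.
  rewrite !(coefD, coefN, coefCM, coefXn, coefX, coefC) !gtn_eqF ?(leq_trans _ i7) //.
  by rewrite !(mulr0, addr0, subr0).
have top_M : M`_6 = 1.
  have e44 : 44 = 44%:P :> {poly k} by rewrite polyC_natr.
  have e64 : 64 = 64%:P :> {poly k} by rewrite polyC_natr.
  rewrite /cm_ord e44 e64 !(coefD, coefN, coefCM, coefXn, coefX, coefC) /=.
  by rewrite !(mulr0, addr0, subr0).
have top_h : h`_2 = t.
  rewrite /cm_ker !(coefD, coefN, coefCM, coefXn, coefX, coefC) /=.
  by rewrite !(mulr0, mulr1, addr0, subr0).
pose m := (7 * p).-1.
have mS : m.+1 = (7 * p)%N by rewrite prednK // muln_gt0.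
(* The coefficient of [X^(7p - 1)] in the identity [Sum = t M^p f^n]. *)
have rhs : (t%:P * (f ^+ n * M ^+ p))`_m = t * A.
  rewrite coefCM; congr (_ * _).
  have [M' eM sM'] : exists2 M' : {poly k}, M = 'X^6 + M' & (size M' <= 6)%N.
    exists (M - 'X^6); first by ring.
    apply/leq_sizeP => i; rewrite leq_eqVlt => /predU1P[<-|i6].
      by rewrite coefB top_M coefXn eqxx subrr.
    by rewrite coefB coefXn gtn_eqF // subr0 nth_default // (leq_trans sM).
  have cp : p \in [pchar {poly k}] by rewrite pchar_poly.
  have eMp : M ^+ p = 'X^(6 * p) + M' ^+ p.
    rewrite eM -!(pFrobenius_autE cp) pFrobenius_autD_comm; last exact: mulrC.
    by rewrite !pFrobenius_autE -exprM.
  rewrite eMp mulrDr coefD coefMXn.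
  have m6 : (m < 6 * p)%N = false by move: p_pos mS; lia.
  rewrite m6 (_ : (m - 6 * p = p.-1)%N); last by move: p_pos mS; lia.
  rewrite [X in _ + X]nth_default ?addr0 //.
  have [sMp _] := coef_exp_top p sM'.
  have [sfn _] := @coef_exp_top f 3 n (eq_leq (size_cubic _ _)).
  apply: (leq_trans (size_polyMleq _ _)); move: sMp sfn mS p_pos p2n.
  by clear; move: (size _) (size _) => x y; lia.
have lhs : t%:P * (f ^+ n * M ^+ p) =
  \sum_(i < (3 * n).+1) (f ^+ n)`_i *:
    (N ^+ i * h ^+ (2 * (3 * n - i)) * (N^`() * h - 2 * N * h^`())).
  have -> : t%:P * (f ^+ n * M ^+ p) = (f ^+ n * M ^+ (2 * n)) * (t%:P * M).
    have -> : M ^+ p = M ^+ (2 * n) * M by rewrite -exprSr; congr (_ ^+ _); lia.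
    by ring.
  rewrite -(cm_differential t_root) -pullback_exp mulr_suml.
  by apply: eq_bigr => i _; rewrite -scalerAl.
have pn : (p.-1 < (3 * n).+1)%N by move: p2n p_pos; lia.
have := congr1 (fun Q : {poly k} => Q`_m) lhs; rewrite rhs coef_sum.
rewrite (bigD1 (Ordinal pn)) //= [X in _ = _ + X]big1 ?addr0; last first.
  (* The other terms are derivatives, up to a nonzero factor, and the
     coefficient of [X^(7p - 1)] in a derivative is a multiple of [7p]. *)
  move=> i; rewrite -val_eqE /= => ip; rewrite coefZ.
  set e := (2 * (3 * n - i))%N.
  have i1 : (i.+1%:R : k) != 0.
    rewrite -(dvdn_pcharf charp); apply/negP => /dvdnP[[|[|q]] eq] //.
      by move: ip; rewrite -[(i : nat)]/(i.+1.-1) eq mul1n eqxx.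
    by have := ltn_ord i; move: eq p2n; clear; lia.
  have ee : (e.+1%:R : k) = - 2 * i.+1%:R.
    apply/eqP; rewrite -subr_eq0 mulNr opprK -natrM -natrD -(dvdn_pcharf charp).
    by apply/dvdnP; exists 3; rewrite /e; have := ltn_ord i; move: p2n; clear; lia.
  have der : (N ^+ i.+1 * h ^+ e.+1)^`() =
      i.+1%:R *: (N ^+ i * h ^+ e * (N^`() * h - 2 * N * h^`())).
    exact: deriv_exp_mul.
  have : i.+1%:R * (N ^+ i * h ^+ e * (N^`() * h - 2 * N * h^`()))`_m = 0.
    rewrite -coefZ -der coef_deriv mS -mulr_natr natrM (pcharf0 charp).
    by rewrite !mulr0.
  by move/eqP; rewrite mulf_eq0 (negPf i1) /= => /eqP ->; rewrite mulr0.
rewrite coefZ -/A (cm_differential t_root).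
have -> : (2 * (3 * n - p.-1) = p.-1)%N by move: p2n; lia.
have -> : (N ^+ p.-1 * h ^+ p.-1 * (t%:P * M))`_m = t ^+ p.
  have -> : N ^+ p.-1 * h ^+ p.-1 * (t%:P * M) = t%:P * (N ^+ p.-1 * h ^+ p.-1 * M) by ring.
  have [sN tN] := coef_exp_top p.-1 (size_cm_num t).
  have [sh th] := coef_exp_top p.-1 (size_cm_ker t).
  have sNh : (size (N ^+ p.-1 * h ^+ p.-1)%R <= (5 * p.-1 + 2 * p.-1).+1)%N.
    apply: (leq_trans (size_polyMleq _ _)); move: sN sh; clear.
    by move: (size _) (size _) => x y; lia.
  have tNh := pvalM None sN sh; rewrite /= tN th coef_cm_num top_h expr1n mul1r in tNh.
  have := pvalM None sNh sM; rewrite /= tNh top_M mulr1.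
  have -> : (5 * p.-1 + 2 * p.-1 + 6 = m)%N by move: mS p_pos; clear; lia.
  by rewrite coefCM => ->; rewrite -exprS prednK.
move=> /eqP; rewrite [A * _]mulrC -subr_eq0 -mulrBl mulf_eq0 subr_eq0.
by rewrite eq_sym (negPf t_not_fixed) /= => /eqP.
Qed.

End Inert.

(** * Primes represented by the form of discriminant -19 *)

(** The principal form is the only reduced form of discriminant -19. A form
    [A X^2 + B X Y + C Y^2] is thus the principal form in two integral linear
    forms, and reduction carries these two along. *)
Lemma principal_form (A B C : int) : 0 < A -> 4 * A * C - B ^+ 2 = 19 ->
  exists m n m' n' : int, [/\ A = m ^+ 2 + m * n + 5 * n ^+ 2,
    C = m' ^+ 2 + m' * n' + 5 * n' ^+ 2
  & B = 2 * m * m' + m * n' + m' * n + 10 * n * n'].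
Proof.
have [s] := ubnP `|A|%N; elim: s A B C => // s IH A B C As A0 disc.
pose q := ((B + A) %/ (2 * A))%Z; pose B' := B - 2 * q * A.
pose C' := C - q * B + q ^+ 2 * A.
have disc' : 4 * A * C' - B' ^+ 2 = 19 by rewrite -disc /C' /B'; ring.
have [b1 b2] : - A <= B' /\ B' < A.
  have A2 : 2 * A != 0 by lia.
  have := divz_eq (B + A) (2 * A); have := modz_ge0 (B + A) A2.
  have : ((B + A) %% (2 * A) < `|2 * A|)%Z by rewrite ltz_mod.
  rewrite -/q /B'; move: (_ %% _)%Z => r; lia.
suff [m [n [m' [n' [eA eC eB]]]]] : exists m n m' n' : int,
    [/\ A = m ^+ 2 + m * n + 5 * n ^+ 2, C' = m' ^+ 2 + m' * n' + 5 * n' ^+ 2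
    & B' = 2 * m * m' + m * n' + m' * n + 10 * n * n'].
  exists m, n, (m' + q * m), (n' + q * n); split=> //.
    have -> : C = C' + q * B' + q ^+ 2 * A by rewrite /C' /B'; ring.
    by rewrite eC eB eA; ring.
  have -> : B = B' + 2 * q * A by rewrite /B'; ring.
  by rewrite eB eA; ring.
clearbody B' C'; clear disc B C q.
have C0 : 0 < C' by nia.
have [CA|AC] := ltP C' A.
  have [|||m' [n' [m [n [eC eA eB]]]]] := IH C' B' A.
  - by lia.
  - exact: C0.
  - by rewrite -disc'; ring.
  by exists m, n, m', n'; split=> //; rewrite eB; ring.
have A2 : A <= 2 by nia.
have [eA|eA] : A = 1 \/ A = 2 by lia.
  exists 1, 0, 0, (-1); move: b1 b2 disc'; rewrite eA => b1 b2 disc'.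
  have eB : B' = -1.
    have [e|//] : B' = 0 \/ B' = -1 by lia.
    by move: disc'; rewrite e expr0n; lia.
  by rewrite eB; move: disc'; rewrite eB; split=> //; lia.
move: b1 b2 disc'; rewrite eA => b1 b2 disc'.
have [e|[e|[e|e]]] : B' = -2 \/ B' = -1 \/ B' = 0 \/ B' = 1 by lia.
all: by move: disc'; rewrite e expr2; lia.
Qed.

Lemma norm_form_scaled (m n : int) :
  4 * (m ^+ 2 + m * n + 5 * n ^+ 2) = (2 * m + n) ^+ 2 + 19 * n ^+ 2.
Proof. by ring. Qed.

Lemma norm_form_of_scaled (q x y : int) : 4 * q = x ^+ 2 + 19 * y ^+ 2 ->
  exists m, x = 2 * m + y /\ q = m ^+ 2 + m * y + 5 * y ^+ 2.
Proof.
move=> e; have [m em] : exists m, x = 2 * m + y.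
  exists ((x - y) %/ 2)%Z; have := divz_eq (x - y) 2; have := modz_ge0 (x - y) (isT : 2 != 0 :> int).
  have : ((x - y) %% 2 < `|2|)%Z by rewrite ltz_mod.
  move: (_ %/ _)%Z (_ %% _)%Z => u r r1 r2 er; have [r0|r1'] : r = 0 \/ r = 1 by lia.
    by rewrite r0 in er; lia.
  have ex : x = 2 * u + 1 + y by lia.
  exfalso; move: e; rewrite ex.
  have -> : (2 * u + 1 + y) ^+ 2 + 19 * y ^+ 2 = 4 * (u ^+ 2 + u + u * y + 5 * y ^+ 2) + 2 * y + 1 by ring.
  by lia.
exists m; split=> //; apply: (@mulfI _ 4) => //.
by rewrite norm_form_scaled -em.
Qed.

Section Residues.
Variables (k : closedFieldType) (p : nat).
Hypotheses (charp : p \in [pchar k]).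

(** A root of [t^2 - t + 5] in the prime field makes [p] the value of a form
    of discriminant -19. *)
Lemma represented (t : k) : t ^+ 2 = t - 5 -> t ^+ p = t ->
  exists m n : int, p%:Z = m ^+ 2 + m * n + 5 * n ^+ 2.
Proof.
move=> t_root /(fixed_prime_field charp)[c _ et].
have : ((c%:Z ^+ 2 - c%:Z + 5)%:~R : k) == 0.
  by rewrite intrD intrB rmorphXn /= -!pmulrn -et t_root; apply/eqP; ring.
rewrite (intk_eq0 charp) -[p]/(`|p%:Z|%N) -dvdzE => /dvdzP[C eC].
have p0 : 0 < p%:Z by have := prime_gt0 (pcharf_prime charp); lia.
have [|m [n [m' [n' [eA _ _]]]]] := @principal_form p%:Z (2 * c%:Z - 1) C p0.
  transitivity (4 * (C * p%:Z) - (2 * c%:Z - 1) ^+ 2); first by ring.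
  by rewrite -eC; ring.
by exists m, n.
Qed.

(** The Gaussian period of order 9 in the 19th roots of unity is fixed by the
    [p]-th power when [p] is a square modulo 19, and satisfies
    [e^2 + e + 5 = 0]. *)
Lemma split_root : (p %% 19)%N \in [:: 1; 4; 5; 6; 7; 9; 11; 16; 17]%N ->
  exists t : k, t ^+ 2 = t - 5 /\ t ^+ p = t.
Proof.
move=> pQ; have [z /rootP] : exists z : k, root (\sum_(i < 19) 'X^i) z.
  apply/closed_rootP; apply/eqP => s1.
  have : (\sum_(i < 19) 'X^i : {poly k})`_18 = 1.
    rewrite coef_sum (bigD1 (inord 18)) //= inordK // coefXn eqxx big1 ?addr0 //.
    by move=> i; rewrite -val_eqE /= inordK // coefXn eq_sym => /negPf ->.
  by rewrite nth_default ?s1 // => /esym/eqP; rewrite oner_eq0.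
rewrite !big_ord_recr big_ord0 /= !hornerE => Phi.
have z19 : z ^+ 19 = 1.
  apply/eqP; rewrite -subr_eq0; apply/eqP; rewrite -[RHS](mulr0 (z - 1)) -[in RHS]Phi.
  by ring.
pose e := z ^+ 1 + z ^+ 4 + z ^+ 5 + z ^+ 6 + z ^+ 7 + z ^+ 9 + z ^+ 11 + z ^+ 16 + z ^+ 17.
have e2 : e ^+ 2 + e + 5 = 0.
  (* The second factor is the quotient of [e^2 + e + 5] by the cyclotomic polynomial. *)
  rewrite -[RHS](mulr0 (5 - 4 * z - z ^+ 3 + z ^+ 4 + 2 * z ^+ 5 + 2 * z ^+ 10
    - z ^+ 13 - z ^+ 14 + z ^+ 15 + z ^+ 16)) -[in RHS]Phi /e.
  by ring.
(* The [p]-th power permutes the nine terms of [e]. *)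
have ep : e ^+ p = e.
  rewrite -(pFrobenius_autE charp) /e !pFrobenius_autD_comm; try exact: mulrC.
  rewrite !pFrobenius_autE -!exprM.
  have red j : z ^+ (j * p) = z ^+ ((j * (p %% 19)) %% 19) by rewrite modnMmr expr_mod.
  rewrite !red; move: (p %% 19)%N pQ => c.
  rewrite !inE => /orP[|/orP[|/orP[|/orP[|/orP[|/orP[|/orP[|/orP[]]]]]]]] /eqP -> /=; ring.
exists (- e); split.
  by apply/eqP; rewrite -subr_eq0 -[X in _ == X]e2; apply/eqP; ring.
by rewrite -(pFrobenius_autE charp) pFrobenius_autN pFrobenius_autE ep.
Qed.

End Residues.

Lemma legendre19_eq1 (p : nat) : legendre p%:Z 19 = 1 ->
  (p %% 19)%N \in [:: 1; 4; 5; 6; 7; 9; 11; 16; 17]%N.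
Proof.
rewrite /legendre; case: ifP => // n19; case: ifP => // /existsP[x hx] _.
have e : p = x * x %[mod 19].
  apply/eqP; rewrite -[(_ == _)]/(p == x * x %[mod 19]) eq_sym -eqz_nat -!modz_nat.
  by rewrite eqz_mod_dvd PoszM -expr2.
rewrite e; have x19 := ltn_ord x; have n19' : (p %% 19 != 0)%N.
  by apply/negP => /eqP h; move: n19; rewrite dvdzE /= /dvdn h.
move: n19'; rewrite e; move: (nat_of_ord x) x19 => {e hx} {}x.
by do 19 (case: x => [|x] //).
Qed.

Lemma legendre19_eqN1 (p : nat) (x y : int) : 4 * p%:Z = x ^+ 2 + 19 * y ^+ 2 ->
  legendre p%:Z 19 <> -1.
Proof.
move=> e; rewrite /legendre; case: ifP => // _; case: ifPn => // /existsPn h _.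
(* Modulo 19, 10 is the inverse of 2, so that [10 x] is a square root of [p]. *)
have r0 := modz_ge0 (10 * x) (isT : 19 != 0 :> int).
have r1 : ((10 * x) %% 19 < `|19|)%Z by rewrite ltz_mod.
have lt : (`|((10 * x) %% 19)%Z| < 19)%N by lia.
have /negP := h (Ordinal lt); apply => /=.
have := divz_eq (10 * x) 19; rewrite gez0_abs //.
move: (_ %/ _)%Z (_ %% _)%Z => u r ex.
apply/dvdzP; exists (21 * p%:Z - 20 * x * u + 19 * u ^+ 2 - 100 * y ^+ 2).
have er : r = 10 * x - u * 19 by rewrite ex; ring.
have e' : p%:Z = 100 * (x ^+ 2 + 19 * y ^+ 2) - 399 * p%:Z by rewrite -e; ring.
by rewrite er {1}e'; ring.
Qed.

(** * Coefficients of the two hypergeometric series *)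

Definition acoef (c : nat) : nat := 'C(3 * c, c) * 'C(6 * c, 3 * c).
Definition bcoef (c : nat) : nat := 'C(2 * c, c) * 'C(3 * c, c) * 'C(6 * c, 3 * c).

Lemma acoef_fact c : (acoef c * (c`! * (2 * c)`! * (3 * c)`!) = (6 * c)`!)%N.
Proof.
have e1 : ('C(3 * c, c) * (c`! * (2 * c)`!) = (3 * c)`!)%N.
  by rewrite -(bin_fact (m := c) (n := 3 * c)); [congr (_ * (_ * _`!)); lia | lia].
have e2 : ('C(6 * c, 3 * c) * ((3 * c)`! * (3 * c)`!) = (6 * c)`!)%N.
  by rewrite -(bin_fact (m := 3 * c) (n := 6 * c)); [congr (_ * (_ * _`!)); lia | lia].
by rewrite -e2 -{2}e1 /acoef; ring.
Qed.

Lemma bcoef_fact c : (bcoef c * (c`! ^ 3 * (3 * c)`!) = (6 * c)`!)%N.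
Proof.
have e1 : ('C(2 * c, c) * (c`! * c`!) = (2 * c)`!)%N.
  by rewrite -(bin_fact (m := c) (n := 2 * c)); [congr (_ * (_ * _`!)); lia | lia].
by rewrite -acoef_fact -e1 /acoef /bcoef; ring.
Qed.

Lemma acoef_rec c : (c.+1 ^ 2 * acoef c.+1 = 12 * (6 * c + 1) * (6 * c + 5) * acoef c)%N.
Proof.
have h := acoef_fact c; have h' := acoef_fact c.+1.
have f6 : ((6 * c.+1)`! = (6 * c + 6) * (6 * c + 5) * (6 * c + 4) * (6 * c + 3) *
  (6 * c + 2) * (6 * c + 1) * (6 * c)`!)%N.
  have -> : (6 * c.+1 = (6 * c).+2.+4)%N by lia.
  by rewrite !factS; ring.
have f3 : ((3 * c.+1)`! = (3 * c + 3) * (3 * c + 2) * (3 * c + 1) * (3 * c)`!)%N.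
  have -> : (3 * c.+1 = (3 * c).+3)%N by lia.
  by rewrite !factS; ring.
have f2 : ((2 * c.+1)`! = (2 * c + 2) * (2 * c + 1) * (2 * c)`!)%N.
  have -> : (2 * c.+1 = (2 * c).+2)%N by lia.
  by rewrite !factS; ring.
move: h'; rewrite f6 f3 f2 factS -h.
set u := (c`! * (2 * c)`! * (3 * c)`!)%N => e.
have u0 : (0 < u * (4 * (3 * c + 3) * (3 * c + 2) * (3 * c + 1) * (2 * c + 1)))%N.
  by rewrite !muln_gt0 !fact_gt0 !addn_gt0 !orbT.
apply/eqP; rewrite -(eqn_pmul2r u0); apply/eqP.
transitivity (2 * (acoef c.+1 * (c.+1 * c`! * ((2 * c + 2) * (2 * c + 1) * (2 * c)`!) *
  ((3 * c + 3) * (3 * c + 2) * (3 * c + 1) * (3 * c)`!))))%N.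
  by rewrite /u; ring.
by rewrite e -/u; ring.
Qed.

Lemma bcoef_rec c :
  (c.+1 ^ 3 * bcoef c.+1 = 24 * (2 * c + 1) * (6 * c + 1) * (6 * c + 5) * bcoef c)%N.
Proof.
have bE i : bcoef i = ('C(2 * i, i) * acoef i)%N by rewrite /bcoef -mulnA.
have rec2 : (c.+1 * 'C(2 * c.+1, c.+1) = 2 * (2 * c + 1) * 'C(2 * c, c))%N.
  have e i : ('C(2 * i, i) * (i`! * i`!) = (2 * i)`!)%N.
    by rewrite -(bin_fact (m := i) (n := 2 * i)); [congr (_ * (_ * _`!)); lia | lia].
  have := e c.+1; have -> : (2 * c.+1 = (2 * c).+2)%N by lia.
  rewrite !factS -(e c) => h.
  have u0 : (0 < c.+1 * (c`! * c`!))%N by rewrite !muln_gt0 !fact_gt0.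
  apply/eqP; rewrite -(eqn_pmul2r u0); apply/eqP.
  transitivity ('C((2 * c).+2, c.+1) * (c.+1 * c`! * (c.+1 * c`!)))%N; first by ring.
  by rewrite h; ring.
have := acoef_rec c; rewrite !bE => ra.
transitivity ((c.+1 * 'C(2 * c.+1, c.+1)) * (c.+1 ^ 2 * acoef c.+1))%N; first by ring.
by rewrite rec2 ra; ring.
Qed.

(** * Their divisibility by [p] *)

Section Valuations.
Variable p : nat.
Hypotheses (p_prime : prime p) (p_gt3 : (3 < p)%N).

Lemma logn_fact_small m : (m < p ^ 2)%N -> logn p m`! = (m %/ p)%N.
Proof.
case: m => [|m] mp; first by rewrite logn1 div0n.
rewrite logn_fact // big_ltn // expn1 big1_seq ?addn0 // => i /andP[_].
rewrite mem_index_iota => /andP[i2 _]; rewrite divn_small //.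
by rewrite (leq_trans mp) // leq_pexp2l // prime_gt0.
Qed.

Let q c := ((6 * c) %/ p)%N.

Let small j c : (c < p)%N -> (j <= 6)%N -> (j * c < p ^ 2)%N.
Proof.
have p5 : (4 < p)%N by move: p_prime p_gt3; case: (p) => [|[|[|[|[|]]]]].
by move=> cp j6; apply: (leq_ltn_trans (leq_mul j6 (leqnn c))); move: p5 cp; clear; nia.
Qed.

Let p_pos : (0 < p)%N. Proof. exact: prime_gt0. Qed.

Let q_half c : ((3 * c) %/ p = q c %/ 2)%N.
Proof. by rewrite /q -divnMA -[(6 * c)%N]/((3 * 2) * c)%N -mulnAC divnMr. Qed.

Let q_third c : ((2 * c) %/ p = q c %/ 3)%N.
Proof. by rewrite /q -divnMA -[(6 * c)%N]/((2 * 3) * c)%N -mulnAC divnMr. Qed.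

Let q_lt6 c : (c < p)%N -> (q c < 6)%N.
Proof. by move=> cp; rewrite /q ltn_divLR // ltn_pmul2l. Qed.

Let logn_fact_mul j c : (c < p)%N -> (j <= 6)%N -> logn p (j * c)`! = (j * c %/ p)%N.
Proof. by move=> cp j6; rewrite logn_fact_small // small. Qed.

Let logn_fact_lt c : (c < p)%N -> logn p c`! = 0%N.
Proof.
by move=> cp; rewrite -[in LHS](mul1n c) logn_fact_mul // mul1n divn_small.
Qed.

Lemma logn_acoef c : (c < p)%N -> (logn p (acoef c) + q c %/ 2 + q c %/ 3 = q c)%N.
Proof.
move=> cp; have : (0 < acoef c)%N by rewrite muln_gt0 !bin_gt0; lia.
move: (acoef c) (acoef_fact c) => A /(congr1 (logn p)) + A0.
rewrite !lognM ?muln_gt0 ?fact_gt0 // (logn_fact_lt cp) !logn_fact_mul //.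
by rewrite q_half q_third -/(q c); lia.
Qed.

Lemma logn_bcoef c : (c < p)%N -> (logn p (bcoef c) + q c %/ 2 = q c)%N.
Proof.
move=> cp; have : (0 < bcoef c)%N by rewrite !muln_gt0 !bin_gt0; lia.
move: (bcoef c) (bcoef_fact c) => B /(congr1 (logn p)) + B0.
rewrite !lognM ?muln_gt0 ?fact_gt0 // (logn_fact_lt cp) !logn_fact_mul //.
by rewrite q_half -/(q c); lia.
Qed.

Let a_pos c : (0 < acoef c)%N. Proof. by rewrite muln_gt0 !bin_gt0; lia. Qed.
Let b_pos c : (0 < bcoef c)%N. Proof. by rewrite !muln_gt0 !bin_gt0; lia. Qed.

Lemma dvdn_acoef c : (c < p)%N -> (p <= 6 * c)%N -> (p %| acoef c)%N.
Proof.
move=> cp pc; rewrite -[X in (X %| _)%N]expn1 pfactor_dvdn //.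
have := logn_acoef cp; have : (0 < q c)%N by rewrite /q divn_gt0.
by move: (q_lt6 cp); case: (q c) => [|[|[|[|[|[|]]]]]] //; lia.
Qed.

(** The valuation of [acoef c] is [q - q / 2 - q / 3] for the quotient [q] of
    [6 c] by [p]: it is 1 for [q] between 1 and 4, and 2 for [q = 5]. As the two
    quotients add up to 5 at least, one of them is 5 or both are positive. *)
Lemma dvdn_acoef2 i j : (i < p)%N -> (j < p)%N -> (p <= i + j)%N ->
  (p ^ 2 %| acoef i * acoef j)%N.
Proof.
move=> ip jp pij; have aij : (0 < acoef i * acoef j)%N by rewrite muln_gt0 !a_pos.
rewrite (pfactor_dvdn _ p_prime aij) (lognM _ (a_pos i) (a_pos j)).
have : (5 <= q i + q j)%N.
  have qi := divn_eq (6 * i) p; have qj := divn_eq (6 * j) p.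
  have ri := ltn_pmod (6 * i) p_pos; have rj := ltn_pmod (6 * j) p_pos.
  by rewrite -/(q i) -/(q j) in qi qj; nia.
have := logn_acoef ip; have := logn_acoef jp; move: (q_lt6 ip) (q_lt6 jp).
by case: (q i) => [|[|[|[|[|[|]]]]]] //; case: (q j) => [|[|[|[|[|[|]]]]]] //; lia.
Qed.

Lemma dvdn_bcoef c : (c < p)%N -> (p <= 2 * c)%N -> (p ^ 2 %| bcoef c)%N.
Proof.
move=> cp pc; rewrite pfactor_dvdn //.
have : (3 <= q c)%N by rewrite /q leq_divRL //; lia.
have := logn_bcoef cp; move: (q_lt6 cp).
by case: (q c) => [|[|[|[|[|[|]]]]]] //; lia.
Qed.

End Valuations.

(** * A truncated Clausen identity *)

Section Clausen.
Variable M : nat.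
Implicit Types P Q : {poly int}.

Definition van (m : nat) P := forall i, (i < m)%N -> P`_i = 0.
Definition theta P : {poly int} := 'X * P^`().

Lemma vanD m P Q : van m P -> van m Q -> van m (P + Q).
Proof. by move=> hP hQ i im; rewrite coefD hP ?hQ. Qed.

Lemma vanN m P : van m P -> van m (- P).
Proof. by move=> hP i im; rewrite coefN hP ?oppr0. Qed.

Lemma vanM m P Q : van m P -> van m (Q * P).
Proof.
move=> hP i im; rewrite coefM big1 // => j _; rewrite hP ?mulr0 //.
by rewrite (leq_ltn_trans (leq_subr _ _)).
Qed.

Lemma coef_theta P i : (theta P)`_i = P`_i *+ i.
Proof. by rewrite /theta coefXM; case: i => [|i]; rewrite ?mulr0n // coef_deriv. Qed.

Lemma van_theta m P : van m P -> van m (theta P).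
Proof. by move=> hP i im; rewrite coef_theta hP ?mul0rn. Qed.

Lemma thetaD P Q : theta (P + Q) = theta P + theta Q.
Proof. by rewrite /theta derivD mulrDr. Qed.

Lemma thetaB P Q : theta (P - Q) = theta P - theta Q.
Proof. by rewrite /theta derivB mulrBr. Qed.

Lemma thetaM P Q : theta (P * Q) = theta P * Q + P * theta Q.
Proof. by rewrite /theta derivM; ring. Qed.

Lemma thetaX : theta 'X = 'X.
Proof. by rewrite /theta derivX mulr1. Qed.

Lemma theta_nat n : theta n%:R = 0.
Proof. by rewrite /theta -polyC_natr derivC mulr0. Qed.

Lemma coef_natM n P i : (n%:R * P)`_i = n%:R * P`_i.
Proof. by rewrite -polyC_natr coefCM. Qed.

Lemma vanX m P : van m P -> van m.+1 ('X * P).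
Proof. by move=> hP [|i] im; rewrite coefXM //= hP. Qed.

Local Notation u := (1 - 432%:R * 'X : {poly int}).

(** The third-order operator that annihilates the squares of the solutions of
    [u (theta^2 Y) = 432 X theta Y + 60 X Y]. *)
Definition op3 P := theta (u * (u * theta (theta P) - 432%:R * 'X * theta P - 120%:R * 'X * P))
  - 120%:R * 'X * u * theta P.

Lemma theta_u : theta u = - (432%:R * 'X).
Proof. by rewrite thetaB thetaM thetaX theta_nat /theta derivC; ring. Qed.

(** At a singular point with exponents 0, 0, 0 a power series solution is
    determined by its constant term. *)
Lemma op3_inj P : P`_0 = 0 -> van M (op3 P) -> van M P.
Proof.
move=> P0 hP; suff H m : (m <= M)%N -> van m P by exact: H.
elim: m => [|m IH] mM; first by move=> i; rewrite ltn0.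
have vP := IH (ltnW mM).
move=> i; rewrite ltnS leq_eqVlt => /predU1P[->|]; last exact: vP.
have [->//|m0] := eqVneq m 0%N.
pose R1 := (432%:R ^+ 2 * 'X - 864%:R) * theta (theta P) - 432%:R * u * theta P - 120%:R * u * P.
have e : op3 P = theta (theta (theta P)) + 'X * (R1 + theta R1 - 120%:R * u * theta P).
  have -> : op3 P = theta (theta (theta P) + 'X * R1) - 120%:R * 'X * u * theta P.
    by rewrite /op3; congr (theta _ - _); rewrite /R1; ring.
  by rewrite thetaD [theta ('X * R1)]thetaM thetaX; ring.
have vR : van m.+1 ('X * (R1 + theta R1 - 120%:R * u * theta P)).
  have v1 : van m R1.
    apply: vanD; last by apply/vanN/vanM.
    by apply: vanD; [apply/vanM/van_theta/van_theta | apply/vanN/vanM/van_theta].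
  by apply/vanX/vanD; [apply: vanD => //; exact: van_theta | apply/vanN/vanM/van_theta].
have := hP m mM; rewrite e coefD vR // addr0 !coef_theta.
by move/eqP; rewrite !mulrn_eq0 (negPf m0) /= => /eqP.
Qed.

Definition aser : {poly int} := \poly_(c < M) (acoef c)%:Z.

Local Notation Y := aser.

Lemma acoef_rec_int (i A A' : nat) :
  (i.+1 ^ 2 * A' = 12 * (6 * i + 1) * (6 * i + 5) * A)%N ->
  A'%:Z *+ i.+1 *+ i.+1 -
    (432%:R * (A%:Z *+ i *+ i) + 432%:R * (A%:Z *+ i) + 60%:R * A%:Z) = 0.
Proof.
move=> /(congr1 (fun n : nat => n%:R : int)) e.
transitivity ((i.+1 ^ 2 * A')%:R - (12 * (6 * i + 1) * (6 * i + 5) * A)%:R : int).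
  by rewrite -[A'%:Z]natz -[A%:Z]natz; ring.
by rewrite e subrr.
Qed.

Lemma aser_ode : van M (u * theta (theta Y) - 432%:R * 'X * theta Y - 60%:R * 'X * Y).
Proof.
move=> i iM.
have -> : u * theta (theta Y) - 432%:R * 'X * theta Y - 60%:R * 'X * Y =
  theta (theta Y) - 'X * (432%:R * theta (theta Y) + 432%:R * theta Y + 60%:R * Y) by ring.
rewrite coefB !coef_theta coef_poly iM coefXM.
case: i iM => [|i] iM; first by rewrite !mulr0n subr0.
rewrite [_.-1]/= !coefD !coef_natM !coef_theta !coef_poly (ltnW iM).
exact: acoef_rec_int (acoef_rec i).
Qed.

Lemma op3_square : van M (op3 (Y ^+ 2)).
Proof.
set D := u * theta (theta Y) - 432%:R * 'X * theta Y - 60%:R * 'X * Y.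
have vD : van M D := aser_ode.
have sq P : theta (P ^+ 2) = 2%:R * P * theta P by rewrite expr2 thetaM; ring.
have -> : op3 (Y ^+ 2) = 4%:R * u * theta Y * D + theta (2%:R * u * Y * D).
  have -> : op3 (Y ^+ 2) = theta (2%:R * u ^+ 2 * theta Y ^+ 2 + 2%:R * u * Y * D)
      - 240%:R * 'X * u * Y * theta Y.
    have t2 : theta (2%:R * Y * theta Y) = 2%:R * theta Y ^+ 2 + 2%:R * Y * theta (theta Y).
      by rewrite !thetaM theta_nat; ring.
    by rewrite /op3 sq t2; congr (theta _ - _); rewrite /D; ring.
  have t3 : theta (2%:R * u ^+ 2 * theta Y ^+ 2) = - (4%:R * 432%:R * 'X * u * theta Y ^+ 2)
      + 4%:R * u ^+ 2 * theta Y * theta (theta Y).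
    by rewrite thetaM sq thetaM sq theta_nat theta_u; ring.
  by rewrite thetaD t3 /D; ring.
by apply: vanD; [apply: vanM | apply/van_theta/vanM].
Qed.


Local Notation v := (1 - 864%:R * 'X : {poly int}).
Local Notation z := ('X * u : {poly int}).

(** With [z = X u], the truncated third-order series is [bser 0]; the weight
    [c^r] accounts for [r] applications of the derivation [z d/dz]. *)
Definition bser (r : nat) : {poly int} := \sum_(c < M) (c ^ r * bcoef c)%:R * z ^+ c.

Lemma theta_zX c : u * theta (z ^+ c) = c%:R * z ^+ c * v.
Proof.
elim: c => [|c IH]; first by rewrite expr0 (theta_nat 1); ring.
have tz : theta z = 'X * v by rewrite thetaM thetaX theta_u; ring.
rewrite exprSr thetaM tz mulrDr mulrA IH -[c.+1]addn1 natrD; ring.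
Qed.

Lemma theta_bser r : u * theta (bser r) = v * bser r.+1.
Proof.
rewrite /bser /theta raddf_sum !mulr_sumr /=; apply: eq_bigr => c _.
have -> : 'X * ((c ^ r * bcoef c)%:R * z ^+ c)^`() = (c ^ r * bcoef c)%:R * theta (z ^+ c).
  by rewrite -[LHS]/(theta _) thetaM theta_nat; ring.
by rewrite mulrCA theta_zX expnS -mulnA natrM; ring.
Qed.

Lemma bser_ode : van M (bser 3 - 24%:R * z *
  (72%:R * bser 3 + 108%:R * bser 2 + 46%:R * bser 1 + 5%:R * bser 0)).
Proof.
pose F c : {poly int} := (c ^ 3 * bcoef c)%:R * z ^+ c.
have -> : 24%:R * z * (72%:R * bser 3 + 108%:R * bser 2 + 46%:R * bser 1 + 5%:R * bser 0)
    = \sum_(c < M) F c.+1.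
  rewrite /bser !mulr_sumr -!big_split mulr_sumr /=; apply: eq_bigr => c _.
  rewrite /F bcoef_rec exprS.
  have -> : (24 * (2 * c + 1) * (6 * c + 1) * (6 * c + 5) * bcoef c =
    24 * (72 * (c ^ 3 * bcoef c) + 108 * (c ^ 2 * bcoef c) + 46 * (c ^ 1 * bcoef c)
     + 5 * (c ^ 0 * bcoef c)))%N by ring.
  move: (c ^ 3 * _)%N (c ^ 2 * _)%N (c ^ 1 * _)%N (c ^ 0 * _)%N => a3 a2 a1 a0.
  by rewrite !(natrM, natrD); ring.
have e : \sum_(c < M) F c.+1 = bser 3 + F M.
  have F0 : F 0%N = 0 by rewrite /F exp0n // mul0n mul0r.
  have : \sum_(c < M.+1) F c = F 0%N + \sum_(c < M) F c.+1 by rewrite big_ord_recl.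
  by rewrite F0 add0r big_ord_recr => <-.
rewrite e opprD addrA subrr add0r; apply/vanN.
rewrite /F exprMn mulrCA => i iM.
by rewrite coefXnM iM.
Qed.

Lemma van_cancel m P : van m (u * P) -> van m P.
Proof.
move=> h i; elim/ltn_ind: i => i IH im; have := h i im.
rewrite mulrBl mul1r coefB -mulrA coef_natM coefXM.
case: i IH im => [|i] IH im /=; first by rewrite mulr0 subr0.
by rewrite (IH i) ?mulr0 ?subr0 // ltnW.
Qed.

Lemma op3_bser : van M (op3 (bser 0)).
Proof.
apply: van_cancel.
have tv : theta v = - (864%:R * 'X) by rewrite thetaB thetaM thetaX !theta_nat (theta_nat 1); ring.
move: (theta_bser 0) (theta_bser 1) (theta_bser 2) bser_ode.
move: (bser 0) (bser 1) (bser 2) (bser 3) => g0 g1 g2 g3 e0 e1 e2 ode.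
have eQ : u * (u * theta (theta g0) - 432%:R * 'X * theta g0 - 120%:R * 'X * g0) =
    v ^+ 2 * g2 - 864%:R * 'X * u * g1 - 120%:R * 'X * u * g0.
  have : theta (u * theta g0) = theta (v * g1) by rewrite e0.
  rewrite [LHS]thetaM [RHS]thetaM theta_u tv => h.
  have -> : u * theta (theta g0) = - (432%:R * 'X) * theta g0 + u * theta (theta g0)
    + 432%:R * 'X * theta g0 by ring.
  by rewrite h; transitivity (v * (u * theta g1) - 864%:R * 'X * u * g1 - 120%:R * 'X * u * g0);
    [ring | rewrite e1; ring].
have -> : u * op3 g0 = v * (g3 - 24%:R * z *
    (72%:R * g3 + 108%:R * g2 + 46%:R * g1 + 5%:R * g0)).
  have tv2 : theta (v ^+ 2) = - (2%:R * v * 864%:R * 'X) by rewrite expr2 thetaM tv; ring.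
  have tXu : theta ('X * u) = 'X * v by rewrite thetaM thetaX theta_u; ring.
  rewrite /op3 eQ !thetaB -[864%:R * 'X * u]mulrA -[120%:R * 'X * u]mulrA.
  rewrite [theta (v ^+ 2 * g2)]thetaM tv2 [theta (_ * g1)]thetaM [theta (_ * g0)]thetaM.
  rewrite ![theta (_ * ('X * u))]thetaM !theta_nat tXu.
  transitivity (- (2%:R * v * 864%:R * 'X) * u * g2 + v ^+ 2 * (u * theta g2)
    - (864%:R * 'X * v * u * g1 + 864%:R * 'X * u * (u * theta g1))
    - (120%:R * 'X * v * u * g0 + 120%:R * 'X * u * (u * theta g0))
    - 120%:R * 'X * u * (u * theta g0)); first by ring.
  by rewrite e0 e1 e2; ring.
exact: vanM.
Qed.

(** Up to scaling of the variable, [acoef] and [bcoef] are the coefficients of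
    [2F1(1/6, 5/6; 1)] and [3F2(1/6, 1/2, 5/6; 1, 1)]. Clausen's identity holds
    because both sides satisfy the third-order equation and have constant term 1. *)
Lemma clausen_truncated : van M (aser ^+ 2 - bser 0).
Proof.
have op3B P Q : op3 (P - Q) = op3 P - op3 Q.
  rewrite /op3 !(thetaB P Q) !(thetaB (theta P) (theta Q)).
  rewrite (_ : u * (u * (_ - _) - _ - _) =
    u * (u * theta (theta P) - 432%:R * 'X * theta P - 120%:R * 'X * P) -
    u * (u * theta (theta Q) - 432%:R * 'X * theta Q - 120%:R * 'X * Q)); last by ring.
  by rewrite thetaB; ring.
have [M0|M0] := posnP M; first by move=> i; rewrite M0.
apply: op3_inj; last by rewrite op3B; apply/vanD/vanN/op3_bser/op3_square.
rewrite coefB expr2 coef0M coef_poly M0 -!horner_coef0 /bser horner_sum.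
rewrite (bigD1 (Ordinal M0)) //= big1 => [|c c0].
  by rewrite addr0 expr0 mulr1 -polyC_natr hornerC.
rewrite hornerM horner_exp hornerM hornerX mul0r expr0n.
by rewrite -val_eqE /= in c0; rewrite (negPf c0) mulr0.
Qed.

End Clausen.

(** * The sum modulo [p^2] is a norm-like expression *)

Section Supercongruence.
Variable p : nat.
Hypotheses (p_prime : prime p) (p_gt3 : (3 < p)%N).
Local Notation p2 := ((p ^ 2)%N%:Z).
Local Notation u := (1 - 432%:R * 'X : {poly int}).

Lemma coef_zX (c m : nat) : (2 * c < m)%N -> (('X * u) ^+ c)`_m = 0.
Proof.
move=> cm; rewrite nth_default //; apply: leq_trans cm.
elim: c => [|c IH]; first by rewrite expr0 size_poly1.
have sz : (size ('X * u)%R <= 3)%N.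
  rewrite (leq_trans (size_polyMleq _ _)) // size_polyX /= ltnS.
  rewrite (leq_trans (size_polyD _ _)) // geq_max size_poly1 size_polyN /=.
  by rewrite -polyC_natr mul_polyC (leq_trans (size_scale_leq _ _)) // size_polyX.
rewrite exprS (leq_trans (size_polyMleq _ _)) //.
by move: sz IH; move: (size _) (size _) => a b; lia.
Qed.

(** The truncation at [p] of the Clausen identity holds modulo [p^2]: each of
    the terms of degree at least [p] is divisible by [p^2]. *)
Lemma clausen_mod : exists K, bser p 0 - aser p ^+ 2 = p2 *: K.
Proof.
apply/polyOver_dvdzP/polyOverP => m.
have [mp|pm] := ltnP m p.
  have /eqP := clausen_truncated mp; rewrite coefB subr_eq0 => /eqP e.
  by rewrite coefB e subrr dvdz0.
rewrite coefB; apply: rpredB.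
  rewrite /bser coef_sum; apply: rpred_sum => c _.
  rewrite coef_natM natz; have [cm|mc] := ltnP (2 * c) m.
    by rewrite coef_zX // mulr0 dvdz0.
  apply: dvdz_mulr; rewrite dvdzE /= expn0 mul1n.
  by apply: dvdn_bcoef => //; exact: leq_trans mc.
rewrite expr2 coefM; apply: rpred_sum => j _; rewrite !coef_poly.
case: ifP => jp; last by rewrite mul0r dvdz0.
case: ifP => mjp; last by rewrite mulr0 dvdz0.
rewrite -PoszM dvdzE /=; apply: dvdn_acoef2 => //.
by rewrite subnKC // -ltnS ltn_ord.
Qed.

(** Congruence modulo [p^2] in the ring of [sqrt 114], which ['X] stands for. *)
Definition eqm (P Q : {poly int}) :=
  exists U V : {poly int}, P - Q = p2 *: U + ('X^2 - 114%:R) * V.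

Lemma eqm_refl P : eqm P P.
Proof. by exists 0, 0; rewrite subrr scaler0 mulr0 addr0. Qed.

Lemma eqm_sym P Q : eqm P Q -> eqm Q P.
Proof. by case=> U [V e]; exists (- U), (- V); rewrite -opprB e scalerN mulrN opprD. Qed.

Lemma eqm_trans P Q R : eqm P Q -> eqm Q R -> eqm P R.
Proof.
case=> U [V e] [U' [V' e']]; exists (U + U'), (V + V').
by rewrite -[P](subrK Q) -addrA e e' scalerDr mulrDr addrACA.
Qed.

Lemma eqmD P Q P' Q' : eqm P Q -> eqm P' Q' -> eqm (P + P') (Q + Q').
Proof.
case=> U [V e] [U' [V' e']]; exists (U + U'), (V + V').
by rewrite opprD addrACA e e' scalerDr mulrDr addrACA.
Qed.

Lemma eqmM P Q P' Q' : eqm P Q -> eqm P' Q' -> eqm (P * P') (Q * Q').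
Proof.
case=> U [V e] [U' [V' e']]; exists (U * P' + Q * U'), (V * P' + Q * V').
have -> : P * P' - Q * Q' = (P - Q) * P' + Q * (P' - Q') by ring.
by rewrite e e' -!mul_polyC; ring.
Qed.

Lemma eqmX P Q c : eqm P Q -> eqm (P ^+ c) (Q ^+ c).
Proof.
move=> e; elim: c => [|c IH]; first by rewrite !expr0; exact: eqm_refl.
by rewrite !exprS; apply: eqmM.
Qed.

Lemma eqm_sum m (F G : 'I_m -> {poly int}) : (forall i, eqm (F i) (G i)) ->
  eqm (\sum_i F i) (\sum_i G i).
Proof.
move=> h; apply: (big_ind2 eqm); first exact: eqm_refl.
  by move=> *; apply: eqmD.
by move=> i _; exact: h.
Qed.

Lemma quadratic_remainder (P : {poly int}) :
  exists V s t, P = ('X^2 - 114%:R) * V + s%:P + t%:P * 'X.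
Proof.
elim/poly_ind: P => [|P c [V [s [t ->]]]].
  by exists 0, 0, 0; rewrite mulr0 mul0r !addr0.
exists (V * 'X + t%:P), (c + 114%:R * t), s.
by rewrite polyCD polyCM polyC_natr; ring.
Qed.

Lemma quadratic_remainder0 (V : {poly int}) s t :
  ('X^2 - 114%:R) * V = s%:P + t%:P * 'X -> s = 0 /\ t = 0.
Proof.
move=> e; have V0 : V = 0.
  apply/eqP; apply: contraT => V0.
  have sq : size ('X^2 - 114%:R : {poly int}) = 3%N.
    by rewrite size_polyDl size_polyXn // size_polyN -polyC_natr ltnS (leq_trans (size_polyC_leq1 _)).
  have q0 : 'X^2 - 114%:R != 0 :> {poly int} by rewrite -size_poly_eq0 sq.
  have := congr1 (fun P : {poly int} => size P) e; rewrite size_mul // sq => es.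
  have : (size (s%:P + t%:P * 'X)%R <= 2)%N.
    rewrite (leq_trans (size_polyD _ _)) // geq_max (leq_trans (size_polyC_leq1 _)) //.
    by rewrite mul_polyC (leq_trans (size_scale_leq _ _)) // size_polyX.
  by rewrite -es; move: V0; rewrite -size_poly_gt0; case: (size V).
have := e; rewrite V0 mulr0 => /esym e0.
split.
  by have := congr1 (fun P : {poly int} => P`_0) e0; rewrite coefD coefC coefCM coefX mulr0 addr0 coef0.
by have := congr1 (fun P : {poly int} => P`_1) e0; rewrite coefD coefC coefCM coefX mulr1 add0r coef0.
Qed.

Variables d e : int.
Hypothesis d_inv : d * (1024%:R * 27%:R) = 1 + p2 * e.

(** A solution [X] of [X (1 - 432 X) = z] for the argument [z = (-96)^(-3)] of the
    sum, which is [- 864 d^2] for an inverse [d] of [1024 * 27]: the discriminant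
    of the quadratic equation is 114 up to squares. *)
Definition xarg : {poly int} := d%:P * (32%:R - 3%:R * 'X).

Lemma xarg_image : eqm (xarg * (1 - 432%:R * xarg)) (- 864%:R * d ^+ 2)%:P.
Proof.
exists (- (e%:P * xarg)), (- 3888%:R * d ^+ 2)%:P.
have e1 : d%:P * (1024%:R * 27%:R) = 1 + p2%:P * e%:P :> {poly int}.
  by rewrite -!polyC_natr -!polyCM d_inv polyCD.
have e2 : 1 = d%:P * (1024%:R * 27%:R) - p2%:P * e%:P :> {poly int} by rewrite e1; ring.
rewrite {1}e2 /xarg -mul_polyC.
have -> : (- 864%:R * d ^+ 2)%:P = - 864%:R * d%:P ^+ 2 :> {poly int} by ring.
have -> : (- 3888%:R * d ^+ 2)%:P = - 3888%:R * d%:P ^+ 2 :> {poly int} by ring.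
by ring.
Qed.

Definition binsum_int : int := \sum_(c < p) (bcoef c)%:Z * (- 864%:R * d ^+ 2) ^+ c.

(** The second-order series has the value [s + t sqrt 114] at one of the two
    conjugate arguments. The sum is the square of this value, and being rational
    it has no component along [sqrt 114], whence the second equation. *)
Lemma binsum_int_square : exists s t m1 m2 : int,
  [/\ binsum_int = s ^+ 2 + 114%:R * t ^+ 2 + p2 * m1, 2%:R * s * t = p2 * m2
  & forall (k : comNzRingType) (w : k), w ^+ 2 = 114%:R ->
    \sum_(c < p) (acoef c)%:R * (d%:~R * (32%:R - 3%:R * w)) ^+ c = s%:~R + t%:~R * w].
Proof.
have [V [s [t eA]]] := quadratic_remainder (aser p \Po xarg).
have [K eK] := clausen_mod.
have c1 : eqm (bser p 0 \Po xarg) binsum_int%:P.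
  rewrite /bser /binsum_int raddf_sum /= rmorph_sum /=.
  apply: eqm_sum => c; rewrite comp_polyM rmorphM /= expn0 mul1n.
  apply: eqmM.
    by rewrite -polyC_natr comp_polyC natz; exact: eqm_refl.
  rewrite rmorphXn /= rmorphXn /=; apply: eqmX.
  rewrite comp_polyM comp_polyX comp_polyB comp_polyM comp_polyX.
  rewrite -(polyC_natr _ 432) -(polyC1 _) !comp_polyC polyC_natr polyC1.
  exact: xarg_image.
have c2 : eqm (bser p 0 \Po xarg) ((s%:P + t%:P * 'X) ^+ 2).
  apply: (@eqm_trans _ ((aser p \Po xarg) ^+ 2)).
    exists (K \Po xarg), 0; rewrite mulr0 addr0 -comp_polyZ -eK.
    by rewrite comp_polyB rmorphXn.
  apply: eqmX; rewrite eA; exists 0, V; rewrite scaler0 add0r; ring.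
have [U [W eT]] := eqm_trans (eqm_sym c1) c2.
have [U' [m1 [m2 eU]]] := quadratic_remainder U.
have key : ('X^2 - 114%:R) * (W + p2 *: U' + (t ^+ 2)%:P) =
    (binsum_int - s ^+ 2 - 114%:R * t ^+ 2 - p2 * m1)%:P + (- (2%:R * s * t) - p2 * m2)%:P * 'X.
  have -> : ('X^2 - 114%:R) * (W + p2 *: U' + (t ^+ 2)%:P) =
    (p2 *: U + ('X^2 - 114%:R) * W) - p2%:P * (m1%:P + m2%:P * 'X)
      + ('X^2 - 114%:R) * (t%:P ^+ 2) by rewrite eU -!mul_polyC; ring.
  by rewrite -eT; ring.
have [k1 k2] := quadratic_remainder0 key.
exists s, t, m1, (- m2); split.
- by rewrite -[LHS]subr0 -k1; ring.
- by apply/eqP; rewrite -subr_eq0 -oppr_eq0 -k2; apply/eqP; ring.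
move=> k w hw; pose ev (P : {poly int}) : k := (map_poly intr P).[w].
have evq : (map_poly (intr : int -> k) ('X^2 - 114%:R)).[w] = 0.
  by rewrite rmorphB /= map_polyXn rmorph_nat hornerD hornerXn hornerN -polyC_natr hornerC hw subrr.
have := congr1 ev eA; rewrite /ev 2!rmorphD 2!rmorphM /= !hornerD hornerM evq mul0r add0r.
rewrite hornerM !map_polyC map_polyX !hornerC hornerX => <-.
rewrite map_comp_poly horner_comp.
have -> : (map_poly intr xarg).[w] = d%:~R * (32%:R - 3%:R * w) :> k.
  rewrite /xarg rmorphM rmorphB rmorphM /= !rmorph_nat map_polyC map_polyX /=.
  by rewrite -!polyC_natr !hornerE.
rewrite (@horner_coef_wide _ p); last first.
  by rewrite (leq_trans (size_poly _ _)) // /aser; apply: (leq_trans (size_poly _ _)).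
apply: eq_bigr => c _; rewrite coef_map /= coef_poly ltn_ord.
by rewrite -pmulrn.
Qed.

End Supercongruence.

(** * The Hasse invariant as a truncated hypergeometric series *)

Lemma coef_XaddC_exp (R : comNzRingType) (c : R) m j :
  (('X + c%:P) ^+ m)`_j = c ^+ (m - j) *+ 'C(m, j).
Proof.
rewrite addrC exprDn coef_sum.
have [mj|jm] := ltnP m j.
  rewrite big1 ?bin_small ?mulr0n // => i _.
  rewrite -polyC_exp coefMn coefCM coefXn (gtn_eqF (leq_trans (ltn_ord i) mj)).
  by rewrite mulr0 mul0rn.
rewrite (bigD1 (inord j)) //= inordK ?ltnS // -polyC_exp coefMn coefCM coefXn eqxx mulr1.
rewrite big1 ?addr0 // => i; rewrite -val_eqE /= inordK ?ltnS // => ij.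
by rewrite -polyC_exp coefMn coefCM coefXn eq_sym (negPf ij) mulr0 mul0rn.
Qed.

Lemma prime_ndvd_fact p m : prime p -> (m < p)%N -> ~~ (p %| m`!)%N.
Proof.
move=> pp; elim: m => [|m IH] mp; first by rewrite dvdn1 gtn_eqF // prime_gt1.
by rewrite factS Euclid_dvdM // negb_or gtnNdvd //= IH // ltnW.
Qed.

Section HasseSeries.
Variables (k : closedFieldType) (p : nat).
Hypotheses (charp : p \in [pchar k]) (p_gt3 : (3 < p)%N).
Local Notation n := p./2.

Let p_prime : prime p := pcharf_prime charp.
Let p_neq2 : p != 2%N. Proof. by rewrite gtn_eqF // (ltn_trans _ p_gt3). Qed.
Let p2n : (n * 2).+1 = p := half_p charp p_neq2.
Let p_pos : (0 < p)%N := prime_gt0 p_prime.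

(** Translations do not change the coefficient of [X^(p-1)], because the
    binomial coefficients [C(i, p-1)] vanish modulo [p] for [p <= i < 2p - 1]. *)
Lemma coef_pred_shift (g : {poly k}) e : (size g <= (p.-1).*2.+1)%N ->
  (g \Po ('X - e%:P))`_(p.-1) = g`_(p.-1).
Proof.
move=> sg; rewrite -{1}[g]coefK poly_def raddf_sum coef_sum /=.
have term i : (g`_i *: 'X^i \Po ('X - e%:P))`_(p.-1) =
    g`_i * ((- e) ^+ (i - p.-1) *+ 'C(i, p.-1)).
  by rewrite comp_polyZ comp_Xn_poly coefZ -polyCN coef_XaddC_exp.
have [lt|ge] := ltnP p.-1 (size g); last first.
  rewrite nth_default // big1 // => i _; rewrite term bin_small ?mulr0n ?mulr0 //.
  exact: leq_trans (ltn_ord i) ge.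
rewrite (bigD1 (Ordinal lt)) //= term subnn expr0 binn mulr1n mulr1.
rewrite big1 ?addr0 // => i; rewrite -val_eqE /= => ip; rewrite term.
have [ilt|ige] := ltnP i p.-1; first by rewrite bin_small ?mulr0n ?mulr0.
have pi : (p <= i)%N.
  have : (p.-1 < i)%N by rewrite ltn_neqAle eq_sym ip.
  by rewrite prednK.
have ub : (i - p.-1 < p)%N.
  have := leq_trans (ltn_ord i) sg; rewrite -addnn; move: p_pos; clear; lia.
suff : (p %| 'C(i, p.-1))%N by rewrite (dvdn_pcharf charp) -[(- e) ^+ _ *+ _]mulr_natr => /eqP ->; rewrite !mulr0.
have := bin_fact (leq_trans (leq_pred p) pi) => e1.
have : (p %| i`!)%N by rewrite dvdn_fact // p_pos.
rewrite -e1 Euclid_dvdM // => /orP[//|]; rewrite Euclid_dvdM //.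
have nf m : (m < p)%N -> (p %| m`!)%N = false by move=> mp; apply/negbTE/prime_ndvd_fact.
by rewrite !nf // prednK.
Qed.

(** The coefficients of the series are, modulo [p], trinomial coefficients of
    [n = (p - 1)/2], which plays the role of [-1/2]. *)
Lemma acoef_trinomial c : (c < p)%N ->
  ((acoef c)%:R : k) = (- 64%:R) ^+ c * ('C(n, c) * 'C(n - c, 2 * c))%:R.
Proof.
move=> cp; have [cn|nc] := leqP c n; last first.
  rewrite bin_small // mul0n mulr0; apply/eqP; rewrite -(dvdn_pcharf charp).
  by apply: dvdn_acoef => //; move: p2n nc; clear; lia.
have nf m : (m < p)%N -> (m`!%:R : k) != 0.
  by move=> mp; rewrite -(dvdn_pcharf charp) prime_ndvd_fact.
have c2 : (2 * c < p)%N by move: p2n cn; clear; lia.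
apply: (mulIf (nf _ cp)); apply: (mulIf (nf _ c2)).
have n2 : 2%:R * (n%:R : k) = -1.
  apply/eqP; rewrite -addr_eq0 -natrM -(natrD _ _ 1) -(dvdn_pcharf charp).
  by rewrite mulnC addn1 p2n.
have double_fact m : ((2 * m)`! = m`! * \prod_(i < m) (4 * i + 2))%N.
  elim: m => [|m IH]; first by rewrite big_ord0.
  by rewrite mulnS !addSn add0n !factS IH big_ord_recr /=; ring.
have ffact_prod m : (((n ^_ m)%N)%:R : k) = \prod_(i < m) (n%:R - i%:R).
  elim: m => [|m IH]; first by rewrite big_ord0 ffactn0.
  rewrite ffactnSr natrM IH big_ord_recr /=.
  have [le|gt] := leqP m n; first by rewrite natrB.
  rewrite (bigD1 (Ordinal gt)) //= subrr !mul0r.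
  by [].
have lhs : (acoef c * c`! * (2 * c)`! = \prod_(i < 3 * c) (4 * i + 2))%N.
  have f3 : (0 < (3 * c)`!)%N by rewrite fact_gt0.
  apply/eqP; rewrite -(eqn_pmul2l f3) -double_fact.
  have -> : (2 * (3 * c) = 6 * c)%N by lia.
  by rewrite -acoef_fact; apply/eqP; ring.
rewrite -!natrM lhs.
have rhs : ('C(n, c) * 'C(n - c, 2 * c) * c`! * (2 * c)`! = n ^_ (3 * c))%N.
  have -> : (3 * c = c + 2 * c)%N by lia.
  have ffactD d : (n ^_ (c + d) = n ^_ c * (n - c) ^_ d)%N.
    elim: d => [|d IH]; first by rewrite addn0 ffactn0 muln1.
    by rewrite addnS !ffactnSr IH subnDA mulnA.
  by rewrite ffactD -!bin_ffact; ring.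
have -> : (- 64%:R) ^+ c * ('C(n, c) * 'C(n - c, 2 * c))%:R * c`!%:R * (2 * c)`!%:R =
   (- 64%:R) ^+ c * ('C(n, c) * 'C(n - c, 2 * c) * c`! * (2 * c)`!)%:R :> k.
  by rewrite !natrM; ring.
rewrite rhs ffact_prod.
have -> : - 64%:R = (- 4%:R) ^+ 3 :> k by ring.
rewrite -exprM natr_prod.
transitivity (\prod_(i < 3 * c) (- 4%:R * (n%:R - i%:R)) : k).
  apply: eq_bigr => i _; rewrite natrD natrM.
  by transitivity (- 2%:R * (2%:R * n%:R) + 4%:R * i%:R : k); [rewrite n2; ring | ring].
by rewrite big_split /= prodr_const card_ord.
Qed.

Variables a b e : k.
Hypotheses (e0 : e != 0) (e_crit : 3%:R * e ^+ 2 = - a).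

(** The cubic has the critical point [e]; expanding around it leaves one
    trinomial sum. *)
Lemma hasse_expansion : hasse p a b =
  \sum_(c < n.+1) ('C(n, c) * 'C(n - c, 2 * c))%:R *
    (b - 2%:R * e ^+ 3) ^+ c * (3%:R * e) ^+ (n - c - 2 * c).
Proof.
pose kap := b - 2%:R * e ^+ 3.
pose g := 'X^2 * ('X + (3%:R * e)%:P) + kap%:P.
have ef : cubic a b = g \Po ('X - e%:P).
  rewrite /g comp_polyD comp_polyM comp_Xn_poly comp_polyD comp_polyX !comp_polyC.
  have -> : a = - (3%:R * e ^+ 2) by rewrite e_crit opprK.
  by rewrite /cubic /kap; ring.
have sg : size g = 4%N.
  rewrite /g mulrDr -exprSr -addrA size_polyDl size_polyXn // ltnS.
  rewrite (leq_trans (size_polyD _ _)) // geq_max mulrC mul_polyC.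
  rewrite (leq_trans (size_scale_leq _ _)) ?size_polyXn //=.
  by rewrite (leq_trans (size_polyC_leq1 _)).
have g0 : g != 0 by rewrite -size_poly_eq0 sg.
have n1 : (0 < n)%N by move: p2n p_gt3; clear; lia.
rewrite /hasse ef -rmorphXn /= coef_pred_shift; last first.
  rewrite -[size _]prednK ?size_exp ?sg ?size_poly_gt0 ?expf_neq0 // ltnS -addnn.
  by move: p2n n1; clear; lia.
rewrite /g exprDn coef_sum.
have pn : (p.-1 = 2 * n)%N by move: p2n; clear; lia.
rewrite pn; apply: eq_bigr => c _; have cn : (c <= n)%N by rewrite -ltnS ltn_ord.
rewrite exprMn -exprM -polyC_exp coefMn coefMC coefXnM.
have -> : (2 * n < 2 * (n - c))%N = false by apply/negbTE; rewrite -leqNgt leq_mul2l leq_subr.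
have -> : (2 * n - 2 * (n - c) = 2 * c)%N by lia.
rewrite coef_XaddC_exp natrM -[_ *+ 'C(n - c, _)]mulr_natr -[_ *+ 'C(n, c)]mulr_natr.
rewrite -/kap; move: (kap ^+ c) ((3%:R * e) ^+ _) => A B.
by move: ('C(n, c)%:R : k) ('C(n - c, _)%:R : k) => C D; ring.
Qed.

Lemma hasse_series x : b - 2%:R * e ^+ 3 = - (64%:R * 27%:R) * e ^+ 3 * x ->
  hasse p a b = (3%:R * e) ^+ n * \sum_(c < p) (acoef c)%:R * x ^+ c.
Proof.
move=> ex; rewrite hasse_expansion ex mulr_sumr.
have np : (n.+1 <= p)%N by move: p2n; clear; lia.
rewrite -(big_mkord xpredT (fun c => (3%:R * e) ^+ n * ((acoef c)%:R * x ^+ c))).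
rewrite (big_cat_nat _ np) //= big_mkord [X in _ = _ + X]big1_seq ?addr0; last first.
  move=> c; rewrite mem_index_iota => /andP[_ /andP[nc cp]].
  by rewrite acoef_trinomial // bin_small // mul0n !mulr0 mul0r mulr0.
apply: eq_bigr => c _; have cp : (c < p)%N := leq_trans (ltn_ord c) np.
rewrite acoef_trinomial //.
have [h|h] := leqP (2 * c) (n - c); last first.
  by rewrite ['C(n - c, _)]bin_small // muln0 !mul0r mulr0 mul0r mulr0.
have -> : (3%:R * e) ^+ n = (3%:R * e) ^+ (n - c - 2 * c) * (3%:R * e) ^+ (3 * c).
  by rewrite -exprD; congr (_ ^+ _); lia.
have -> : (- (64%:R * 27%:R) * e ^+ 3 * x) ^+ c = (- 64%:R) ^+ c * (3%:R * e) ^+ (3 * c) * x ^+ c.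
  by rewrite exprM -!exprMn; congr (_ ^+ _); ring.
by ring.
Qed.

End HasseSeries.

(** * The field of rational functions and its derivation *)

Section Derivation.
Variables (k K : fieldType) (phi : {rmorphism {poly k} -> K}) (num den : K -> {poly k}).
Hypotheses (phi_inj : injective phi) (den_neq0 : forall x, den x != 0)
  (num_den : forall x, x = phi (num x) / phi (den x)).

Definition quotient_der (x : K) : K :=
  phi ((num x)^`() * den x - num x * (den x)^`()) / phi (den x) ^+ 2.

Lemma phi_neq0 N : N != 0 -> phi N != 0.
Proof. by apply: contraNneq => e; apply/eqP/phi_inj; rewrite e rmorph0. Qed.

Lemma quotient_derE N D : D != 0 ->
  quotient_der (phi N / phi D) = phi (N^`() * D - N * D^`()) / phi D ^+ 2.
Proof.
move=> D0; rewrite /quotient_der; set x := phi N / phi D.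
have D0' := phi_neq0 D0; have d0' := phi_neq0 (den_neq0 x).
have cross : num x * D = N * den x.
  apply: phi_inj; rewrite !rmorphM /=.
  have := num_den x; rewrite {1}/x => /eqP; rewrite eqr_div // => /eqP <-; ring.
have cross' : (num x)^`() * D + num x * D^`() = N^`() * den x + N * (den x)^`().
  by rewrite -!derivM cross.
move: (num x) (den x) d0' cross cross' => n d d0' cross cross'.
have key : (n^`() * d - n * d^`()) * D ^+ 2 = (N^`() * D - N * D^`()) * d ^+ 2.
  transitivity (d * D * (n^`() * D + n * D^`()) - d * D^`() * (n * D) - d^`() * D * (n * D)).
    by ring.
  by rewrite cross' cross; ring.
apply/eqP; rewrite eqr_div ?expf_neq0 //; apply/eqP.
by rewrite -!rmorphXn -!rmorphM /= key.
Qed.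

Lemma quotient_derD : {morph quotient_der : x y / x + y}.
Proof.
move=> x y; rewrite [x in LHS]num_den [y in LHS]num_den.
have x0 := phi_neq0 (den_neq0 x); have y0 := phi_neq0 (den_neq0 y).
have -> : phi (num x) / phi (den x) + phi (num y) / phi (den y) =
    phi (num x * den y + num y * den x) / phi (den x * den y).
  by rewrite rmorphD !rmorphM; field; rewrite x0 y0.
rewrite quotient_derE ?mulf_neq0 // derivD !derivM /quotient_der.
by rewrite !(rmorphB, rmorphD, rmorphM) /=; field; rewrite x0 y0.
Qed.

Lemma quotient_derM x y :
  quotient_der (x * y) = quotient_der x * y + x * quotient_der y.
Proof.
have x0 := phi_neq0 (den_neq0 x); have y0 := phi_neq0 (den_neq0 y).
have -> : x * y = phi (num x * num y) / phi (den x * den y).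
  by rewrite {1}[x]num_den {1}[y]num_den !rmorphM; field; rewrite x0 y0.
rewrite quotient_derE ?mulf_neq0 // !derivM.
rewrite [X in _ = _ * X + _]num_den [X in _ = _ + X * _]num_den /quotient_der.
by rewrite !(rmorphB, rmorphD, rmorphM) /=; field; rewrite x0 y0.
Qed.

Lemma quotient_der_of N : quotient_der (phi N) = phi N^`().
Proof.
rewrite -{1}[phi N]divr1 -(rmorph1 phi) quotient_derE ?oner_neq0 //.
by rewrite derivE mulr0 subr0 mulr1 rmorph1 expr1n divr1.
Qed.

End Derivation.

Section RationalFunctions.
Variable k : fieldType.
Local Notation K := {fraction {poly k}}.

Definition frac_num (x : K) : {poly k} := (repr x).1.
Definition frac_den (x : K) : {poly k} := (repr x).2.

Lemma frac_den_neq0 x : frac_den x != 0.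
Proof. exact: denom_ratioP. Qed.

Lemma frac_num_den (x : K) :
  x = FracField.tofrac (frac_num x) / FracField.tofrac (frac_den x).
Proof.
have d0 : FracField.tofrac (frac_den x) != 0 by rewrite tofrac_eq0 frac_den_neq0.
apply: (mulIf d0); rewrite mulfVK //; rewrite /frac_num /frac_den in d0 *.
rewrite -{1}[x]reprK; unlock FracField.tofrac; rewrite -[LHS]FracField.pi_mul.
apply/eqP; rewrite /FracField.mulf /= FracField.equivf_def.
by rewrite !numden_Ratio ?oner_eq0 ?mulr1 ?denom_ratioP //; apply/eqP; ring.
Qed.

Lemma tofrac_inj : injective (@FracField.tofrac {poly k}).
Proof. by move=> N D /eqP; rewrite tofrac_eq => /eqP. Qed.

Definition rational_functions : function_field k :=
  @FunctionField k K (@FracField.tofrac {poly k}) tofrac_inj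
    (fun x => ex_intro _ _ (ex_intro _ _ (conj (frac_den_neq0 x) (frac_num_den x))))
    _ (quotient_derD tofrac_inj frac_den_neq0 frac_num_den)
    (quotient_derM tofrac_inj frac_den_neq0 frac_num_den)
    (quotient_der_of tofrac_inj frac_den_neq0 frac_num_den).

End RationalFunctions.

Lemma closed_field_pchar p : prime p -> exists k : closedFieldType, p \in [pchar k].
Proof.
move=> pp; have [k [iota _]] := countable_algebraic_closure 'F_p.
exists k; rewrite (fmorph_pchar iota); exact: pchar_Fp.
Qed.

(** * Congruences between rationals *)

Section Congruences.
Variable p : nat.
Hypothesis pp : prime p.

Lemma pintegral_frac (n d : int) : coprimez p%:Z d -> pintegral p (n%:~R / d%:~R).
Proof.
move=> cpd; have d0 : d != 0.
  apply: contraTneq cpd => ->; rewrite /coprimez gcdz0 /=.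
  by have := prime_gt1 pp; clear; case: p => [|[|]].
have d0' : (d%:~R : rat) != 0 by rewrite intr_eq0.
have [x ex] : exists x : rat, n%:~R / d%:~R = x by eexists.
rewrite /pintegral ex.
have e : n * denq x = numq x * d.
  apply: (@intr_inj rat); rewrite !intrM numqE -ex mulrAC divfK //.
have : (denq x %| d)%Z.
  rewrite -(@Gauss_dvdzr _ (numq x)); last by rewrite coprimez_sym coprimezE coprime_num_den.
  by rewrite -e dvdz_mull.
by move: cpd; rewrite !coprimezE dvdzE => c1 c2; apply: coprime_dvdr c1.
Qed.

Lemma pintegral_int (n : int) : pintegral p n%:~R.
Proof. by rewrite -[n%:~R]divr1; apply: (@pintegral_frac n 1); rewrite coprimezE coprimen1. Qed.

Lemma pcongr_frac (m : nat) (N H z : int) : coprimez p%:Z H ->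
  (m%:Z %| N - z * H)%Z -> pcongr p m (N%:~R / H%:~R) z%:~R.
Proof.
move=> cH /dvdzP[q eq]; split; [exact: pintegral_frac | exact: pintegral_int |].
exists (q%:~R / H%:~R); first exact: pintegral_frac.
have H0 : (H%:~R : rat) != 0.
  rewrite intr_eq0; apply: contraTneq cH => ->; rewrite /coprimez gcdz0 /=.
  by have := prime_gt1 pp; clear; case: p => [|[|]].
apply: (mulIf H0); rewrite mulrBl divfK // mulrA divfK // -!intrM -intrB eq.
by rewrite mulrC intrM.
Qed.

Variables (p_gt3 : (3 < p)%N) (d e : int).
Hypothesis d_inv : d * (1024%:R * 27%:R) = 1 + (p ^ 2)%N%:Z * e.

Local Notation h := ((- 96%:R) ^+ 3 : int).

Lemma coprimez_base i : coprimez p%:Z (h ^+ i).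
Proof.
rewrite coprimezXr // coprimezXr // coprimezE /= prime_coprime //.
apply/negP; rewrite (_ : 96 = 2 ^ 5 * 3)%N //.
rewrite Euclid_dvdM // Euclid_dvdX // (dvdn_prime2 pp (isT : prime 2)) (dvdn_prime2 pp (isT : prime 3)).
by move: p_gt3; clear; case: p => [|[|[|[|]]]].
Qed.

Lemma binsumE : binsum p =
  (\sum_(c < p) (bcoef c)%:Z * h ^+ (p.-1 - c))%:~R / (h ^+ p.-1)%:~R.
Proof.
have [y ey] : exists y : rat, (- 96%:R) ^+ 3 = y by eexists.
have y0 : y != 0 by rewrite -ey expf_neq0 // oppr_eq0 pnatr_eq0.
have cast i : ((h ^+ i)%:~R : rat) = y ^+ i.
  by rewrite -ey; move: 96%N => n; rewrite !rmorphXn /= rmorphN /= rmorph_nat.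
have -> : binsum p = \sum_(c < p) (bcoef c)%:R / y ^+ c.
  by rewrite /binsum big_mkord; apply: eq_bigr => c _; congr (_ / _); rewrite -ey; exact: exprM.
rewrite cast rmorph_sum /= mulr_suml; apply: eq_bigr => c _.
have cp : (c <= p.-1)%N by rewrite -ltnS prednK ?prime_gt0.
rewrite [in RHS]intrM (cast (p.-1 - c)%N) -pmulrn.
have -> : y ^+ p.-1 = y ^+ (p.-1 - c) * y ^+ c by rewrite -exprD subnK.
by field; rewrite !expf_neq0.
Qed.

(** As [27648^2 = 864 * 96^3], the integer [- 864 d^2] is an inverse of [(-96)^3]
    modulo [p^2]. *)
Lemma binsum_int_cong :
  ((p ^ 2)%N%:Z %| \sum_(c < p) (bcoef c)%:Z * h ^+ (p.-1 - c) - binsum_int p d * h ^+ p.-1)%Z.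
Proof.
rewrite /binsum_int mulr_suml -sumrB; apply: rpred_sum => c _.
have cp : (c <= p.-1)%N by rewrite -ltnS prednK ?prime_gt0.
set y := - 864%:R * d ^+ 2.
have -> : (bcoef c)%:Z * h ^+ (p.-1 - c) - (bcoef c)%:Z * y ^+ c * h ^+ p.-1
  = - ((bcoef c)%:Z * h ^+ (p.-1 - c)) * ((y * h) ^+ c - 1).
  move: h => H; have -> : H ^+ p.-1 = H ^+ (p.-1 - c) * H ^+ c by rewrite -exprD subnK.
  by rewrite [(y * H) ^+ c]exprMn; move: (H ^+ _) (H ^+ c) (y ^+ c) => u v w; ring.
rewrite subrX1 dvdz_mull // dvdz_mulr //.
have -> : y * h = (d * (1024%:R * 27%:R)) ^+ 2 by rewrite /y; ring.
rewrite d_inv; apply/dvdzP; exists (2 * e + (p ^ 2)%N%:Z * e ^+ 2); ring.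
Qed.

Lemma binsum_pcongr (m : nat) (z : int) : (m %| p ^ 2)%N ->
  (m%:Z %| binsum_int p d - z)%Z -> pcongr p m (binsum p) z%:~R.
Proof.
move=> mp mz; rewrite binsumE; apply: pcongr_frac; first exact: coprimez_base.
rewrite -[X in (_ %| X)%Z](subrKA (binsum_int p d * h ^+ p.-1)) -mulrBl.
rewrite rpredD ?dvdz_mulr //.
by apply: (@dvdz_trans (p ^ 2)%N%:Z); rewrite ?binsum_int_cong.
Qed.

End Congruences.

(** * The sum as a Hasse invariant *)

Section Residue.
Variables (k : closedFieldType) (p : nat).
Hypothesis charp : p \in [pchar k].

Lemma intk_eq0_dvdz (z : int) : (z%:~R == 0 :> k) = (p%:Z %| z)%Z.
Proof. by rewrite (intk_eq0 charp) dvdzE. Qed.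

Lemma intk_expp (z : int) : (z%:~R : k) ^+ p = z%:~R.
Proof. by rewrite -(pFrobenius_autE charp) rmorph_int. Qed.

Lemma closed_sqrt (x : k) : exists w, w ^+ 2 = x.
Proof.
have [w ew] := @solve_monicpoly k 2 (fun i => if i == 0%N then x else 0) isT.
by exists w; rewrite ew !big_ord_recl big_ord0 /=; ring.
Qed.

(** Euler's criterion: a square root of [z] in the algebraic closure is fixed by
    the [p]-th power exactly when it is an integer modulo [p]. *)
Lemma euler_criterion (z : int) : p != 2%N -> (legendre z p)%:~R = (z%:~R : k) ^+ p./2.
Proof.
move=> p_neq2; have hp := half_p charp p_neq2.
rewrite /legendre; case: ifPn => [pz|npz].
  have -> : (z%:~R : k) = 0 by apply/eqP; rewrite intk_eq0_dvdz.
  by rewrite expr0n; case: (p./2) hp => // hp; move: (prime_gt1 (pcharf_prime charp)); rewrite -hp.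
have z0 : (z%:~R : k) != 0 by rewrite intk_eq0_dvdz.
have [w ew] := closed_sqrt z%:~R.
have w0 : w != 0 by apply: contraNneq z0 => w0; rewrite -ew w0 expr0n.
have wp : w ^+ p = z%:~R ^+ p./2 * w by rewrite -ew -exprM mulnC -exprSr hp.
have sq (c : nat) : (p%:Z %| c%:Z ^+ 2 - z)%Z = (c%:R ^+ 2 == w ^+ 2 :> k).
  by rewrite -intk_eq0_dvdz intrB rmorphXn /= -pmulrn subr_eq0 ew.
case: ifPn => [/existsP[c]|/existsPn nsq].
  rewrite sq eqf_sqr => ec; apply: (mulIf w0); rewrite -wp mul1r.
  case/orP: ec => /eqP ec; first by rewrite -ec (nat_expp charp).
  have -> : w = - c%:R by rewrite ec opprK.
  by rewrite -(pFrobenius_autE charp) rmorphN rmorph_nat.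
have z1 : (z%:~R ^+ p./2) ^+ 2 = 1 :> k.
  by apply: (mulIf z0); rewrite mul1r -exprM -exprSr hp intk_expp.
have /orP[/eqP e1|/eqP -> //] : (z%:~R ^+ p./2 == 1 :> k) || (z%:~R ^+ p./2 == -1 :> k).
  by rewrite -eqf_sqr z1 expr1n.
have /(fixed_prime_field charp)[c cp ec] : w ^+ p = w by rewrite wp e1 mul1r.
by have := nsq (Ordinal cp); rewrite /= sq -ec eqxx.
Qed.

Variables (p_gt3 : (3 < p)%N) (p_neq19 : p != 19%N) (d : int).
Hypothesis d_inv : (d%:~R : k) * (1024%:R * 27%:R) = 1.

Lemma natk_neq0 (q : nat) : prime q -> q != p -> (q%:R : k) != 0.
Proof.
by move=> qp qp'; rewrite -(dvdn_pcharf charp) dvdn_prime2 ?(pcharf_prime charp) // eq_sym.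
Qed.

Let p_neq2 : p != 2%N. Proof. by rewrite neq_ltn (ltn_trans _ p_gt3) ?orbT. Qed.
Let p_neq3 : p != 3%N. Proof. by rewrite neq_ltn p_gt3 orbT. Qed.
Let k2 : (2 : k) != 0 := k2_neq0 charp p_neq2.
Let k3 : (3 : k) != 0 := k3_neq0 charp p_neq3.

Lemma k19_neq0 : (19 : k) != 0.
Proof. by rewrite natk_neq0 // eq_sym. Qed.

Lemma sqrt114_neq0 (w : k) : w ^+ 2 = 114%:R -> w != 0.
Proof.
have k114 : (114%:R : k) != 0.
  by rewrite (_ : 114 = 2 * 3 * 19)%N // !natrM mulf_neq0 ?k19_neq0 // mulf_neq0 ?k2 ?k3.
by move=> w2; apply: contraNneq k114 => w0; rewrite -w2 w0 expr0n.
Qed.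

Lemma discriminant_sqrt (t : k) : t ^+ 2 = t - 5 -> (2%:R * t - 1) ^+ 2 = - 19%:R.
Proof.
move=> t_root; transitivity (4 * (t ^+ 2 - t) + 1); first by ring.
by rewrite t_root; ring.
Qed.

Lemma discriminant_sqrt_neq0 (t : k) : t ^+ 2 = t - 5 -> 2%:R * t - 1 != 0.
Proof.
by move/discriminant_sqrt => r2; apply: contraNneq k19_neq0 => r0; rewrite -oppr_eq0 -r2 r0 expr0n.
Qed.

(** The cubic has the critical point [e = - 4 (2 t - 1) / w], as
    [(2 t - 1)^2 = -19] and [w^2 = 114] make [3 e^2 = - 8]. *)
Lemma hasse_cm_series (t w : k) : t ^+ 2 = t - 5 -> w ^+ 2 = 114%:R ->
  hasse p 8 (cmB t) = (3%:R * (- 4%:R * (2%:R * t - 1) / w)) ^+ p./2 *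
    \sum_(c < p) (acoef c)%:R * (d%:~R * (32%:R - 3%:R * w)) ^+ c.
Proof.
move=> t_root w2; have w0 := sqrt114_neq0 w2; have r2 := discriminant_sqrt t_root.
have r0 := discriminant_sqrt_neq0 t_root; set r := 2%:R * t - 1 in r2 r0 *.
have ew : - 4%:R * r / w * w = - 4%:R * r by rewrite mulfVK.
have e0 : - 4%:R * r / w != 0.
  rewrite mulf_neq0 ?invr_eq0 // mulf_neq0 // oppr_eq0.
  by rewrite (_ : 4 = 2 * 2)%N // natrM mulf_neq0.
move: (- 4%:R * r / w) ew e0 => e ew e0.
have e_crit : 3%:R * e ^+ 2 = - 8%:R.
  apply: (mulIf (expf_neq0 2 w0)); rewrite -mulrA -exprMn ew exprMn r2 w2; ring.
apply: (hasse_series charp p_gt3 e0 e_crit).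
apply: (mulfI k3); apply: (mulfI k2).
transitivity (e * (32%:R - 3%:R * w)).
  have eB : cmB t = 2 * r by rewrite /cmB /r; ring.
  have -> : e * (32%:R - 3%:R * w) = 32%:R * e - 3%:R * (e * w) by ring.
  have -> : 2 * (3%:R * (cmB t - 2%:R * e ^+ 3)) = 6%:R * cmB t - 4%:R * e * (3%:R * e ^+ 2) by ring.
  by rewrite e_crit ew eB; ring.
transitivity (- (2%:R * 64%:R * 27%:R) * e * (3%:R * e ^+ 2) * (d%:~R * (32%:R - 3%:R * w))); last by ring.
rewrite e_crit; transitivity (e * (32%:R - 3%:R * w) * (d%:~R * (1024%:R * 27%:R))); last by ring.
by rewrite d_inv mulr1.
Qed.

Variables (s u m1 m2 : int).
Hypothesis T_eq : binsum_int p d = s ^+ 2 + 114%:R * u ^+ 2 + (p ^ 2)%N%:Z * m1.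
Hypothesis su_eq : 2%:R * s * u = (p ^ 2)%N%:Z * m2.
Hypothesis series_eq : forall w : k, w ^+ 2 = 114%:R ->
  \sum_(c < p) (acoef c)%:R * (d%:~R * (32%:R - 3%:R * w)) ^+ c = s%:~R + u%:~R * w.

(** When the Hasse invariant vanishes, so do both conjugate values of the
    series, hence [p] divides [s] and [u], and [p^2] divides the value of the
    sum, which is a quadratic form in [s] and [u]. *)
Lemma binsum_int_hasse0 (t : k) : t ^+ 2 = t - 5 -> hasse p 8 (cmB t) = 0 ->
  ((p ^ 2)%N%:Z %| binsum_int p d)%Z.
Proof.
move=> t_root h0; have [w w2] := closed_sqrt 114%:R.
have w0 := sqrt114_neq0 w2.
have r0 := discriminant_sqrt_neq0 t_root.
have val (v : k) : v != 0 -> v ^+ 2 = 114%:R -> s%:~R + u%:~R * v = 0.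
  move=> v0 v2; have := hasse_cm_series t_root v2; rewrite h0 series_eq //.
  move/esym/eqP; rewrite mulf_eq0 expf_eq0 => /orP[/andP[_]|/eqP //].
  rewrite mulf_eq0 (negPf k3) /= mulf_eq0 invr_eq0 (negPf v0) orbF mulf_eq0 (negPf r0) orbF.
  by rewrite oppr_eq0 (_ : 4 = 2 * 2)%N // natrM mulf_eq0 (negPf k2).
have v1 := val w w0 w2; have v2 : s%:~R - u%:~R * w = 0.
  by rewrite -mulrN val ?oppr_eq0 ?sqrrN.
have ps : (p%:Z %| s)%Z.
  rewrite -intk_eq0_dvdz; apply/eqP/(mulfI k2); rewrite mulr0.
  transitivity ((s%:~R + u%:~R * w) + (s%:~R - u%:~R * w)); first by ring.
  by rewrite v1 v2 addr0.
have pu : (p%:Z %| u)%Z.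
  rewrite -intk_eq0_dvdz; apply/eqP/(mulIf w0)/(mulfI k2); rewrite mul0r mulr0.
  transitivity ((s%:~R + u%:~R * w) - (s%:~R - u%:~R * w)); first by ring.
  by rewrite v1 v2 subr0.
have /dvdzP[s' es] := ps; have /dvdzP[u' eu] := pu.
apply/dvdzP; exists (s' ^+ 2 + 114%:R * u' ^+ 2 + m1).
by rewrite T_eq es eu -mulnn PoszM; ring.
Qed.

(** Modulo [p] the sum is the square of a value of the second-order series. The
    factor [3 e] that relates it to the Hasse invariant squares to
    [- 24 = - 6 * 2^2]. *)
Lemma binsum_int_hasse (t : k) : t ^+ 2 = t - 5 ->
  hasse p 8 (cmB t) ^+ 2 = (- 6%:R) ^+ p./2 * (binsum_int p d)%:~R.
Proof.
move=> t_root; have [w w2] := closed_sqrt 114%:R.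
have w0 := sqrt114_neq0 w2.
rewrite (hasse_cm_series t_root w2) series_eq // exprMn; congr (_ * _).
  rewrite -exprM mulnC exprM.
  have -> : (3%:R * (- 4%:R * (2%:R * t - 1) / w)) ^+ 2 = - 6%:R * 2 ^+ 2.
    apply: (mulIf (expf_neq0 2 w0)); rewrite -exprMn.
    have -> : 3%:R * (- 4%:R * (2%:R * t - 1) / w) * w = - 12%:R * (2%:R * t - 1) by field.
    have -> : (- 12%:R * (2%:R * t - 1)) ^+ 2 = 144%:R * (4 * (t ^+ 2 - t) + 1) by ring.
    by rewrite t_root w2; ring.
  rewrite exprMn -exprM mulnC; suff -> : (2 : k) ^+ (p./2 * 2) = 1 by rewrite mulr1.
  by apply: (mulIf k2); rewrite mul1r -exprSr (half_p charp p_neq2) (nat_expp charp).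
have p0 : ((p ^ 2)%N%:~R : k) = 0.
  by apply/eqP; rewrite intk_eq0_dvdz dvdzE /= dvdn_mulr // mulnn.
have su0 : 2 * s%:~R * u%:~R = 0 :> k.
  have := congr1 (fun z => z%:~R : k) su_eq; rewrite !intrM p0 mul0r => <-; ring.
rewrite T_eq !intrD !intrM p0 mul0r addr0.
transitivity (s%:~R ^+ 2 + u%:~R ^+ 2 * w ^+ 2 + 2 * s%:~R * u%:~R * w); first by ring.
by rewrite su0 w2; ring.
Qed.

End Residue.

(** * The congruences *)

(** Only the constant term of the sum is not divisible by 5. *)
Lemma binsum_int5 (d : int) : (5%:Z %| binsum_int 5 d - 1)%Z.
Proof.
rewrite /binsum_int big_ord_recl /= mulr1 addrAC /bcoef !muln0 bin0 subrr add0r.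
apply: rpred_sum => c _; rewrite dvdz_mulr // dvdzE /= /bcoef -mulnA dvdn_mull //.
by apply: dvdn_acoef => //=; move: (ltn_ord c); rewrite /bump /=; lia.
Qed.

Lemma inverse_mod_square p : prime p -> (3 < p)%N ->
  exists d e : int, d * (1024%:R * 27%:R) = 1 + (p ^ 2)%N%:Z * e.
Proof.
move=> pp p_gt3; have c : coprimez (2 ^ 10 * 3 ^ 3)%N%:Z (p ^ 2)%N%:Z.
  rewrite coprimezE /= coprime_pexpr // coprimeMl !coprime_pexpl // !prime_coprime //.
  by rewrite !dvdn_prime2 // !neq_ltn p_gt3 (ltn_trans _ p_gt3).
have /coprimezP[[d e] /= de] := c; exists d, (- e); move: de.
rewrite (PoszM (2 ^ 10)%N) (_ : (2 ^ 10)%N%:Z = 1024%:R) // (_ : (3 ^ 3)%N%:Z = 27%:R) //.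
by move: (p ^ 2)%N%:Z => q de; apply: (addIr (e * q)); rewrite de; ring.
Qed.

Theorem theorem4p4 (p : nat) (p_prime : prime p)
    (p_neq2 : p <> 2%N) (p_neq3 : p <> 3%N) (p_neq19 : p <> 19%N) :
  (legendre p%:Z 19 = - 1 -> pcongr p (p ^ 2)%N (binsum p) 0) /\
  (legendre p%:Z 19 = 1 ->
    (exists x y : int, 4 * p%:Z = x ^+ 2 + 19 * y ^+ 2) /\
    (forall x y : int, 4 * p%:Z = x ^+ 2 + 19 * y ^+ 2 ->
      pcongr p p (binsum p) ((legendre (- 6) p * x ^+ 2)%:~R))).
Proof.
have p_gt3 : (3 < p)%N.
  by move: p_neq2 p_neq3 (prime_gt1 p_prime); clear; case: p => [|[|[|[|]]]].
move/eqP: p_neq2 => p_neq2; move/eqP: p_neq3 => p_neq3; move/eqP: p_neq19 => p_neq19.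
have [d [e d_inv]] := inverse_mod_square p_prime p_gt3.
have [s [u [m1 [m2 [T_eq su_eq series_eq]]]]] := binsum_int_square p_prime p_gt3 d_inv.
have [k charp] := closed_field_pchar p_prime.
have FF := rational_functions k.
have dk : (d%:~R : k) * (1024%:R * 27%:R) = 1.
  have p0 : ((p ^ 2)%N%:~R : k) = 0.
    by apply/eqP; rewrite (intk_eq0_dvdz charp) dvdzE /= dvdn_mulr // mulnn.
  transitivity ((d * (1024%:R * 27%:R))%:~R : k); first by ring.
  by rewrite d_inv intrD intrM p0 mul0r addr0.
split=> [inert|split19].
  apply: (binsum_pcongr (z := 0) p_prime p_gt3 d_inv) => //; rewrite subr0.
  have [t t_root] : exists t : k, t ^+ 2 = t - 5.
    have [w w2] := closed_sqrt (- 19 : k); have k2 := k2_neq0 charp p_neq2.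
    exists ((1 + w) / 2); apply: (mulIf (expf_neq0 2 k2)); rewrite -exprMn divfK //.
    transitivity (1 + 2 * w + w ^+ 2); first by ring.
    by rewrite w2; field.
  apply: (binsum_int_hasse0 charp p_gt3 p_neq19 dk T_eq (series_eq k) t_root).
  apply: (hasse_inert charp p_neq2 FF t_root); apply/eqP => t_p.
  have [m [n e_p]] := represented charp t_root t_p.
  by apply: (@legendre19_eqN1 p (2 * m + n) n) inert; rewrite e_p norm_form_scaled.
have [t [t_root t_p]] := split_root charp (legendre19_eq1 split19).
split=> [|x y e_p].
  have [m [n e_p]] := represented charp t_root t_p.
  by exists (2 * m + n), n; rewrite e_p norm_form_scaled.
apply: (binsum_pcongr p_prime p_gt3 d_inv); first by rewrite dvdn_mulr // mulnn.
rewrite -(intk_eq0_dvdz charp) intrB intrM (euler_criterion charp _ p_neq2) subr_eq0.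
apply/eqP.
(* The prime 5 is the degree of the endomorphism; both sides are then computed. *)
have [p5|p_neq5] := eqVneq p 5%N.
  have [x2 y2] : x ^+ 2 = 1 /\ y ^+ 2 = 1.
    move: e_p; rewrite p5; clear => e_p.
    have y1 : (- 1 <= y) && (y <= 1) by apply/andP; split; nia.
    have [ey|y0] := eqVneq y 0; last first.
      have ey : y ^+ 2 = 1 by have [->|->] : y = 1 \/ y = -1 by lia.
      by split=> //; move: e_p; rewrite ey; lia.
    have /andP[x4 x4'] : (- 4 <= x) && (x <= 4) by apply/andP; split; nia.
    have : 0 <= (x + 4) * (4 - x) by rewrite mulr_ge0 ?subr_ge0 // -lerBlDr sub0r.
    by move: e_p; rewrite ey; lia.
  have T36 : (p%:Z %| binsum_int p d - (- 6) ^+ 2)%Z.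
    rewrite p5 (_ : _ - _ = (binsum_int 5 d - 1) - 5%:Z * 7); last by ring.
    by rewrite rpredB ?binsum_int5 ?dvdz_mulr.
  move: T36; rewrite -(intk_eq0_dvdz charp) intrB subr_eq0 => /eqP ->.
  by rewrite x2 mulr1 p5 rmorphXn.
have [m [ex norm_p]] := norm_form_of_scaled e_p.
have T2 (t' : k) : t' ^+ 2 = t' - 5 -> t' ^+ p = t' -> m%:~R + y%:~R * t' = 0 ->
    (binsum_int p d)%:~R = (- 6)%:~R ^+ p./2 * (x ^+ 2)%:~R :> k.
  move=> t'_root t'_p mult0.
  have := hasse_split charp p_neq2 p_neq3 p_neq19 p_neq5 FF t'_root t'_p (esym norm_p) mult0.
  rewrite (binsum_int_hasse charp p_gt3 p_neq19 dk T_eq su_eq (series_eq k) t'_root) -ex.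
  have -> : - 6%:R = (- 6)%:~R :> k by ring.
  move=> x2; rewrite [in RHS]rmorphXn /= -x2 mulrA -expr2 -exprM -[LHS]mul1r; congr (_ * _).
  have k6 : ((- 6)%:~R : k) != 0.
    rewrite (intk_eq0_dvdz charp) dvdzE /= (Euclid_dvdM 2 3) // !dvdn_prime2 //.
    by rewrite negb_or p_neq2.
  by apply: (mulIf k6); rewrite mul1r -exprSr (half_p charp p_neq2) (intk_expp charp).
(* As [p] is the norm of [m + y t], one of the conjugates vanishes in [k]. *)
have /eqP : (m%:~R + y%:~R * t) * (m%:~R + y%:~R * (1 - t)) = 0 :> k.
  transitivity ((m ^+ 2 + m * y)%:~R - y%:~R ^+ 2 * (t ^+ 2 - t) : k); first by ring.
  rewrite t_root; transitivity ((m ^+ 2 + m * y + 5 * y ^+ 2)%:~R : k); first by ring.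
  by rewrite -norm_p; apply/eqP; rewrite (intk_eq0_dvdz charp) dvdzz.
rewrite mulf_eq0 => /orP[] /eqP mult0; first exact: (T2 t).
apply: (T2 (1 - t)) => //.
  by transitivity (1 - 2 * t + t ^+ 2); [ring | rewrite t_root; ring].
by rewrite -(pFrobenius_autE charp) rmorphB rmorph1 /= pFrobenius_autE t_p.
Qed.
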